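(* Let $N\ge 1$ be an integer and $0<s<1$. If $N<10s$, then there is no stable solution $u$ of the fractional Gelfand equation $$(-\Delta)^s u=e^u \quad\text{in }\mathbb{R}^N .$$
   Context: Let $\mathcal L_s(\mathbb{R}^N)=\{u\in L^1_{\rm loc}(\mathbb{R}^N):\int_{\mathbb{R}^N}\frac{|u(x)|}{(1+|x|)^{N+2s}}\,dx<\infty\}$. The fractional Laplacian is defined by $$(-\Delta)^s u(x)=c_{N,s}\lim_{\varepsilon\to0}\int_{\mathbb{R}^N\setminus B(x,\varepsilon)}\frac{u(x)-u(\xi)}{|x-\xi|^{N+2s}}\,d\xi,$$ where $B(x,\varepsilon)=\{y\in\mathbb{R}^N:|y-x|<\varepsilon\}$ and $c_{N,s}>0$ is the usual normalization constant (so that $(-\Delta)^s$ has Fourier symbol $|\xi|^{2s}$), namely $c_{N,s}=\frac{4^s\,\Gamma(N/2+s)}{\pi^{N/2}|\Gamma(-s)|}$. It is well defined at every point for $u\in C^{2\sigma}(\mathbb{R}^N)\cap\mathcal L_s(\mathbb{R}^N)$ with some $\sigma>s$. Here $C^{2\sigma}(\mathbb{R}^N)$ is the (local) Hölder space of order $2\sigma$: functions of class $C^{k}$ whose $k$-th order derivatives are locally $\gamma$-Hölder continuous, where $2\sigma=k+\gamma$, $k\in\mathbb{N}_0$, $\gamma\in(0,1]$. A solution of $(-\Delta)^s u=e^u$ in $\mathbb{R}^N$ means a (real-valued) function $u\in C^{2\sigma}(\mathbb{R}^N)\cap\mathcal L_s(\mathbb{R}^N)$ for some $\sigma>s$ satisfying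 the equation at every point of $\mathbb{R}^N$. A solution $u$ is called stable if $$\int_{\mathbb{R}^N}e^u\phi^2\,dx\le\frac{c_{N,s}}2\int_{\mathbb{R}^N}\int_{\mathbb{R}^N}\frac{(\phi(x)-\phi(y))^2}{|x-y|^{N+2s}}\,dx\,dy\quad\text{for all }\phi\in C^1_c(\mathbb{R}^N).$$ *)

(* Defs.v *)
From HB Require Import structures.
From mathcomp Require Import all_boot all_order all_algebra.
From mathcomp Require Import all_classical all_reals all_analysis.

Set Implicit Arguments.
Unset Strict Implicit.
Unset Printing Implicit Defensive.

Import Order.TTheory GRing.Theory Num.Theory.
Import numFieldNormedType.Exports.

Local Open Scope classical_set_scope.
Local Open Scope ring_scope.

(* R^N is 'rV[R]_N. Its sigma-algebra is the product one (the smallest one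
   making the coordinates measurable), which is the Borel sigma-algebra. *)
Section rV_measurable.
Context (R : realType) (n : nat).

Definition rV_coord (i : 'I_n) (x : 'rV[R]_n) : measurableTypeR R := x ord0 i.

Let rV_set0 : g_sigma_preimage rV_coord set0.
Proof. exact: sigma_algebra0. Qed.

Let rV_setC A : g_sigma_preimage rV_coord A -> g_sigma_preimage rV_coord (~` A).
Proof. exact: sigma_algebraC. Qed.

Let rV_bigcup (F : _^nat) : (forall i, g_sigma_preimage rV_coord (F i)) ->
  g_sigma_preimage rV_coord (\bigcup_i (F i)).
Proof. exact: sigma_algebra_bigcup. Qed.

HB.instance Definition _ := @isMeasurable.Build
  (measure_tuple_display default_measure_display)
  'rV[R]_n (g_sigma_preimage rV_coord) rV_set0 rV_setC rV_bigcup.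

End rV_measurable.

Lemma measurable_rV_coord (R : realType) (n : nat) (i : 'I_n) :
  measurable_fun [set: 'rV[R]_n] (@rV_coord R n i).
Proof.
move=> _ Y mY; rewrite setTI; apply: sub_sigma_algebra => /=.
rewrite -bigcup_seq/=; exists i => /=; first by rewrite mem_index_enum.
by exists Y => //; rewrite setTI.
Qed.

Lemma measurable_fun_rVP (R : realType) (n : nat) d (T : measurableType d)
    (f : T -> 'rV[R]_n) :
  (forall i, measurable_fun [set: T] (@rV_coord R n i \o f)) ->
  measurable_fun [set: T] f.
Proof.
move=> mf _ A mA; rewrite setTI.
have : g_sigma_preimage (fun i => @rV_coord R n i \o f) `<=` measurable.
  apply: smallest_sub; first exact: sigma_algebra_measurable.
  rewrite -bigcup_seq => B [i _ [C mC <-]].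
  exact: (mf i measurableT C mC).
apply; rewrite g_sigma_preimage_comp; exists A => //.
by rewrite setTI.
Qed.

Definition rV_cons (R : realType) (n : nat)
    (p : measurableTypeR R * 'rV[R]_n) : 'rV[R]_n.+1 :=
  row_mx (p.1 : R)%:M p.2 : 'rV[R]_(1 + n).

Definition rV_uncons (R : realType) (n : nat) (x : 'rV[R]_n.+1) :
    measurableTypeR R * 'rV[R]_n :=
  (x ord0 ord0, rsubmx (x : 'rV[R]_(1 + n))).

Lemma rV_unconsK (R : realType) (n : nat) :
  cancel (@rV_uncons R n) (@rV_cons R n).
Proof.
move=> x; rewrite /rV_cons /rV_uncons /= -[RHS](@hsubmxK _ 1 1 n).
rewrite (_ : _%:M = lsubmx (x : 'rV[R]_(1 + n)))//.
apply/matrixP => i j; rewrite !mxE !ord1 eqxx mulr1n.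
by congr (x _ _); apply/val_inj.
Qed.

Lemma rV_consK (R : realType) (n : nat) :
  cancel (@rV_cons R n) (@rV_uncons R n).
Proof.
move=> [x v]; rewrite /rV_cons /rV_uncons /= row_mxKr; congr pair.
transitivity (((x : R)%:M : 'M[R]_1) ord0 ord0); last by rewrite mxE eqxx mulr1n.
rewrite -(row_mxEl (x : R)%:M v); congr (row_mx _ _ _ _).
exact/val_inj.
Qed.

Lemma measurable_rV_cons (R : realType) (n : nat) :
  measurable_fun setT (@rV_cons R n).
Proof.
apply: measurable_fun_rVP => i; rewrite -[i]/(i : 'I_(1 + n)).
case: (splitP (i : 'I_(1 + n))) => j ij.
  have -> : rV_coord i \o @rV_cons R n = fst.
    apply/funext => p; rewrite /= /rV_coord /rV_cons.
    transitivity (((p.1 : R)%:M : 'M[R]_1) ord0 j); last first.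
      by rewrite mxE !ord1 eqxx mulr1n.
    rewrite -(row_mxEl (p.1 : R)%:M p.2); congr (row_mx _ _ _ _).
    exact/val_inj.
  exact: measurable_fst.
have -> : rV_coord i \o @rV_cons R n = rV_coord j \o snd.
  apply/funext => p; rewrite /= /rV_coord /rV_cons.
  rewrite -(row_mxEr (p.1 : R)%:M p.2); congr (row_mx _ _ _ _).
  exact/val_inj.
by apply: measurableT_comp; [exact: measurable_rV_coord|exact: measurable_snd].
Qed.

Lemma measurable_rV_uncons (R : realType) (n : nat) :
  measurable_fun setT (@rV_uncons R n).
Proof.
apply/measurable_fun_pairP; split; first exact: measurable_rV_coord.
apply: measurable_fun_rVP => j.
rewrite (_ : _ \o _ = rV_coord (rshift 1 j : 'I_n.+1)).
  exact: measurable_rV_coord.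
by apply/funext => x; rewrite /= /rV_coord mxE.
Qed.

Section lebesgue_step.
Local Open Scope ereal_scope.
Context (R : realType) (n : nat).
Variable m : {sigma_finite_measure set 'rV[R]_n -> \bar R}.

Definition lebesgue_step : set 'rV[R]_n.+1 -> \bar R :=
  pushforward (@lebesgue_measure R \x m) (@rV_cons R n).

Let m_preimage (A : set 'rV[R]_n.+1) : measurable A ->
  measurable (@rV_cons R n @^-1` A).
Proof.
by move=> mA; rewrite -[X in measurable X]setTI; exact: measurable_rV_cons.
Qed.

Let step0 : lebesgue_step set0 = 0.
Proof. by rewrite /lebesgue_step /pushforward preimage_set0 measure0. Qed.

Let step_ge0 A : 0 <= lebesgue_step A.
Proof. by rewrite /lebesgue_step /pushforward measure_ge0. Qed.

Let step_sigma_additive : semi_sigma_additive lebesgue_step.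
Proof.
move=> F mF tF mUF; rewrite /lebesgue_step /pushforward preimage_bigcup.
apply: measure_semi_sigma_additive.
- by move=> k; exact: m_preimage.
- apply/trivIsetP => /= i j _ _ ij; rewrite -preimage_setI.
  by move/trivIsetP : tF => /(_ _ _ _ _ ij) ->//; rewrite preimage_set0.
- by rewrite -preimage_bigcup; exact: m_preimage.
Qed.

HB.instance Definition _ := isMeasure.Build _ _ _
  lebesgue_step step0 step_ge0 step_sigma_additive.

Let step_sigma_finite : sigma_finite setT lebesgue_step.
Proof.
have /sigma_finiteP[F [FT ndF Foo]] := sigma_finiteT (@lebesgue_measure R).
have /sigma_finiteP[G [GT ndG Goo]] := sigma_finiteT m.
exists (fun k => @rV_uncons R n @^-1` (F k `*` G k)).
  rewrite -preimage_bigcup (_ : \bigcup_k _ = setT) ?preimage_setT//.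
  rewrite -subTset => -[x v] _.
  have [i _ Fix] : (\bigcup_k F k) x by rewrite -FT.
  have [j _ Gjv] : (\bigcup_k G k) v by rewrite -GT.
  exists (maxn i j) => //; split => /=.
  - by move: x Fix; exact/subsetPset/ndF/leq_maxl.
  - by move: v Gjv; exact/subsetPset/ndG/leq_maxr.
move=> k; have [mF Fkoo] := Foo k; have [mG Gkoo] := Goo k; split.
  rewrite -[X in measurable X]setTI; apply: measurable_rV_uncons => //.
  exact: measurableX.
rewrite /lebesgue_step /pushforward -comp_preimage.
rewrite (_ : _ \o _ = id); last by apply/funext => p; exact: rV_consK.
by rewrite preimage_id product_measure1E// lte_mul_pinfty// ge0_fin_numE.
Qed.

HB.instance Definition _ := Measure_isSigmaFinite.Build _ _ _
  lebesgue_step step_sigma_finite.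

End lebesgue_step.

(* Lebesgue measure on R^N, as an N-fold product; on the one-point space R^0
   it is the Dirac mass. *)
Fixpoint lebesgueN (R : realType) (n : nat) :
    {sigma_finite_measure set 'rV[R]_n -> \bar R} :=
  match n with
  | 0 => dirac (0 : 'rV[R]_0)
  | n'.+1 => lebesgue_step (lebesgueN R n')
  end.

Arguments lebesgueN {R} n.

Section fractional_gelfand.
Context {R : realType}.

(* The library norm of 'rV[R]_N is the sup norm. *)
Definition eucl (N : nat) (x : 'rV[R]_N) : R :=
  Num.sqrt (\sum_(i < N) x ord0 i ^+ 2).

Definition eball (N : nat) (x : 'rV[R]_N) (e : R) : set 'rV[R]_N :=
  [set y | eucl (y - x) < e].

(* Euler's integral, meant for 0 < x. *)
Definition Gamma_pos (x : R) : R :=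
  \int[lebesgue_measure]_(t in `]0, +oo[) (t `^ (x - 1) * expR (- t)).

(* Gamma function on the reals: Euler's integral is extended to x <= 0 by
   Gamma (x + 1) = x * Gamma x, with k the least natural number such that
   0 < x + k. At the poles the value is the junk 0. *)
Definition Gamma (x : R) : R :=
  let k := if 0 < x then 0%N else (Num.truncn (- x)).+1 in
  Gamma_pos (x + k%:R) / \prod_(i < k) (x + i%:R).

Definition frac_const (N : nat) (s : R) : R :=
  4 `^ s * Gamma (N%:R / 2 + s) / (pi `^ (N%:R / 2) * `|Gamma (- s)|).

Definition in_Ls (N : nat) (s : R) (u : 'rV[R]_N -> R) : Prop :=
  [/\ measurable_fun setT u,
      forall K : set 'rV[R]_N, compact K ->
        (\int[lebesgueN N]_(x in K) `|u x|%:E < +oo)%E &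
      (\int[lebesgueN N]_x (`|u x| / (1 + eucl x) `^ (N%:R + 2 * s))%:E
        < +oo)%E].

(* The integral over the complement of B(x, e) in the definition of the
   fractional Laplacian, with its constant. *)
Definition frac_lap_trunc (N : nat) (s : R) (u : 'rV[R]_N -> R)
    (x : 'rV[R]_N) (e : R) : R :=
  frac_const N s *
  \int[lebesgueN N]_(xi in ~` eball x e)
    ((u x - u xi) / eucl (x - xi) `^ (N%:R + 2 * s)).

(* (- Delta)^s u (x) = l : the limit exists and is l. *)
Definition is_frac_lap (N : nat) (s : R) (u : 'rV[R]_N -> R) (x : 'rV[R]_N)
    (l : R) : Prop :=
  frac_lap_trunc s u x e @[e --> 0^'+] --> l.

Definition basis_vec (N : nat) (i : 'I_N) : 'rV[R]_N := delta_mx ord0 i.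

Definition partial (N : nat) (i : 'I_N) (f : 'rV[R]_N -> R) : 'rV[R]_N -> R :=
  fun x => 'D_(basis_vec i) f x.

Fixpoint classC (N k : nat) (f : 'rV[R]_N -> R) : Prop :=
  continuous f /\
  match k with
  | 0 => True
  | k'.+1 => forall i, (forall x, derivable f x (basis_vec i)) /\
                       classC k' (partial i f)
  end.

Definition locally_holder (N : nat) (g : R) (f : 'rV[R]_N -> R) : Prop :=
  forall x : 'rV[R]_N, exists C : R, exists2 U, nbhs x U &
    forall y z, U y -> U z -> `|f y - f z| <= C * eucl (y - z) `^ g.

(* C^a (R^N), for a > 0. *)
Definition holder_space (N : nat) (a : R) (f : 'rV[R]_N -> R) : Prop :=
  exists (k : nat) (g : R),
    [/\ 0 < g <= 1, a = k%:R + g, classC k f &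
        forall is_ : k.-tuple 'I_N,
          locally_holder g (foldr (@partial N) f is_)].

Definition is_solution (N : nat) (s : R) (u : 'rV[R]_N -> R) : Prop :=
  [/\ exists2 sigma, s < sigma & holder_space (2 * sigma) u,
      in_Ls s u &
      forall x, is_frac_lap s u x (expR (u x))].

Definition C1c (N : nat) (phi : 'rV[R]_N -> R) : Prop :=
  classC 1 phi /\ compact (closure [set x | phi x != 0]).

Definition is_stable (N : nat) (s : R) (u : 'rV[R]_N -> R) : Prop :=
  forall phi : 'rV[R]_N -> R, C1c phi ->
    (\int[lebesgueN N]_x (expR (u x) * phi x ^+ 2)%:E <=
     (frac_const N s / 2)%:E *
     \int[lebesgueN N]_x \int[lebesgueN N]_y
       ((phi x - phi y) ^+ 2 / eucl (x - y) `^ (N%:R + 2 * s))%:E)%E.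

End fractional_gelfand.

(* Main.v *)
(* Write p = N + 2s.  Symmetrising the truncated operator and letting the
   truncation tend to 0 gives the weak form of the equation as an inequality,
   tested against psi = e^(m u) phi^2; an elementary pointwise inequality
   bounds (x, y) |-> (e^(m u / 2) phi (x) - e^(m u / 2) phi (y))^2 from above by
   the resulting pairing, up to e^(m u) (phi (x) - phi (y))^2.  Stability,
   extended from C^1 to continuous phi by averaging along the coordinate
   directions, then yields for 0 <= m < 4 a Caccioppoli inequality
     int e^((m+1) u) phi^2 <= C int e^(m u)(x) int (phi x - phi y)^2 / |x-y|^p.
   For a cutoff phi at scale r the inner integral is O(r^(-2s)), and
   O(r^N |x|^(-p)) far away, so int_(|x|<=r) e^(m u) = O(r^(N - 2sm)) passes
   from m to m + 1.  Starting at m = 0 this reaches every m in [4, 5); since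
   N < 10s some such m has N < 2sm, and r -> oo contradicts e^(m u) > 0. *)
Require Import Defs.
From mathcomp Require Import all_boot all_order all_algebra.
From mathcomp Require Import all_classical all_reals all_analysis.
From mathcomp Require Import measurable_realfun ring lra.

Set Implicit Arguments.
Unset Strict Implicit.
Unset Printing Implicit Defensive.

Import Order.TTheory GRing.Theory Num.Theory.
Import numFieldNormedType.Exports.
Local Open Scope classical_set_scope.
Local Open Scope ring_scope.

(** * Lebesgue measure on row vectors *)

(** The threshold 4 comes from absorption. With [al = m / 2], stability bounds the integral of
    [e^((m+1) u) phi^2] by the energy of [e^(al u) phi], and the pointwise inequality bounds
    [1 + al / 2] times that energy by [al] times the same integral plus an error. Absorbing needs
    [al < 1 + al / 2], that is [m < 4]; the last step then yields exponents below 5, and [2 s] times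
    5 is [10 s]. Two obstacles shape the rest. For small [s] a solution may be merely Hölder
    continuous, so [e^(m u / 2) phi] need not be C^1 and cannot be inserted directly into the
    stability condition. Averaging never increases the energy, so Fatou's lemma on the other side is
    enough to remove it. Moreover the product of the differences of [u] and [psi] has no sign and is
    not known to be integrable against the singular kernel. The weak form is therefore stated
    between nonnegative integrands: one passes to the limit by monotone convergence, the other is
    bounded by its untruncated integral, which may be infinite. *)

Section rV_norm.
Context {R : realType} {N : nat}.
Implicit Types x y : 'rV[R]_N.

Lemma rV_norm_le x (r : R) : 0 <= r ->
  (`|x| <= r) <-> (forall i, `|x ord0 i| <= r).
Proof.
move=> r0; rewrite /Num.norm/= mx_normrE; split.
  by move=> /bigmax_leP[_ h] i; exact: (h (ord0, i)).
move=> h; apply/bigmax_leP; split => // -[i j] _ /=.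
by rewrite (ord1 i); exact: h.
Qed.

Lemma rV_norm_lt x (r : R) : 0 < r ->
  (`|x| < r) <-> (forall i, `|x ord0 i| < r).
Proof.
move=> r0; rewrite /Num.norm/= mx_normrE; split.
  by move=> /bigmax_ltP[_ h] i; exact: (h (ord0, i)).
move=> h; apply/bigmax_ltP; split => // -[i j] _ /=.
by rewrite (ord1 i); exact: h.
Qed.

Lemma rV_coord_le x i : `|x ord0 i| <= `|x|.
Proof. by move: i; apply/rV_norm_le. Qed.

Lemma eucl_ge0 x : 0 <= eucl x.
Proof. exact: sqrtr_ge0. Qed.

Lemma rV_norm_le_eucl x : `|x| <= eucl x.
Proof.
apply/rV_norm_le; first exact: eucl_ge0.
move=> i; rewrite -sqrtr_sqr ler_wsqrtr// (bigD1 i)//= lerDl.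
by apply: sumr_ge0 => j _; exact: sqr_ge0.
Qed.

Lemma eucl_le_rV_norm x : eucl x <= N%:R * `|x|.
Proof.
rewrite -[leRHS]ger0_norm ?mulr_ge0// -sqrtr_sqr ler_wsqrtr//.
rewrite exprMn; apply: (@le_trans _ _ (\sum_(i < N) `|x| ^+ 2)).
  apply: ler_sum => i _.
  by rewrite -real_normK ?num_real// lerXn2r ?nnegrE// rV_coord_le.
rewrite sumr_const card_ord -[leLHS]mulr_natl; apply: ler_wpM2r; first exact: sqr_ge0.
by rewrite -natrX ler_nat; case: (N) => // n; rewrite leq_pmull.
Qed.

Lemma euclN x : eucl (- x) = eucl x.
Proof. by rewrite /eucl; congr Num.sqrt; apply: eq_bigr => i _; rewrite mxE sqrrN. Qed.

Lemma eucl_distC x y : eucl (x - y) = eucl (y - x).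
Proof. by rewrite -euclN opprB. Qed.

Lemma eucl_eq0 x : eucl x = 0 -> x = 0.
Proof.
move=> x0; apply/eqP; rewrite -normr_eq0 eq_le normr_ge0 andbT -x0.
exact: rV_norm_le_eucl.
Qed.

Lemma eucl0 : eucl (0 : 'rV[R]_N) = 0.
Proof.
by rewrite /eucl big1 ?sqrtr0// => i _; rewrite mxE expr0n.
Qed.

End rV_norm.

Section rV_borel.
Context {R : realType} {N : nat}.
Implicit Types (x y : 'rV[R]_N).

Lemma measurable_rV_ball x (r : R) : measurable (ball x r).
Proof.
have [r0|r0] := lerP r 0.
  have -> : ball x r = set0; last exact: measurable0.
  rewrite -subset0 => y.
  by rewrite mx_norm_ball /ball_/= => xy; move: (le_lt_trans (normr_ge0 _) xy); rewrite ltNge r0.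
have -> : ball x r = \bigcap_(i in [set: 'I_N]) (@rV_coord R N i @^-1` (ball (x ord0 i) r)).
  apply/seteqP; split => y.
    by rewrite mx_norm_ball /ball_/= => /(rV_norm_lt _ r0) h i _ /=;
      have := h i; rewrite !mxE.
  rewrite mx_norm_ball /ball_/= => h; apply/(rV_norm_lt _ r0) => i.
  by have := h i I; rewrite /ball/= !mxE.
apply: fin_bigcap_measurable => // i _.
rewrite -[X in measurable X]setTI; apply: (@measurable_rV_coord R N i) => //.
exact: measurable_ball.
Qed.

(** The sigma-algebra is generated by the coordinates. Sup-norm balls are finite intersections of
    coordinate slabs, and those with rational centre and radius form a countable base. *)
Lemma open_measurable_rV (A : set 'rV[R]_N) : open A -> measurable A.
Proof.
move=> oA.
pose Q (q : 'rV[rat]_N * rat) : set 'rV[R]_N :=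
  ball (map_mx (fun a : rat => ratr a : R) q.1) (ratr q.2 : R).
have -> : A = \bigcup_(q in [set q | Q q `<=` A]) Q q.
  apply/seteqP; split => [x Ax|x [q]]; last exact.
  have /nbhs_ballP[e /= e0 eA] : nbhs x A by exact: open_nbhs_nbhs.
  (* A rational radius below [e / 2] and a rational centre within that radius of [x] give a ball
     that contains [x] and lies in its [e]-ball. *)
  have [r] := rat_in_itvoo (divr_gt0 e0 (ltr0n R 2)).
  rewrite in_itv/= => /andP[r0 re].
  have h i : exists q : rat, `|x ord0 i - ratr q| < ratr r.
    have [] := @rat_in_itvoo _ (x ord0 i - ratr r) (x ord0 i + ratr r).
      by rewrite ltrD2l gtrN.
    move=> q; rewrite in_itv/= => /andP[q1 q2]; exists q.
    by rewrite ltr_norml; apply/andP; split; lra.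
  have /choice[q qh] := h.
  exists (\row_i q i, r) => /=; last first.
    rewrite /Q mx_norm_ball /ball_/=; apply/rV_norm_lt => // i.
    by rewrite !mxE distrC.
  apply: subset_trans eA => y; rewrite /Q mx_norm_ball /ball_/=.
  move=> /(rV_norm_lt _ r0) hy; apply/rV_norm_lt => // i.
  have := hy i; have := qh i; rewrite !mxE => h1 h2.
  rewrite -(subrK (ratr (q i)) (x ord0 i)) -addrA.
  by rewrite (le_lt_trans (ler_normD _ _))//; lra.
rewrite bigcup_mkcond; apply: countable_bigcupT_measurable; first exact: countableP.
by move=> q; case: ifP => // _; exact: measurable_rV_ball.
Qed.

Lemma continuous_measurable_rV (f : 'rV[R]_N -> R) :
  continuous f -> measurable_fun setT f.
Proof.
move=> cf; apply: (measurability _ (@RGenOInfty.measurableE R)).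
move=> _ [_ [a ->] <-]; rewrite setTI; apply: open_measurable_rV.
by apply: open_comp => [x _|]; [exact: cf|exact: interval_open].
Qed.

Lemma measurable_rV_norm : measurable_fun setT (fun x : 'rV[R]_N => `|x|).
Proof. by apply: continuous_measurable_rV; exact: norm_continuous. Qed.

Lemma measurable_rV_cube (r : R) : measurable [set x : 'rV[R]_N | `|x| <= r].
Proof.
have := measurable_rV_norm measurableT (measurable_itv `]-oo, r]).
by rewrite setTI; congr measurable; apply/seteqP; split => x /=; rewrite in_itv.
Qed.

Lemma measurable_eucl : measurable_fun setT (@eucl R N).
Proof.
apply: (measurableT_comp (f := @Num.sqrt R)).
  exact: continuous_measurable_fun (@sqrt_continuous R).
apply: measurable_sum => i.
by apply: measurable_funX; exact: measurable_rV_coord.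
Qed.

End rV_borel.

(** * Lebesgue integration by induction on the dimension *)

Section lebesgueN_theory.
Local Open Scope ereal_scope.
Context {R : realType}.
Local Notation mu1 := (@lebesgue_measure R).

(** Tonelli's theorem unfolds the recursive pushforward; the invariance under translation and
    reflection below is proved by induction through it. *)
Lemma ge0_integral_lebesgueNS (n : nat) (f : 'rV[R]_n.+1 -> \bar R) :
  measurable_fun setT f -> (forall x, 0 <= f x) ->
  \int[lebesgueN n.+1]_x f x =
  \int[mu1]_t \int[lebesgueN n]_v f (rV_cons (t, v)).
Proof.
move=> mf f0.
rewrite [LHS](_ : _ = \int[pushforward (mu1 \x lebesgueN n) (@rV_cons R n)]_x f x)//.
rewrite ge0_integral_pushforward//; last exact: measurable_rV_cons.
rewrite preimage_setT fubini_tonelli1//.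
- by apply: measurableT_comp => //; exact: measurable_rV_cons.
- by move=> x; exact: f0.
Qed.

(** The pushforward by a translation gives half-open intervals their length, and Lebesgue measure is
    the only measure that does. *)
Lemma ge0_integral_lebesgue_shift (a : R) (f : R -> \bar R) :
  measurable_fun setT f -> (forall x, 0 <= f x) ->
  \int[mu1]_t f (t + a)%R = \int[mu1]_t f t.
Proof.
move=> mf f0.
have mshift : measurable_fun setT (fun t : measurableTypeR R => (t + a)%R : measurableTypeR R).
  exact: measurable_funD.
rewrite [RHS](eq_measure_integral (pushforward mu1
    (fun t : measurableTypeR R => (t + a)%R : measurableTypeR R))); last first.
  move=> A mA _.
  apply: lebesgue_measure_unique => // _ [[b c]] _ <-.
  rewrite /= /pushforward.
  have -> : (fun t : measurableTypeR R => (t + a)%R : measurableTypeR R) @^-1` `]b, c]%classic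
     = `](b - a)%R, (c - a)%R]%classic.
    by apply/seteqP; split => x /=; rewrite !in_itv/= ltrBlDr lerBrDr.
  rewrite !lebesgue_measure_itv/= !lte_fin ltrD2r; case: ifP => // _.
  by rewrite -!EFinD; congr (_%:E); lra.
by rewrite ge0_integral_pushforward//.
Qed.

Lemma ge0_integral_lebesgueN1 (f : R -> \bar R) :
  measurable_fun setT f -> (forall x, 0 <= f x) ->
  \int[mu1]_t f (- t)%R = \int[mu1]_t f t.
Proof.
move=> mf f0.
rewrite [RHS](eq_measure_integral (pushforward mu1
    (-%R : _ -> measurableTypeR R))); last first.
  by move=> A mA _; rewrite -[LHS]lebesgue_measureN.
by rewrite ge0_integral_pushforward.
Qed.

Lemma rV_cons0E (n : nat) (p : R * 'rV[R]_n) : rV_cons p ord0 ord0 = p.1.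
Proof. by have /(congr1 fst) := rV_consK p. Qed.

Lemma rV_consSE (n : nat) (p : R * 'rV[R]_n) (j : 'I_n) :
  rV_cons p ord0 (lift ord0 j) = p.2 ord0 j.
Proof.
have /(congr1 snd)/= := rV_consK p => <-; rewrite [RHS]mxE.
by congr (rV_cons p _ _); exact/val_inj.
Qed.

Lemma rV_consD (n : nat) (a b : R) (v w : 'rV[R]_n) :
  rV_cons (a + b, v + w)%R = (rV_cons (a, v) + rV_cons (b, w))%R.
Proof.
by apply/rowP => i; case: (unliftP ord0 i) => [j ->|->]; rewrite [RHS]mxE
  ?rV_consSE ?rV_cons0E/= ?mxE.
Qed.

Lemma rV_consN (n : nat) (a : R) (v : 'rV[R]_n) :
  rV_cons (- a, - v)%R = (- rV_cons (a, v))%R.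
Proof.
by apply/rowP => i; case: (unliftP ord0 i) => [j ->|->]; rewrite [RHS]mxE
  ?rV_consSE ?rV_cons0E/= ?mxE.
Qed.

Lemma measurable_rV_shift (n : nat) (a : 'rV[R]_n) :
  measurable_fun setT (fun x : 'rV[R]_n => x + a)%R.
Proof.
apply: measurable_fun_rVP => i.
rewrite (_ : _ \o _ = fun x => (rV_coord i x + a ord0 i : measurableTypeR R))%R; last first.
  by apply/funext => x; rewrite /= /rV_coord mxE.
by apply: measurable_funD => //; exact: measurable_rV_coord.
Qed.

Lemma measurable_rV_opp (n : nat) :
  measurable_fun setT (fun x : 'rV[R]_n => - x)%R.
Proof.
apply: measurable_fun_rVP => i.
rewrite (_ : _ \o _ = fun x => (- rV_coord i x : measurableTypeR R))%R; last first.
  by apply/funext => x; rewrite /= /rV_coord mxE.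
by apply: measurable_funN => //; exact: measurable_rV_coord.
Qed.

Lemma measurable_rV_slice (n : nat) (f : 'rV[R]_n.+1 -> \bar R) (t : R) :
  measurable_fun setT f -> measurable_fun setT (fun v => f (rV_cons (t, v))).
Proof.
move=> mf; apply: measurableT_comp => //.
apply: (@measurableT_comp _ _ _ _ _ _ _ _ (pair (t : measurableTypeR R))).
  exact: measurable_rV_cons.
exact: pair1_measurable.
Qed.

Lemma measurable_rV_slice_integral (n : nat) (f : 'rV[R]_n.+1 -> \bar R) :
  measurable_fun setT f -> (forall x, 0 <= f x) ->
  measurable_fun setT
    (fun t : measurableTypeR R => \int[lebesgueN n]_v f (rV_cons (t, v))).
Proof.
move=> mf f0.
apply: (@measurable_fun_fubini_tonelli_F _ _ _ _ _ (lebesgueN n)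
  (f \o @rV_cons R n)).
- by apply: measurableT_comp => //; exact: measurable_rV_cons.
- by move=> x; exact: f0.
Qed.

Lemma ge0_integral_lebesgueN_shift (n : nat) (a : 'rV[R]_n) (f : 'rV[R]_n -> \bar R) :
  measurable_fun setT f -> (forall x, 0 <= f x) ->
  \int[lebesgueN n]_x f (x + a)%R = \int[lebesgueN n]_x f x.
Proof.
elim: n a f => [|n IH] a f mf f0.
  by apply: eq_integral => x _; congr f; apply/rowP => -[].
rewrite ge0_integral_lebesgueNS//; last first.
  by apply: measurableT_comp => //; exact: measurable_rV_shift.
apply: (eq_trans _ (esym (ge0_integral_lebesgueNS mf f0))).
rewrite -(rV_unconsK a); case: (rV_uncons a) => a0 a'.
under eq_integral.
  move=> t _; under eq_integral do rewrite -rV_consD.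
  rewrite (IH a' (fun v => f (rV_cons (t + a0, v)%R)))//; last first.
    exact: measurable_rV_slice.
  over.
rewrite (ge0_integral_lebesgue_shift a0
  (f := fun t => \int[lebesgueN n]_v f (rV_cons (t, v))))//.
- exact: measurable_rV_slice_integral.
- by move=> x; apply: integral_ge0.
Qed.

Lemma ge0_integral_lebesgueN_opp (n : nat) (f : 'rV[R]_n -> \bar R) :
  measurable_fun setT f -> (forall x, 0 <= f x) ->
  \int[lebesgueN n]_x f (- x)%R = \int[lebesgueN n]_x f x.
Proof.
elim: n f => [|n IH] f mf f0.
  by apply: eq_integral => x _; congr f; apply/rowP => -[].
rewrite ge0_integral_lebesgueNS//; last first.
  by apply: measurableT_comp => //; exact: measurable_rV_opp.
apply: (eq_trans _ (esym (ge0_integral_lebesgueNS mf f0))).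
under eq_integral.
  move=> t _; under eq_integral do rewrite -rV_consN.
  rewrite (IH (fun v => f (rV_cons (- t, v)%R)))//; last first.
    exact: measurable_rV_slice.
  over.
rewrite (ge0_integral_lebesgueN1
  (f := fun t => \int[lebesgueN n]_v f (rV_cons (t, v))))//.
- exact: measurable_rV_slice_integral.
- by move=> x; apply: integral_ge0.
Qed.

Lemma lebesgueN_cube (n : nat) (r : R) : (0 <= r)%R ->
  lebesgueN n [set x : 'rV[R]_n | `|x| <= r]%R = ((2 * r) ^+ n)%:E.
Proof.
move=> r0; elim: n => [|n IH].
  by rewrite expr0 /= diracE mem_set//= normr0.
rewrite [LHS](_ : _ = (mu1 \x lebesgueN n)
   (@rV_cons R n @^-1` [set x | (`|x| <= r)%R]))//.
rewrite (_ : _ @^-1` _ = [set` `[- r, r]%R] `*` [set x : 'rV[R]_n | `|x| <= r]%R).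
  rewrite product_measure1E//.
    rewrite [X in _ * X]IH exprS EFinM; congr (_ * _).
    rewrite [LHS]lebesgue_measure_itv/= lte_fin.
    case: ifPn => [_|]; first by rewrite -EFinD; congr (_%:E); lra.
    by rewrite -leNgt => h; congr (_%:E); lra.
  exact: measurable_rV_cube.
apply/seteqP; split => -[t v] /=.
  move=> /(rV_norm_le _ r0) h; split => /=.
    by have := h ord0; rewrite rV_cons0E in_itv/= -ler_norml.
  by apply/(rV_norm_le _ r0) => i; have := h (lift ord0 i); rewrite rV_consSE.
move=> [/=]; rewrite in_itv/= -ler_norml => h /(rV_norm_le _ r0) h'.
apply/(rV_norm_le _ r0) => i.
by case: (unliftP ord0 i) => [j ->|->]; rewrite ?rV_consSE ?rV_cons0E.
Qed.

End lebesgueN_theory.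

(** * Dyadic integrals of powers of the norm *)

Section dyadic.
Context {R : realType}.

Lemma powRX (a x : R) (k : nat) : 0 <= a -> (a ^+ k) `^ x = (a `^ x) ^+ k.
Proof.
move=> a0; rewrite -powR_mulrn// -powRrM mulrC powRrM powR_mulrn//.
exact: powR_ge0.
Qed.

Lemma powR_lt1 (a x : R) : 1 < a -> x < 0 -> a `^ x < 1.
Proof.
move=> a1 x0; rewrite /powR gt_eqF ?(lt_trans ltr01)//.
by rewrite -[ltRHS]expR0 ltr_expR nmulr_rlt0// ln_gt0.
Qed.

Lemma powRD_gt0 (a x y : R) : 0 < a -> a `^ (x + y) = a `^ x * a `^ y.
Proof. by move=> a0; rewrite powRD// (gt_eqF a0) implybT. Qed.

Lemma dyadic_bracket (r t : R) : 0 < r -> r < t ->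
  exists k : nat, r * 2 ^+ k < t <= r * 2 ^+ k.+1.
Proof.
move=> r0 rt.
have ex : exists k, t <= r * 2 ^+ k.
  exists (Num.truncn (t / r)).+1.
  rewrite mulrC -ler_pdivrMr// (le_trans (ltW (truncnS_gt _)))//.
  by rewrite -natrX ler_nat ltnW// ltn_expl.
case: (ex_minnP ex) => -[|k] tk kmin.
  by move: tk; rewrite expr0 mulr1 leNgt rt.
exists k; rewrite tk andbT ltNge; apply/negP => /kmin.
by rewrite ltnn.
Qed.

Lemma sum_geometric_le (C q : R) (n : nat) : 0 <= C -> 0 <= q < 1 ->
  \sum_(0 <= k < n) C * q ^+ k <= C / (1 - q).
Proof.
move=> C0 /andP[q0 q1]; rewrite -mulr_sumr ler_wpM2l//.
rewrite -[leRHS]mul1r ler_pdivlMr ?subr_gt0// mulrC.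
have -> : (1 - q) * (\sum_(0 <= i < n) q ^+ i) = 1 - q ^+ n.
  rewrite big_mkord -[in RHS](expr1n _ n) subrXX; congr (_ * _).
  by apply: eq_bigr => i _; rewrite expr1n mul1r.
by rewrite gerBl exprn_ge0.
Qed.

End dyadic.

Section dyadic_integral.
Local Open Scope ereal_scope.
Context d (T : measurableType d) (R : realType) (mu : {measure set T -> \bar R}).

(** The sets [A k] may overlap: the disjoint pieces [seqDU A k] have the same union, so countable
    additivity and the geometric series apply. *)
Lemma ge0_integral_geometric (f : T -> \bar R) (A : (set T)^nat) (D : set T) (C q : R) :
  measurable_fun setT f -> (forall x, 0 <= f x) ->
  measurable D -> (forall k, measurable (A k)) -> D `<=` \bigcup_k A k ->
  (0 <= C)%R -> (0 <= q < 1)%R ->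
  (forall k, \int[mu]_(x in A k) f x <= (C * q ^+ k)%:E) ->
  \int[mu]_(x in D) f x <= (C / (1 - q))%:E.
Proof.
move=> mf f0 mD mA DA C0 q01 fA.
have mB k : measurable (seqDU A k) by exact: seqDU_measurable.
apply: (@le_trans _ _ (\int[mu]_(x in \bigcup_k A k) f x)).
  apply: ge0_subset_integral => //; first exact: bigcup_measurable.
  exact: measurable_funTS.
rewrite seqDU_bigcup_eq ge0_integral_bigcup//; last first.
  exact: measurable_funTS.
apply: lime_le; first by apply: is_cvg_nneseries => k _ _; exact: integral_ge0.
apply: nearW => n; rewrite (@le_trans _ _ (\sum_(0 <= k < n) (C * q ^+ k)%:E))//.
  apply: lee_sum => k _; apply: le_trans (fA k).
  apply: ge0_subset_integral => //; last exact: subset_seqDU.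
  exact: measurable_funTS.
by rewrite sumEFin lee_fin; exact: sum_geometric_le.
Qed.

End dyadic_integral.

Section radial.
Local Open Scope ereal_scope.
Context {R : realType} {N : nat}.
Local Notation mu := (@lebesgueN R N).
Implicit Types h : 'rV[R]_N -> R.

Lemma measurable_rV_norm_powR (p : R) :
  measurable_fun setT (fun x : 'rV[R]_N => `|x| `^ p)%R.
Proof.
apply: (measurableT_comp (f := fun t : R => t `^ p)%R); first exact: measurable_powR.
exact: measurable_rV_norm.
Qed.

Lemma measurable_rV_normitv (i : interval R) :
  measurable [set x : 'rV[R]_N | `|x|%R \in i].
Proof.
have := @measurable_rV_norm R N measurableT _ (measurable_itv i).
by rewrite setTI.
Qed.

(** Substitute for polar coordinates: [h = 1] with [M = N] controls integrals of powers of the norm,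
    and exponential weights [h] carry the iteration. *)
Definition cube_growth h (C M : R) := forall r : R, (0 < r)%R ->
  \int[mu]_(x in [set x | `|x| <= r]%R) (h x)%:E <= (C * r `^ M)%:E.

Lemma cube_growth_ge0 h C M : (forall x, 0 <= h x)%R -> cube_growth h C M ->
  (0 <= C)%R.
Proof.
move=> h0 /(_ 1%R ltr01); rewrite powR1 mulr1; apply: contraTT.
rewrite -ltNge -ltNge => C0; apply: (@lt_le_trans _ _ 0); first by rewrite lte_fin.
by apply: integral_ge0 => x _; rewrite lee_fin.
Qed.

Lemma annulus_bound h (C M p a b B : R) :
  measurable_fun setT h -> (forall x, 0 <= h x)%R -> cube_growth h C M ->
  (0 < b)%R -> (0 <= B)%R ->
  (forall t, a <= t <= b -> t `^ (- p) <= B)%R ->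
  \int[mu]_(x in [set x | `|x|%R \in `[a, b]%R]) (h x * `|x| `^ (- p))%:E
  <= (B * (C * b `^ M))%:E.
Proof.
move=> mh h0 hC b0 B0 tB.
have mw : measurable_fun setT (fun x : 'rV[R]_N => h x * `|x| `^ (- p))%R.
  by apply: measurable_funM => //; exact: measurable_rV_norm_powR.
apply: (@le_trans _ _ (\int[mu]_(x in [set x | `|x|%R \in `[a, b]%R]) (B%:E * (h x)%:E))).
  apply: ge0_le_integral => //.
  - exact: measurable_rV_normitv.
  - by move=> x _; rewrite lee_fin mulr_ge0// powR_ge0.
  - by apply/measurable_EFinP; apply: measurable_funTS.
  - by apply: measurable_funTS; apply/measurable_EFinP; apply: measurable_funM.
  - move=> x; rewrite /= in_itv/= => xab.
    by rewrite -EFinM lee_fin mulrC ler_wpM2r// tB.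
rewrite ge0_integralZl//; last 3 first.
- exact: measurable_rV_normitv.
- by apply/measurable_EFinP; apply: measurable_funTS.
- by move=> x _; rewrite lee_fin.
rewrite EFinM lee_wpmul2l ?lee_fin//; apply: le_trans (hC _ b0).
apply: ge0_subset_integral => //.
- exact: measurable_rV_normitv.
- exact: measurable_rV_cube.
- by apply/measurable_EFinP; apply: measurable_funTS.
- by move=> x _; rewrite lee_fin.
- by move=> x /=; rewrite in_itv/= => /andP[].
Qed.

(** On the k-th dyadic annulus outside radius [r] the power is bounded by its value at the inner
    radius and the mass of [h] by the outer one. The bounds form a geometric series of ratio 2 to
    the power [M - p]. *)
Lemma integral_tail h (C M p : R) :
  measurable_fun setT h -> (forall x, 0 <= h x)%R -> cube_growth h C M ->
  (0 <= p)%R -> (M < p)%R ->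
  exists2 C' : R, (0 <= C')%R & forall r : R, (0 < r)%R ->
  \int[mu]_(x in [set x | r < `|x|]%R) (h x * `|x| `^ (- p))%:E
  <= (C' * r `^ (M - p))%:E.
Proof.
move=> mh h0 hC p0 Mp.
have C0 := cube_growth_ge0 h0 hC.
have q1 : (0 <= (2 : R) `^ (M - p) < 1)%R.
  by rewrite powR_ge0/=; apply: powR_lt1; lra.
exists (C * 2 `^ M / (1 - 2 `^ (M - p)))%R.
  rewrite divr_ge0// ?mulr_ge0 ?powR_ge0//.
  by case/andP: q1 => _ /ltW; rewrite subr_ge0.
move=> r r0.
rewrite mulrAC.
apply: (@ge0_integral_geometric _ _ _ mu
  (fun x => (h x * `|x| `^ (- p))%:E)
  (fun k => [set x : 'rV[R]_N | `|x|%R \in `[r * 2 ^+ k, r * 2 ^+ k.+1]%R])).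
- apply/measurable_EFinP; apply: measurable_funM => //.
  exact: measurable_rV_norm_powR.
- by move=> x; rewrite lee_fin mulr_ge0// powR_ge0.
- have := measurable_rV_normitv `]r, +oo[; congr measurable.
  by apply/seteqP; split => x /=; rewrite in_itv/= andbT.
- by move=> k; exact: measurable_rV_normitv.
- move=> x /= rx; have [k kx] := dyadic_bracket r0 rx.
  by exists k => //=; rewrite in_itv/=; case/andP: kx => /ltW -> ->.
- by rewrite !mulr_ge0 ?powR_ge0.
- exact: q1.
move=> k.
have k0 : (0 < 2 ^+ k :> R)%R by rewrite exprn_gt0.
apply: le_trans (annulus_bound mh h0 hC _ _ (B := (r * 2 ^+ k) `^ (- p)) _) _ => //.
- by rewrite mulr_gt0// exprn_gt0.
- by rewrite powR_ge0.
- move=> t /andP[rt _].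
  have t0 : (0 < t)%R by apply: lt_le_trans rt; rewrite mulr_gt0.
  rewrite !powRN lef_pV2 ?posrE ?powR_gt0 ?mulr_gt0//.
  by rewrite ge0_ler_powR ?nnegrE ?mulr_ge0 ?(ltW r0) ?(ltW k0) ?(ltW t0).
rewrite lee_fin (_ : r * 2 ^+ k.+1 = (r * 2 ^+ k) * 2)%R; last by rewrite exprSr mulrA.
rewrite [X in (_ * (_ * X))%R]powRM ?mulr_ge0 ?(ltW r0) ?(ltW k0)//.
rewrite [leLHS](_ : _ = C * 2 `^ M * ((r * 2 ^+ k) `^ (-p) * (r * 2 ^+ k) `^ M))%R; last by ring.
rewrite -powRD_gt0 ?mulr_gt0//.
rewrite (addrC (- p)%R) powRM ?(ltW r0) ?(ltW k0)// powRX//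
  [leRHS](_ : _ = C * 2 `^ M * (r `^ (M - p) * (2 `^ (M - p)) ^+ k))%R; last by ring.
by [].
Qed.

(** The same series run inwards, of ratio 2 to the power [p - M]. The origin is left out because no
    annulus reaches it. *)
Lemma integral_head h (C M p : R) :
  measurable_fun setT h -> (forall x, 0 <= h x)%R -> cube_growth h C M ->
  (0 <= M)%R -> (p < M)%R ->
  exists2 C' : R, (0 <= C')%R & forall r : R, (0 < r)%R ->
  \int[mu]_(x in [set x | 0 < `|x| <= r]%R) (h x * `|x| `^ (- p))%:E
  <= (C' * r `^ (M - p))%:E.
Proof.
move=> mh h0 hC M0 Mp.
have C0 := cube_growth_ge0 h0 hC.
have q1 : (0 <= (2 : R) `^ (p - M) < 1)%R.
  by rewrite powR_ge0/=; apply: powR_lt1; lra.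
exists (C * 2 `^ M * 2 `^ (M - p) / (1 - 2 `^ (p - M)))%R.
  rewrite divr_ge0// ?mulr_ge0 ?powR_ge0//.
  by case/andP: q1 => _ /ltW; rewrite subr_ge0.
move=> r r0.
rewrite mulrAC.
apply: (@ge0_integral_geometric _ _ _ mu
  (fun x => (h x * `|x| `^ (- p))%:E)
  (fun k => [set x : 'rV[R]_N | `|x|%R \in `[r / 2 ^+ k, 2 * r / 2 ^+ k]%R])).
- apply/measurable_EFinP; apply: measurable_funM => //.
  exact: measurable_rV_norm_powR.
- by move=> x; rewrite lee_fin mulr_ge0// powR_ge0.
- exact: (measurable_rV_normitv `]0%R, r]).
- by move=> k; exact: measurable_rV_normitv.
- move=> x /= /andP[x0 xr].
  (* Since the annuli descend from [r], it is now [r] that is bracketed between dyadic multiples of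
     half the norm of [x]. *)
  have xr' : (`|x|/2 < r)%R by lra.
  have x20 : (0 < `|x|/2)%R by rewrite divr_gt0.
  have [k /andP[k1 k2]] := dyadic_bracket x20 xr'.
  exists k => //=; rewrite in_itv/=; apply/andP; split.
    rewrite ler_pdivrMr ?exprn_gt0//; apply: le_trans k2 _.
    by rewrite exprS mulrA divfK.
  rewrite ler_pdivlMr ?exprn_gt0// -ler_pdivrMl//.
  by rewrite mulrA (mulrC 2^-1)%R ltW.
- by rewrite !mulr_ge0 ?powR_ge0.
- exact: q1.
move=> k; set b := (2 * r / 2 ^+ k)%R.
have b0 : (0 < b)%R by rewrite divr_gt0// ?mulr_gt0// exprn_gt0.
apply: le_trans (annulus_bound mh h0 hC b0 (B := b `^ (- p) * 2 `^ M) _ _) _ => //.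
- by rewrite mulr_ge0 ?powR_ge0.
- move=> t; rewrite (_ : r / 2 ^+ k = b / 2)%R; last by rewrite /b; field.
  move=> /andP[bt tb].
  have t0 : (0 < t)%R by apply: lt_le_trans bt; rewrite divr_gt0.
  (* Here [p] may have either sign, so monotonicity is used separately for the exponents [M - p > 0]
     and [- M <= 0]; the latter costs the factor 2 to the power [M]. *)
  rewrite (_ : - p = (M - p) + - M)%R; last by ring.
  rewrite (powRD_gt0 _ _ t0) (powRD_gt0 _ _ b0).
  rewrite -mulrA ler_pM ?powR_ge0//.
    by rewrite ge0_ler_powR ?nnegrE ?(ltW t0) ?(ltW b0)//; lra.
  rewrite !powRN -ler_pdivrMl ?invr_gt0 ?powR_gt0// invrK.
  rewrite ler_pdivrMr ?powR_gt0// -powRM ?(ltW t0)//.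
  by rewrite ge0_ler_powR ?nnegrE ?mulr_ge0 ?(ltW t0) ?(ltW b0)//; lra.
rewrite lee_fin.
rewrite [leLHS](_ : _ = C * 2 `^ M * (b `^ (-p) * b `^ M))%R; last by ring.
rewrite -powRD_gt0//.
rewrite (addrC (- p)%R) /b powRM ?mulr_ge0 ?invr_ge0 ?exprn_ge0 ?(ltW r0)//.
rewrite powRM ?(ltW r0)// -exprVn powRX ?invr_ge0// -powR_inv1// -powRrM.
rewrite (_ : -1 * (M - p) = p - M)%R; last by ring.
by rewrite !mulrA.
Qed.

End radial.

(** * Directional means *)

Section unit_interval_mean.
Context {R : realType}.
Local Notation mu1 := (@lebesgue_measure R).
Implicit Types f g : R -> R.

Lemma integrable_unit f : continuous f -> mu1.-integrable `[0, 1] (EFin \o f).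
Proof.
move=> cf; apply: continuous_compact_integrable; first exact: segment_compact.
exact: continuous_subspaceT.
Qed.

Lemma mean_unit_cst (c : R) : \int[mu1]_(t in `[0, 1]) c = c.
Proof.
rewrite Rintegral_cst//= lebesgue_measure_itv/= lte_fin ltr01 oppr0 addr0.
by rewrite mulr1.
Qed.

Lemma mean_unit_dist f (c e : R) : continuous f ->
  (forall t, 0 <= t <= 1 -> `|f t - c| <= e) ->
  `|\int[mu1]_(t in `[0, 1]) f t - c| <= e.
Proof.
move=> cf fe; rewrite -[X in _ - X]mean_unit_cst -RintegralB//=; last 2 first.
- exact: integrable_unit.
- by apply: integrable_unit; exact: cst_continuous.
have cfc : continuous (fun t => f t - c).
  by move=> t; apply: cvgB; [exact: cf|exact: cvg_cst].
apply: le_trans (le_normr_Rintegral _ _) _ => //; first exact: integrable_unit.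
rewrite -[leRHS]mean_unit_cst; apply: le_Rintegral => //.
- apply: (@integrable_unit (fun t => `|f t - c|)) => t.
  by apply: cvg_norm; exact: cfc.
- by apply: integrable_unit; exact: cst_continuous.
Qed.

(** Jensen's inequality for the square, by integrating the tangent-line bound
    [m *+ 2 * f t - m ^+ 2 <= f t ^+ 2] at the mean [m]. *)
Lemma sqr_mean_unit_le f : continuous f ->
  (\int[mu1]_(t in `[0, 1]) f t) ^+ 2 <= \int[mu1]_(t in `[0, 1]) (f t ^+ 2).
Proof.
move=> cf; set m := \int[_]_(_ in _) f _.
have cf2 : continuous (fun t => f t ^+ 2).
  by move=> t; rewrite /continuous_at expr2; under eq_fun do rewrite expr2; apply: cvgM; exact: cf.
have : \int[mu1]_(t in `[0, 1]) (m *+ 2 * f t - m ^+ 2) <= \int[mu1]_(t in `[0, 1]) (f t ^+ 2).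
  apply: le_Rintegral => //.
  - apply: integrable_unit => t; apply: cvgB; last exact: cvg_cst.
    by apply: cvgM; [exact: cvg_cst|exact: cf].
  - exact: integrable_unit.
  - move=> t _; rewrite -subr_ge0.
    by rewrite [leRHS](_ : _ = (f t - m) ^+ 2) ?sqr_ge0//; ring.
rewrite RintegralB//=; last 2 first.
- apply: (@integrable_unit (fun t => m *+ 2 * f t)) => t.
  by apply: cvgM; [exact: cvg_cst|exact: cf].
- by apply: integrable_unit; exact: cst_continuous.
rewrite mean_unit_cst RintegralZl//; last exact: integrable_unit.
by rewrite -/m; apply: le_trans; rewrite le_eqVlt; apply/orP; left; apply/eqP; ring.
Qed.

Lemma antiderivative f (A : R) : continuous f ->
  exists F : R -> R, forall x, A < x -> is_derive x (1 : R) F (f x).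
Proof.
move=> cf; exists (fun x => \int[mu1]_(t in `[A, x]) f t) => x Ax.
have [||//||dF F'] := @continuous_FTC1_closed _ f A x (x + 1).
- by rewrite ltrDl.
- apply: continuous_compact_integrable; first exact: segment_compact.
  exact: continuous_subspaceT.
- exact: cf.
by apply: DeriveDef; [exact: dF|rewrite -derive1E; exact: F'].
Qed.

Lemma is_derive_affine (h d t : R) : is_derive t (1 : R) (fun t : R => h + d * t) d.
Proof.
have h1 := @is_derive_cst R R R h t 1.
have h2 := @is_deriveZ R R R id d t 1 1 (is_derive_id t 1).
have := is_deriveD h1 h2.
by rewrite add0r /GRing.scale/= mulr1.
Qed.

(** With an antiderivative [F] of [f] the mean is [(F (h + d) - F h) / d], which is differentiable
    in [h] although [f] is only continuous. *)
Lemma mean_unit_derive f (d : R) : 0 < d -> continuous f ->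
  is_derive (0 : R) (1 : R) (fun h : R => \int[mu1]_(t in `[0, 1]) f (h + d * t))
    (d^-1 * (f d - f 0)).
Proof.
(* The base point -2 leaves room around [h = 0]: for [h > -1] and [d * t > -1] all arguments
   [h + d * t] lie to its right. *)
move=> d0 cf; have [F FE] := antiderivative (- 2) cf.
have Fh (h : R) : - 1 < h -> \int[mu1]_(t in `[0, 1]) f (h + d * t) = d^-1 * (F (h + d) - F h).
  move=> h1.
  pose G t := d^-1 * F (h + d * t).
  have dG t : - 1 < d * t -> is_derive t (1 : R) G (f (h + d * t)).
    move=> dt1.
    have h2 : - 2 < h + d * t by lra.
    have dFt := FE _ h2.
    have lin := is_derive_affine h d t.
    have : is_derive t (1 : R) (d^-1 *: (F \o (fun t : R => h + d * t))) (d^-1 *: (f (h + d * t) * d)).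
      exact: is_deriveZ.
    by rewrite /GRing.scale/= mulrCA mulVf ?mulr1// gt_eqF.
  have dt (t : R) : 0 <= t -> - 1 < d * t.
    by move=> t0; rewrite (lt_le_trans (y := 0)) ?mulr_ge0 ?(ltW d0)//; lra.
  have cG (t : R) : 0 <= t -> {for t, continuous G}.
    move=> t0; apply/differentiable_continuous/derivable1_diffP.
    by have [] := dG _ (dt _ t0).
  rewrite /Rintegral (@continuous_FTC2 _ (fun t => f (h + d * t)) G)//=.
  - by rewrite /G mulr1 mulr0 addr0 mulrBr.
  - apply: continuous_subspaceT => t.
    apply: (continuous_comp (f := fun t : R => h + d * t)); last exact: cf.
    by apply: cvgD; [exact: cvg_cst|apply: cvgM; [exact: cvg_cst|exact: cvg_id]].
  - split.
    + move=> t; rewrite in_itv/= => /andP[t0 _].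
      by have [] := dG _ (dt _ (ltW t0)).
    + by apply: cvg_at_right_filter; exact: cG.
    + by apply: cvg_at_left_filter; exact: cG.
  - move=> t; rewrite in_itv/= => /andP[t0 _].
    by rewrite derive1E; have [] := dG _ (dt _ (ltW t0)).
have : is_derive (0 : R) (1 : R) (d^-1 *: ((F \o (fun h : R => d + 1 * h)) - F)) (d^-1 *: (f d * 1 - f 0)).
  apply: is_deriveZ; apply: is_deriveB; last by apply: FE; lra.
  have lin := is_derive_affine d 1 0.
  have : is_derive (d + 1 * 0) (1 : R) F (f d) by rewrite mulr0 addr0; apply: FE; lra.
  by move=> ?; apply: is_derive1_comp.
rewrite mulr1 => -[dF F'].
have E : {near (0 : R), (d^-1 *: ((F \o (fun h : R => d + 1 * h)) - F)) =1
    (fun h : R => \int[mu1]_(t in `[0, 1]) f (h + d * t))}.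
  have : \forall h \near (0 : R), - 1 < h by apply: lt_nbhsr; lra.
  apply: filterS => h h1; rewrite [RHS]Fh//.
  by have -> : h + d = d + 1 * h by rewrite mul1r addrC.
apply: DeriveDef; first exact: near_eq_derivable E dF.
by rewrite -[RHS]F'; apply/esym/near_eq_derive; exact: E.
Qed.

End unit_interval_mean.

Section rV_compact_cubes.
Context {R : realType} {N : nat}.

Lemma cube_compact (r : R) : compact [set x : 'rV[R]_N | `|x| <= r].
Proof.
apply: bounded_closed_compact.
  exists r; split; first exact: num_real.
  by move=> M rM x /= xr; rewrite (le_trans xr)// ltW.
have -> : [set x : 'rV[R]_N | `|x| <= r] = (fun x : 'rV[R]_N => `|x|) @^-1` [set t | t <= r] by [].
by apply: closed_comp; [move=> x _; exact: norm_continuous|exact: closed_le].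
Qed.

Lemma continuous_cube_bounded (phi : 'rV[R]_N -> R) (r : R) : continuous phi ->
  exists2 M : R, 0 <= M & forall x, `|x| <= r -> `|phi x| <= M.
Proof.
move=> cphi.
have /compact_bounded[M [_ hM]] : compact (phi @` [set x | `|x| <= r]).
  by apply: continuous_compact; [exact: continuous_subspaceT|exact: cube_compact].
exists (`|M| + 1) => [|x xr]; first by rewrite addr_ge0.
by apply: (hM (`|M| + 1)); [rewrite (le_lt_trans (ler_norm _))// ltrDl|exists x].
Qed.

End rV_compact_cubes.

(** * Averages over a segment in a fixed direction *)

Section directional_mean.
Context {R : realType} {N : nat}.
Local Notation mu1 := (@lebesgue_measure R).
Implicit Types (phi : 'rV[R]_N -> R) (x v : 'rV[R]_N).

Lemma line_quotient phi x v (h : R) :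
  (fun k : R => k^-1 *: ((phi \o shift (x + h *: v)) (k *: v) - phi (x + h *: v))) =
  (fun k : R => k^-1 *: (((fun t : R => phi (x + t *: v)) \o shift h) (k *: (1 : R)) - phi (x + h *: v))).
Proof.
apply/funext => k /=; congr (_ *: (phi _ - _)).
by rewrite [k%:A]mulr1 scalerDl addrCA.
Qed.

Lemma line_derivable phi x v (h : R) :
  derivable phi (x + h *: v) v <-> derivable (fun t : R => phi (x + t *: v)) h (1 : R).
Proof. by rewrite /derivable line_quotient. Qed.

Lemma line_derive phi x v (h : R) :
  'D_v phi (x + h *: v) = 'D_1 (fun t : R => phi (x + t *: v)) h.
Proof. by rewrite /derive line_quotient. Qed.

Lemma line_continuous phi x v : continuous phi -> continuous (fun t : R => phi (x + t *: v)).
Proof.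
move=> cphi t; apply: (continuous_comp (f := fun t : R => x + t *: v)); last exact: cphi.
by apply: cvgD; [exact: cvg_cst|apply: cvgZr_tmp; exact: cvg_id].
Qed.

Definition dmean (v : 'rV[R]_N) (d : R) phi x : R :=
  \int[mu1]_(t in `[0, 1]) phi (x + (d * t) *: v).

Lemma continuous_dmean_arg v (d : R) phi x : continuous phi ->
  continuous (fun t : R => phi (x + (d * t) *: v)).
Proof.
move=> cphi t; apply: (continuous_comp (f := fun t : R => x + (d * t) *: v)); last exact: cphi.
apply: cvgD; first exact: cvg_cst.
by apply: cvgZr_tmp; apply: cvgM; [exact: cvg_cst|exact: cvg_id].
Qed.

Lemma rV_continuousP phi x : {for x, continuous phi} <->
  forall e : R, 0 < e -> \forall y \near x, `|phi x - phi y| <= e.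
Proof. exact: (@cvgrPdist_le R R _ (nbhs x) _). Qed.

(** Tube lemma: compactness of the unit interval makes the neighbourhood of [x] independent of
    [t]. *)
Lemma continuous_dmean_near v (d : R) phi x (e : R) : continuous phi -> 0 < e ->
  \forall y \near x, forall t, 0 <= t <= 1 ->
    `|phi (y + (d * t) *: v) - phi (x + (d * t) *: v)| <= e.
Proof.
move=> cphi e0.
have /compact_near_coveringP cov : compact `[0, 1 : R]%classic by exact: (@segment_compact R).
have := cov _ (nbhs x)
  (fun y t => `|phi (y + (d * t) *: v) - phi (x + (d * t) *: v)| <= e) _ _.
move=> /(_ _) H; have {H} : \forall y \near x, `[0, 1 : R]%classic `<=`
    (fun t : R => `|phi (y + (d * t) *: v) - phi (x + (d * t) *: v)| <= e).
  apply: H => t0 _.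
  pose f (z : R * 'rV[R]_N) := phi (z.2 + (d * z.1) *: v).
  have cf : {for (t0, x), continuous f}.
    apply: (continuous_comp (f := fun z : R * 'rV[R]_N => z.2 + (d * z.1) *: v)); last exact: cphi.
    apply: cvgD; first exact: cvg_snd.
    by apply: cvgZr_tmp; apply: cvgM; [exact: cvg_cst|exact: cvg_fst].
  have e20 : 0 < e / 2 by rewrite divr_gt0.
  have := (@cvgrPdist_le R R _ (nbhs (t0, x)) _ f _).1 cf _ e20.
  move=> [[A B] [/= At0 Bx] AB].
  exists (A, B) => // -[t y] [/= At By].
  have h1 := AB (t, y) (conj At By).
  have h2 := AB (t, x) (conj At (nbhs_singleton Bx)).
  rewrite /f/= in h1 h2.
  rewrite -(subrK (phi (x + (d * t0) *: v)) (phi (y + (d * t) *: v))) -addrA.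
  rewrite (le_trans (ler_normD _ _))// (splitr e) lerD//.
  by rewrite distrC.
by apply: filterS => y h t t01; apply: h; rewrite /= in_itv.
Qed.

Lemma dmean_continuous v (d : R) phi : continuous phi -> continuous (dmean v d phi).
Proof.
move=> cphi x; apply/rV_continuousP => e e0.
have := continuous_dmean_near v d x cphi e0; apply: filterS => y h.
rewrite distrC /dmean -RintegralB//=; last 2 first.
- by apply: (@integrable_unit _ (fun t => phi (y + (d * t) *: v))); exact: continuous_dmean_arg.
- by apply: (@integrable_unit _ (fun t => phi (x + (d * t) *: v))); exact: continuous_dmean_arg.
set f := fun t : R => phi (y + (d * t) *: v) - phi (x + (d * t) *: v).
have := @mean_unit_dist _ f 0 e; rewrite subr0; apply.
  by move=> t; apply: cvgB; exact: continuous_dmean_arg.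
by move=> t t01; rewrite subr0; exact: h.
Qed.

Lemma dmean_cvg v phi x (e : R) : continuous phi -> 0 < e ->
  \forall d \near (0 : R), `|dmean v d phi x - phi x| <= e.
Proof.
move=> cphi e0.
have /cvgrPdist_le/(_ _ e0)[/= r r0 re] := @line_continuous phi x v cphi 0.
exists r => //= d; rewrite /ball_/= sub0r normrN => dr.
apply: mean_unit_dist; first exact: continuous_dmean_arg.
move=> t /andP[t0 t1].
have := re (d * t); rewrite /ball_/= sub0r normrN scale0r addr0 distrC; apply.
rewrite normrM (ger0_norm t0) (le_lt_trans _ dr)//.
by rewrite ler_piMr.
Qed.

(** Averaging gains a derivative in its own direction: that derivative is a difference quotient of
    [phi], hence continuous. *)
Lemma dmean_derive_same v (d : R) phi x : 0 < d -> continuous phi ->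
  is_derive x v (dmean v d phi) (d^-1 * (phi (x + d *: v) - phi x)).
Proof.
move=> d0 cphi.
have cg := @line_continuous phi x v cphi.
have [dF F'] := mean_unit_derive d0 cg.
have E : (fun h : R => \int[mu1]_(t in `[0, 1]) phi (x + (h + d * t) *: v)) =
    (fun h : R => dmean v d phi (x + h *: v)).
  apply/funext => h; apply: eq_Rintegral => t _.
  by rewrite scalerDl addrA.
rewrite E in dF F'.
apply: DeriveDef.
  by have := (line_derivable (dmean v d phi) x v 0).2 dF; rewrite scale0r addr0.
have := line_derive (dmean v d phi) x v 0.
by rewrite F' scale0r addr0 => ->.
Qed.

(** Derivatives already gained in another direction survive, by differentiation under the integral.
    Averaging once along each basis vector thus ends in a C^1 function. *)
Lemma dmean_derive_other v w (d : R) phi x : continuous phi ->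
  (forall y, derivable phi y w) -> continuous ('D_w phi) ->
  is_derive x w (dmean v d phi) (dmean v d ('D_w phi) x).
Proof.
move=> cphi dphi cD.
(* This cube contains all points [x + (d * t) *: v + h *: w] with [h] in []-1, 1[] and [t] in
   [[0, 1]], so the constant [M] is an integrable majorant. *)
have [M M0 HM] := continuous_cube_bounded (`|x| + `|w| + `|d| * `|v|) cD.
pose f (h t : R) := phi (x + (d * t) *: v + h *: w).
have fE h : dmean v d phi (x + h *: w) = \int[mu1]_(t in `[0, 1]) f h t.
  by apply: eq_Rintegral => t _; rewrite /f addrAC.
have df h t : derivable (f^~ t) h (1 : R).
  exact: (line_derivable phi (x + (d * t) *: v) w h).1.
have f'E h t : partial1of2 f h t = 'D_w phi (x + (d * t) *: v + h *: w).
  by rewrite partial1of2E line_derive.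
have I0 : (`]-1, 1[%classic : set R) 0 by rewrite /= in_itv/= ltrN10 ltr01.
have intf h : (`]-1, 1[%classic : set R) h -> mu1.-integrable `[0, 1] (EFin \o f h).
  move=> _; apply: (@integrable_unit _ (f h)).
  rewrite (_ : f h = fun t => phi (x + h *: w + (d * t) *: v)).
    exact: continuous_dmean_arg.
  by apply/funext => t; rewrite /f addrAC.
have bf h t : (`]-1, 1[%classic : set R) h -> `[0, 1]%classic t -> `|partial1of2 f h t| <= M.
  rewrite /= !in_itv/= => /andP[h0 h1] /andP[t0 t1].
  rewrite f'E HM// (le_trans (ler_normD _ _))// addrAC lerD//.
    rewrite (le_trans (ler_normD _ _))// lerD// normrZ ler_wpM2r// normrM.
    by rewrite ler_piMr// ger0_norm.
  by rewrite normrZ ler_piMl// ler_norml !ltW.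
have intM : mu1.-integrable `[0, 1] (EFin \o cst M).
  by apply: (@integrable_unit _ (cst M)); exact: cst_continuous.
have D := @derivable_under_integral _ _ _ mu1 f _ (measurable_itv _) _ _ _ I0 intf
  (fun h t _ _ => df h t) _ (fun=> M0) intM bf.
have E := @differentiation_under_integral _ _ _ mu1 f _ (measurable_itv _) _ _ _ I0 intf
  (fun h t _ _ => df h t) _ (fun=> M0) intM bf.
have fE' : (fun h => \int[mu1]_(t in `[0, 1]) f h t) = (fun h => dmean v d phi (x + h *: w)).
  by apply/funext => h; rewrite fE.
rewrite fE' in D E.
apply: DeriveDef.
  by have := (line_derivable (dmean v d phi) x w 0).2 D; rewrite scale0r addr0.
have := line_derive (dmean v d phi) x w 0.
rewrite scale0r addr0 => ->; rewrite -derive1E E.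
by apply: eq_Rintegral => t _; rewrite f'E scale0r addr0.
Qed.

End directional_mean.

(** * Stability for continuous test functions *)

Section energy.
Local Open Scope ereal_scope.
Context {R : realType} {N : nat}.
Variable s : R.
Local Notation mu1 := (@lebesgue_measure R).
Local Notation mu := (@lebesgueN R N).
Local Notation V := 'rV[R]_N.
Implicit Types phi : V -> R.

Definition kern (z : V) : R := ((eucl z `^ (N%:R + 2 * s))^-1)%R.

Lemma kern_ge0 z : (0 <= kern z)%R.
Proof. by rewrite invr_ge0 powR_ge0. Qed.

Lemma kernN z : kern (- z) = kern z.
Proof. by rewrite /kern euclN. Qed.

Lemma measurable_kern : measurable_fun setT kern.
Proof.
rewrite (_ : kern = fun z => eucl z `^ (- (N%:R + 2 * s)))%R.
  apply: (measurableT_comp (f := fun t : R => t `^ (- (N%:R + 2 * s)))%R).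
    exact: measurable_powR.
  exact: measurable_eucl.
by apply/funext => z; rewrite powRN.
Qed.

Lemma measurable_rV_sub : measurable_fun setT (fun z : V * V => z.1 - z.2)%R.
Proof.
apply: measurable_fun_rVP => i.
rewrite (_ : _ \o _ = fun z : V * V => (rV_coord i z.1 - rV_coord i z.2 : measurableTypeR R))%R; last first.
  by apply/funext => x; rewrite /= /rV_coord !mxE.
apply: measurable_funB.
- exact: (measurableT_comp (@measurable_rV_coord R N i) measurable_fst).
- exact: (measurableT_comp (@measurable_rV_coord R N i) measurable_snd).
Qed.

Lemma measurable_kern_sub : measurable_fun setT (fun z : V * V => kern (z.1 - z.2)).
Proof. exact: (measurableT_comp measurable_kern measurable_rV_sub). Qed.

Definition energy phi : \bar R :=
  \int[mu]_x \int[mu]_y ((phi x - phi y) ^+ 2 / eucl (x - y) `^ (N%:R + 2 * s))%:E.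

Definition energy_density phi (z : V * V) : R :=
  ((phi z.1 - phi z.2) ^+ 2 * kern (z.1 - z.2))%R.

Lemma energy_density_ge0 phi z : (0 <= energy_density phi z)%R.
Proof. by rewrite mulr_ge0 ?sqr_ge0 ?kern_ge0. Qed.

Lemma measurable_energy_density phi : measurable_fun setT phi ->
  measurable_fun setT (energy_density phi).
Proof.
move=> mphi; apply: measurable_funM; last exact: measurable_kern_sub.
apply: measurable_funX; apply: measurable_funB.
- exact: (measurableT_comp mphi measurable_fst).
- exact: (measurableT_comp mphi measurable_snd).
Qed.

Lemma energy_prodE phi : measurable_fun setT phi ->
  energy phi = \int[mu \x mu]_z (energy_density phi z)%:E.
Proof.
move=> mphi; rewrite fubini_tonelli1//.
- by apply/measurable_EFinP; exact: measurable_energy_density.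
- by move=> z; rewrite lee_fin energy_density_ge0.
Qed.

Lemma energy_shift phi (a : V) : measurable_fun setT phi ->
  energy (fun x => phi (x + a)%R) = energy phi.
Proof.
move=> mphi.
have mE : measurable_fun setT (EFin \o energy_density phi).
  by apply/measurable_EFinP; exact: measurable_energy_density.
rewrite /energy -[RHS](ge0_integral_lebesgueN_shift a
  (f := fun x => \int[mu]_y (energy_density phi (x, y))%:E)).
- apply: eq_integral => x _.
  rewrite -[RHS](ge0_integral_lebesgueN_shift a
    (f := fun y => (energy_density phi (x + a, y)%R)%:E)).
  + apply: eq_integral => y _; rewrite /energy_density/= /kern.
    by rewrite (_ : x + a - (y + a) = x - y)%R// opprD addrACA subrr addr0.
  + exact: (measurable_fun_pair2 _ mE).
  + by move=> y; rewrite lee_fin energy_density_ge0.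
- apply: (@measurable_fun_fubini_tonelli_F _ _ _ _ _ mu _ mE).
  by move=> z; rewrite lee_fin energy_density_ge0.
- by move=> x; apply: integral_ge0 => y _; rewrite lee_fin energy_density_ge0.
Qed.

Lemma measurable_rV_line (v : V) (d : R) :
  measurable_fun setT (fun zt : V * measurableTypeR R => zt.1 + (d * zt.2) *: v)%R.
Proof.
apply: measurable_fun_rVP => i.
rewrite (_ : _ \o _ = fun zt : V * measurableTypeR R =>
    (rV_coord i zt.1 + (d * zt.2) * v ord0 i : measurableTypeR R))%R; last first.
  by apply/funext => x; rewrite /= /rV_coord !mxE.
apply: measurable_funD.
- exact: (measurableT_comp (@measurable_rV_coord R N i) measurable_fst).
- by apply: measurable_funM => //; apply: measurable_funM => //.
Qed.

(* Translations preserve the energy, so this is Jensen's inequality for the mean over t. *)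
Lemma energy_dmean_le (v : V) (d : R) phi : continuous phi ->
  energy (dmean v d phi) <= energy phi.
Proof.
move=> cphi.
have mphi := continuous_measurable_rV cphi.
(* The indicator turns the mean into an integral over the whole line, ready to be exchanged with the
   two space integrals. *)
pose Q (x y : V) (t : measurableTypeR R) : R :=
  (energy_density (fun x => phi (x + (d * t) *: v)%R) (x, y) * \1_(`[0%R, 1%R]%classic : set R) t)%R.
have Q0 x y t : (0 <= Q x y t)%R by rewrite mulr_ge0 ?energy_density_ge0.
have mQ d' (T : measurableType d') (px py : T -> V) (pt : T -> measurableTypeR R) :
    measurable_fun setT px -> measurable_fun setT py -> measurable_fun setT pt ->
    measurable_fun setT (fun w => (Q (px w) (py w) (pt w))%:E).
  move=> mpx mpy mpt.
  have mline (pr : T -> V) : measurable_fun setT pr ->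
      measurable_fun setT (fun w => phi (pr w + (d * pt w) *: v)%R).
    move=> mpr; apply: (measurableT_comp mphi).
    apply: (measurableT_comp (measurable_rV_line v d) (g := fun w => (pr w, pt w))).
    exact: measurable_fun_pair.
  apply/measurable_EFinP; apply: measurable_funM.
    apply: measurable_funM.
      by apply: measurable_funX; apply: measurable_funB; apply: mline.
    apply: (measurableT_comp measurable_kern_sub (g := fun w => (px w, py w))).
    exact: measurable_fun_pair.
  have mI : measurable_fun setT (\1_(`[0%R, 1%R]%classic : set R) : measurableTypeR R -> R).
    by apply/measurable_indicP; exact: measurable_itv.
  exact: (measurableT_comp mI mpt).
have cdm := @dmean_continuous _ _ v d _ cphi.
have mdm := continuous_measurable_rV cdm.
have mE : measurable_fun setT (EFin \o energy_density (dmean v d phi)).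
  by apply/measurable_EFinP; exact: measurable_energy_density.
have E0 z : 0 <= (energy_density (dmean v d phi) z)%:E by rewrite lee_fin energy_density_ge0.
have mQt : measurable_fun setT (fun z : V * V => \int[mu1]_t (Q z.1 z.2 t)%:E).
  apply: (@measurable_fun_fubini_tonelli_F _ _ _ _ _ mu1
    (fun w : (V * V) * measurableTypeR R => (Q w.1.1 w.1.2 w.2)%:E)).
    apply: mQ => //.
    - exact: (measurableT_comp measurable_fst measurable_fst).
    - exact: (measurableT_comp measurable_snd measurable_fst).
  by move=> w; rewrite lee_fin.
apply: (@le_trans _ _ (\int[mu]_x \int[mu]_y \int[mu1]_t (Q x y t)%:E)).
  apply: ge0_le_integral => //.
  - by move=> x _; apply: integral_ge0 => y _; exact: (E0 (x, y)).
  - exact: (@measurable_fun_fubini_tonelli_F _ _ _ _ _ mu _ mE).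
  - apply: (@measurable_fun_fubini_tonelli_F _ _ _ _ _ mu _ mQt).
    by move=> z; apply: integral_ge0 => t _; rewrite lee_fin.
  move=> x _; apply: ge0_le_integral; first exact: measurableT.
  - by move=> y _; exact: (E0 (x, y)).
  - exact: (measurable_fun_pair2 _ mE).
  - exact: (measurable_fun_pair2 _ mQt).
  move=> y _.
  have cx := @continuous_dmean_arg _ _ v d _ x cphi.
  have cy := @continuous_dmean_arg _ _ v d _ y cphi.
  pose g (t : R) := (phi (x + (d * t) *: v) - phi (y + (d * t) *: v))%R.
  have cg : continuous g by move=> t; apply: cvgB; [exact: cx|exact: cy].
  have cg2 : continuous (fun t => g t ^+ 2)%R.
    by move=> t; rewrite /continuous_at expr2; under eq_fun do rewrite expr2; apply: cvgM; exact: cg.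
  rewrite (_ : \int[mu1]_t _ = \int[mu1]_(t in `[0%R, 1%R]%classic) (kern (x - y) * g t ^+ 2)%:E); last first.
    rewrite [RHS]integral_mkcond; apply: eq_integral => t _.
    rewrite /Q/= patchE indicE /energy_density/=; case: ifPn => _; last by rewrite mulr0.
    by rewrite mulr1 mulrC.
  have intg2 := integrable_unit cg2.
  have intkg2 : mu1.-integrable `[0%R, 1%R] (EFin \o (fun t => kern (x - y) * g t ^+ 2)%R).
    by apply: (@integrable_unit _ (fun t => kern (x - y) * g t ^+ 2)%R) => t;
      apply: cvgM; [exact: cvg_cst|exact: cg2].
  rewrite -(fineK (integrable_fin_num _ intkg2))//.
  rewrite lee_fin -/(Rintegral _ _ _) RintegralZl// mulrC.
  rewrite ler_wpM2l ?kern_ge0//.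
  apply: le_trans (sqr_mean_unit_le cg).
  by rewrite /dmean /g RintegralB//; apply: integrable_unit.
rewrite (_ : \int[mu]_x _ = \int[mu1]_t \int[mu]_x \int[mu]_y (Q x y t)%:E).
  rewrite (_ : \int[mu1]_t _ = \int[mu1]_(t in `[0%R, 1%R]%classic) energy phi).
    by rewrite integral_cst//= lebesgue_measure_itv/= lte_fin ltr01 oppr0 adde0 mule1.
  rewrite [RHS]integral_mkcond; apply: eq_integral => t _.
  rewrite patchE /Q; case: ifPn => t01.
    rewrite -[RHS](energy_shift ((d * t) *: v) mphi).
    apply: eq_integral => x _; apply: eq_integral => y _.
    by rewrite indicE t01 mulr1.
  apply: integral0_eq => x _; apply: integral0_eq => y _.
  by rewrite indicE (negbTE t01) mulr0.
transitivity (\int[mu]_x \int[mu1]_t \int[mu]_y (Q x y t)%:E).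
  apply: eq_integral => x _.
  apply: (@fubini_tonelli _ _ _ _ _ mu mu1 (fun w : V * measurableTypeR R => (Q x w.1 w.2)%:E)).
    by apply: mQ.
  by move=> w; rewrite lee_fin.
apply: (@fubini_tonelli _ _ _ _ _ mu mu1 (fun w : V * measurableTypeR R => \int[mu]_y (Q w.1 y w.2)%:E)).
  apply: (@measurable_fun_fubini_tonelli_F _ _ _ _ _ mu
    (fun w : (V * measurableTypeR R) * V => (Q w.1.1 w.2 w.1.2)%:E)).
    apply: mQ => //.
    - exact: (measurableT_comp measurable_fst measurable_fst).
    - exact: (measurableT_comp measurable_snd measurable_fst).
  by move=> w; rewrite lee_fin.
by move=> w; apply: integral_ge0 => y _; rewrite lee_fin.
Qed.

End energy.

Section continuous_realfun.
Context {R : realType} {T : topologicalType}.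
Implicit Types f g : T -> R.

Lemma continuous_funM f g : continuous f -> continuous g ->
  continuous (fun x => f x * g x).
Proof. by move=> cf cg x; exact: (cvgM (cf x) (cg x)). Qed.

Lemma continuous_funB f g : continuous f -> continuous g ->
  continuous (fun x => f x - g x).
Proof. by move=> cf cg x; exact: (cvgB (cf x) (cg x)). Qed.

Lemma continuous_funX2 f : continuous f -> continuous (fun x => f x ^+ 2).
Proof. by move=> cf x; exact: (cvgM (cf x) (cf x)). Qed.

Lemma continuous_funexp f : continuous f -> continuous (fun x => expR (f x)).
Proof. by move=> cf x; apply: (continuous_comp (cf x)); exact: continuous_expR. Qed.

End continuous_realfun.

Lemma continuous_rV_shift (R : realType) (N : nat) (phi : 'rV[R]_N -> R) (a : 'rV[R]_N) :
  continuous phi -> continuous (fun x : 'rV[R]_N => phi (x + a)).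
Proof.
move=> cphi x.
have h := @cvgD R 'rV[R]_N 'rV[R]_N (nbhs x) _ id (cst a) x a cvg_id (cvg_cst a).
exact: (cvg_comp _ _ (h (nbhs_filter x) (nbhs_filter x)) (cphi (x + a))).
Qed.

(** * Extension of stability to continuous functions of bounded support *)

Section stability_continuous.
Local Open Scope ereal_scope.
Context {R : realType} {N : nat}.
Variables (s : R) (u : 'rV[R]_N -> R).
Local Notation mu := (@lebesgueN R N).
Local Notation V := 'rV[R]_N.
Implicit Types phi : V -> R.

Definition bounded_support phi := exists M : R, forall x, (M < `|x|)%R -> phi x = 0%R.

(* dmean along e_k makes phi C^1 in the k-th variable while keeping the
   regularity in the later ones; smooth_from 0 gives C1c, smooth_from N is
   mere continuity. *)
Definition smooth_from (k : nat) phi := [/\ continuous phi, bounded_support phi &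
  forall i : 'I_N, (k <= i)%N ->
    (forall x, derivable phi x (basis_vec i)) /\ continuous (partial i phi)].

Definition stable_at phi := \int[mu]_x (expR (u x) * phi x ^+ 2)%:E <=
  (frac_const N s / 2)%:E * energy s phi.

Lemma frac_const_ge0 : (0 < s)%R -> (0 <= frac_const N s)%R.
Proof.
move=> s0; rewrite /frac_const divr_ge0// ?mulr_ge0 ?powR_ge0//.
- by apply: Rintegral_ge0 => t _; rewrite mulr_ge0 ?powR_ge0 ?expR_ge0.
- by rewrite invr_ge0 prodr_ge0// => i _; rewrite !addr_ge0// ?divr_ge0// ltW.
Qed.

Lemma C1c_smooth phi : smooth_from 0 phi -> C1c phi.
Proof.
move=> [cphi [M Mphi] dphi]; split.
  split => // i; have [d c] := dphi i isT.
  by split.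
apply: (subclosed_compact (@closed_closure _ _) (@cube_compact R N M)).
have -> : [set x : V | (`|x| <= M)%R] = closure [set x : V | (`|x| <= M)%R].
  apply/closure_id.
  by apply: compact_closed; [exact: norm_hausdorff|exact: cube_compact].
apply: closure_subset => x /= /eqP; apply: contra_notT.
by rewrite -ltNge; exact: Mphi.
Qed.

Lemma basis_vec_norm (i : 'I_N) : (`|basis_vec i : V| <= 1)%R.
Proof.
apply/rV_norm_le => // j; rewrite mxE eqxx/=.
by case: (j == i); rewrite ?normr1 ?normr0.
Qed.

Lemma smooth_from_dmean (k : nat) (kN : (k < N)%N) (d : R) phi : (0 < d)%R ->
  smooth_from k.+1 phi -> smooth_from k (dmean (basis_vec (Ordinal kN)) d phi).
Proof.
move=> d0 [cphi [M Mphi] dphi]; set v := basis_vec _; split.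
- exact: dmean_continuous.
- exists (M + d)%R => x xM.
  rewrite /dmean -[RHS](mean_unit_cst (0 : R)); apply: eq_Rintegral => t.
  rewrite inE/= in_itv/= => /andP[t0 t1]; apply: Mphi.
  have : (`|(d * t) *: v| <= d)%R.
    rewrite normrZ (le_trans (y := `|d * t| * 1)%R) ?ler_wpM2l ?basis_vec_norm//.
    by rewrite mulr1 ger0_norm ?mulr_ge0 ?(ltW d0)// ler_piMr// ltW.
  have := lerB_normD x ((d * t) *: v); lra.
- move=> i; rewrite leq_eqVlt => /predU1P[ki|ki].
    have -> : i = Ordinal kN by exact/val_inj.
    rewrite -/v; split => [x|].
      by have [] := @dmean_derive_same _ _ v d phi x d0 cphi.
    rewrite (_ : partial _ _ = fun x => d^-1 * (phi (x + d *: v) - phi x))%R.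
      apply: continuous_funM; first exact: cst_continuous.
      by apply: continuous_funB => //; exact: continuous_rV_shift.
    apply/funext => x; rewrite /partial.
    by have [_ ->] := @dmean_derive_same _ _ v d phi x d0 cphi.
  have [di ci] := dphi i ki; split => [x|].
    by have [] := @dmean_derive_other _ _ v (basis_vec i) d phi x cphi di ci.
  rewrite (_ : partial _ _ = dmean v d (partial i phi)); first exact: dmean_continuous.
  apply/funext => x; rewrite /partial.
  by have [_ ->] := @dmean_derive_other _ _ v (basis_vec i) d phi x cphi di ci.
Qed.

Lemma fatou_bound d (T : measurableType d) (m : {measure set T -> \bar R})
    (f_ : (T -> \bar R)^nat) (f : T -> \bar R) (B : \bar R) :
  (forall n, measurable_fun setT (f_ n)) -> (forall n x, 0 <= f_ n x) ->
  (forall x, f_ ^~ x @ \oo --> f x) -> (forall n, \int[m]_x f_ n x <= B) ->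
  \int[m]_x f x <= B.
Proof.
move=> mf f0 cf fB.
rewrite (_ : \int[m]_x f x = \int[m]_x limn_einf (f_^~ x)); last first.
  apply: eq_integral => x _; rewrite is_cvg_limn_einfE.
    by apply/esym/cvg_lim => //; exact: cf.
  by apply/cvg_ex; exists (f x); exact: cf.
apply: le_trans (fatou _ _ _ _) _ => //.
rewrite limn_einf_lim; apply: lime_le; first exact: is_cvg_einfs.
apply: nearW => n; apply: le_trans (fB n).
by apply: ereal_inf_lbound; exists n => /=.
Qed.

Hypothesis cu : continuous u.
Hypothesis s0 : (0 < s)%R.

(** The averages at scale [1 / (n + 1)] are stable test functions with energy at most that of [phi].
    This bounds the left-hand sides uniformly, and Fatou's lemma passes to the limit without any
    convergence of energies. *)
Lemma stable_at_dmean (k : nat) : (k < N)%N ->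
  (forall phi, smooth_from k phi -> stable_at phi) ->
  forall phi, smooth_from k.+1 phi -> stable_at phi.
Proof.
move=> kN IH phi sphi.
have [cphi _ _] := sphi.
set v := basis_vec (Ordinal kN) : V.
pose phi_ n := dmean v n.+1%:R^-1 phi.
have sphi_ n : smooth_from k (phi_ n) by apply: smooth_from_dmean.
have cphi_ n : continuous (phi_ n) by exact: dmean_continuous.
apply: (@fatou_bound _ _ _ (fun n x => (expR (u x) * phi_ n x ^+ 2)%:E)).
- move=> n; apply/measurable_EFinP; apply: measurable_funM.
    by apply: (measurableT_comp (@measurable_expR R)); exact: continuous_measurable_rV.
  by apply: measurable_funX; exact: continuous_measurable_rV.
- by move=> n x; rewrite lee_fin mulr_ge0 ?expR_ge0 ?sqr_ge0.
- move=> x; apply: cvg_EFin; first exact: nearW.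
  apply: cvgM; first exact: cvg_cst.
  rewrite /= expr2; under eq_fun do rewrite expr2.
  suff h : phi_ n x @[n --> \oo] --> phi x by apply: cvgM; exact: h.
  apply/cvgrPdist_le => e e0.
  have [r /= r0 hr] := @dmean_cvg _ _ v phi x e cphi e0.
  near=> n; rewrite distrC; apply: hr.
  rewrite /ball_/= sub0r normrN ger0_norm ?invr_ge0//.
  by near: n; exact: near_infty_natSinv_lt (PosNum r0).
- move=> n; apply: le_trans (IH _ (sphi_ n)) _.
  apply: lee_wpmul2l; last exact: energy_dmean_le.
  by rewrite lee_fin divr_ge0 ?frac_const_ge0.
Unshelve. all: by end_near. Qed.

Lemma stable_at_continuous phi : is_stable s u ->
  continuous phi -> bounded_support phi -> stable_at phi.
Proof.
move=> st cphi bphi.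
have : forall k, (k <= N)%N -> forall phi, smooth_from k phi -> stable_at phi.
  elim => [_ psi /C1c_smooth spsi|k IH kN]; first exact: st.
  exact: stable_at_dmean kN (IH (ltnW kN)).
move=> /(_ N (leqnn N)); apply; split => // i.
by rewrite leqNgt ltn_ord.
Qed.

End stability_continuous.

(** * Second differences of Hölder functions *)

Section second_difference.
Context {R : realType} {N : nat}.
Local Notation V := 'rV[R]_N.
Implicit Types f u : V -> R.

(** Compactness of the cube: since [Q] is monotone in the constant, each local constant can be
    replaced by any larger one, hence by a common one. *)
Lemma local_to_cube (Q : V -> R -> Prop) (M : R) :
  (forall x C C', 0 < C -> C <= C' -> Q x C -> Q x C') ->
  (forall x0 : V, exists2 C : R, 0 < C & \forall x \near x0, Q x C) ->
  exists2 C : R, 0 < C & forall x, `|x| <= M -> Q x C.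
Proof.
move=> Qmono Qloc.
have /compact_near_coveringP cov := @cube_compact R N M.
have h : \forall C \near +oo, [set x : V | `|x| <= M] `<=` (fun x => Q x C).
  apply: cov => x0 _; have [C0 C00 HC0] := Qloc x0.
  exists ((fun x => Q x C0), [set C | C0 < C]) => /=.
    by split; [exact: HC0|exact: (nbhs_pinfty_gt (num_real C0))].
  by move=> [x C] [/= xQ CC0]; exact: Qmono (ltW CC0) xQ.
have [C [C0 CM]] := filter_ex (filterI (nbhs_pinfty_gt (num_real (0 : R))) h).
by exists C.
Qed.

Lemma MVT_signed (g : R -> R) (a : R) : (forall t, derivable g t (1 : R)) ->
  exists2 c, `|c| <= `|a| & g a - g 0 = a * 'D_1 g c.
Proof.
move=> dg.
have isd t : is_derive t (1 : R) g ('D_1 g t) by exact: DeriveDef.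
have cg : continuous g.
  by move=> t; apply/differentiable_continuous/derivable1_diffP.
have [a0|a0|->] := ltgtP a 0.
- have [c] := MVT a0 (fun t _ => isd t) (continuous_subspaceT cg).
  rewrite in_itv/= => /andP[ac c0] E; exists c.
    by rewrite !ler0_norm ?(ltW a0) ?(ltW c0)// lerN2 ltW.
  by rewrite -opprB E sub0r mulrN opprK mulrC.
- have [c] := MVT a0 (fun t _ => isd t) (continuous_subspaceT cg).
  rewrite in_itv/= => /andP[c0 ca] E; exists c.
    by rewrite !ger0_norm ?(ltW a0) ?(ltW c0)// ltW.
  by rewrite E subr0 mulrC.
- by exists 0 => //; rewrite subrr mul0r.
Qed.

(* The path from x to x + z through the corners changes one coordinate at a time. *)
Definition corner (z : V) (k : nat) : V := \row_i (if (i < k)%N then z ord0 i else 0).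

Lemma corner0 z : corner z 0 = 0.
Proof. by apply/rowP => i; rewrite !mxE. Qed.

Lemma cornerN z : corner z N = z.
Proof. by apply/rowP => i; rewrite !mxE ltn_ord. Qed.

Lemma cornerS z (j : 'I_N) : corner z j.+1 = corner z j + z ord0 j *: basis_vec j.
Proof.
apply/rowP => i; rewrite !mxE eqxx/= ltnS leq_eqVlt.
case: (eqVneq i j) => [->|ij]; first by rewrite !eqxx ltnn/= add0r mulr1.
by rewrite (_ : (_ == _ :> nat) = false) ?mulr0 ?addr0//; apply/negbTE.
Qed.

(** The mean value theorem on each edge of the corner path. Every edge stays within the norm of [z]
    from [x], hence so do the intermediate points. *)
Lemma corner_path f x z :
  (forall y (j : 'I_N), derivable f y (basis_vec j)) ->
  exists xi : 'I_N -> V, (forall j, `|xi j - x| <= `|z|) /\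
    f (x + z) - f x = \sum_(j < N) z ord0 j * partial j f (xi j).
Proof.
move=> df.
have step (j : 'I_N) : exists y : V, `|y - x| <= `|z| /\
    f (x + corner z j.+1) - f (x + corner z j) = z ord0 j * partial j f y.
  pose g (t : R) := f (x + corner z j + t *: basis_vec j).
  have dg t : derivable g t (1 : R) by apply/line_derivable.
  have [c cz E] := MVT_signed (z ord0 j) dg.
  exists (x + corner z j + c *: basis_vec j); split.
    rewrite addrAC (addrAC x) subrr add0r; apply/rV_norm_le => // i; rewrite !mxE eqxx/=.
    case: (eqVneq i j) => [->|ij].
      by rewrite ltnn add0r mulr1 (le_trans cz)// rV_coord_le.
    by rewrite mulr0 addr0; case: ifP => _; rewrite ?normr0// rV_coord_le.
  rewrite /partial line_derive -E /g scale0r addr0.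
  by rewrite cornerS addrA.
have [xi xiP] := choice step.
exists xi; split => [j|]; first by have [] := xiP j.
transitivity (\sum_(j < N) (f (x + corner z j.+1) - f (x + corner z j))).
  by rewrite -(big_mkord xpredT (fun j => f (x + corner z j.+1) - f (x + corner z j)))
    telescope_sumr// corner0 cornerN addr0.
by apply: eq_bigr => j _; have [] := xiP j.
Qed.

Lemma classC1_locally_lipschitz f : classC 1 f -> locally_holder 1 f.
Proof.
move=> [_ df] x.
have bnd (j : 'I_N) : exists M : R, forall y, `|y| <= `|x| + 3 -> `|partial j f y| <= M.
  have [_ [cj _]] := df j.
  by have [M _ HM] := continuous_cube_bounded (`|x| + 3) cj; exists M.
have [M HM] := choice bnd.
exists (\sum_(j < N) `|M j|), (ball x 1); first exact: nbhsx_ballx.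
move=> y z; rewrite mx_norm_ball /ball_/= => xy xz.
have [xi [h1 E]] := @corner_path f z (y - z) (fun y j => (df j).1 y).
rewrite (addrC z) subrK in E; rewrite powRr1 ?eucl_ge0// E.
rewrite (le_trans (ler_norm_sum _ _ _))// mulr_suml ler_sum// => j _.
rewrite normrM mulrC ler_pM//; last first.
  by rewrite (le_trans (rV_coord_le _ _))// rV_norm_le_eucl.
rewrite (le_trans _ (ler_norm _))// HM//.
have yz : `|y - z| <= 2.
  rewrite (_ : y - z = (x - z) - (x - y)); last by apply/rowP => i; rewrite !mxE; ring.
  by rewrite (le_trans (ler_normB _ _))//; lra.
have := h1 j => h1j.
rewrite (_ : xi j = (xi j - z) + (z - x) + x); last by apply/rowP => i; rewrite !mxE; ring.
rewrite (le_trans (ler_normD _ _))// addrC lerD2l (le_trans (ler_normD _ _))//.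
by rewrite -(opprB x z) normrN; lra.
Qed.

(** A single [C] bounds the second difference and, through its inverse, the range of [z]; this makes
    the property monotone in [C], as [local_to_cube] requires. With [b > 2 * s] the symmetrised
    singular integral converges absolutely near the origin. *)
Definition second_diff_bound f (b : R) := forall M : R, exists2 C : R, 0 < C &
  forall x, `|x| <= M -> forall z, `|z| <= C^-1 ->
    `|f (x + z) + f (x - z) - 2 * f x| <= C * `|z| `^ b.

Lemma second_diff_mono f b x C C' : 0 < C -> C <= C' ->
  (forall z, `|z| <= C^-1 -> `|f (x + z) + f (x - z) - 2 * f x| <= C * `|z| `^ b) ->
  forall z, `|z| <= C'^-1 -> `|f (x + z) + f (x - z) - 2 * f x| <= C' * `|z| `^ b.
Proof.
move=> C0 CC' h z zC'.
rewrite (le_trans (h _ _)) ?ler_wpM2r ?powR_ge0//.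
by rewrite (le_trans zC')// lef_pV2 ?posrE// (lt_le_trans C0).
Qed.

Lemma eucl_powR_le (z : V) (g : R) : 0 <= g -> eucl z `^ g <= N%:R `^ g * `|z| `^ g.
Proof.
move=> g0; rewrite -powRM// ge0_ler_powR ?nnegrE ?eucl_ge0 ?mulr_ge0//.
exact: eucl_le_rV_norm.
Qed.

Lemma holder_second_diff f (g : R) : 0 < g -> locally_holder g f ->
  second_diff_bound f g.
Proof.
move=> g0 hf M.
apply: (@local_to_cube (fun x C => forall z, `|z| <= C^-1 ->
   `|f (x + z) + f (x - z) - 2 * f x| <= C * `|z| `^ g) M).
  by move=> x C C'; exact: second_diff_mono.
move=> x0; have [C [U /nbhs_ballP[e /= e0 eU] HU]] := hf x0.
rewrite mx_norm_ball in eU.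
(* The first term accounts for two first differences and the comparison of norms; [2 / e] keeps the
   norm of [z] below [e / 2], so that [x + z] and [x - z] stay in [U]. *)
pose C' := 2 * `|C| * N%:R `^ g + 2 / e + 1.
have C'0 : 0 < C'.
  apply: ltr_wpDl => //; apply: addr_ge0; last by rewrite divr_ge0// ltW.
  by rewrite !mulr_ge0 ?powR_ge0.
exists C' => //; near=> x => z zC'.
have ze : `|z| < e / 2.
  rewrite (le_lt_trans zC')// -[ltRHS]invrK ltf_pV2 ?posrE ?invr_gt0 ?divr_gt0//.
  by rewrite invf_div /C' -addrA ltr_wpDl ?ltrDl// !mulr_ge0 ?powR_ge0.
have xe : `|x0 - x| < e / 2.
  near: x; apply/nbhs_ballP; exists (e / 2) => /=; first by rewrite divr_gt0.
  by rewrite mx_norm_ball.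
have Ux : U x by apply: eU; rewrite /ball_/=; lra.
have Uxp : U (x + z).
  apply: eU; rewrite /ball_/= opprD addrA (le_lt_trans (ler_normB _ _))//; lra.
have Uxm : U (x - z).
  apply: eU; rewrite /ball_/= opprD addrA opprK (le_lt_trans (ler_normD _ _))//; lra.
have h1 := HU _ _ Uxp Ux; have h2 := HU _ _ Uxm Ux.
rewrite (addrAC x) subrr add0r in h1; rewrite (addrAC x) subrr add0r euclN in h2.
have ez := eucl_powR_le z (ltW g0).
have Cz : C * eucl z `^ g <= `|C| * N%:R `^ g * `|z| `^ g.
  by rewrite -mulrA (le_trans (ler_wpM2r (powR_ge0 _ _) (ler_norm C)))// ler_wpM2l.
rewrite (_ : _ + _ - _ = (f (x + z) - f x) + (f (x - z) - f x)); last by ring.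
rewrite (le_trans (ler_normD _ _))//.
have : 2 * `|C| * N%:R `^ g * `|z| `^ g <= C' * `|z| `^ g.
  by rewrite ler_wpM2r ?powR_ge0// /C' -addrA lerDl addr_ge0// divr_ge0// ltW.
lra.
Unshelve. all: by end_near. Qed.

(** The second difference is the increment of [y |-> f (y + z) - f y] from [x - z] to [x]. The
    corner path yields one power of the norm of [z], the Hölder bound on the partial derivatives the
    other [g]. *)
Lemma C1_second_diff f (g : R) : 0 < g ->
  (forall y (j : 'I_N), derivable f y (basis_vec j)) ->
  (forall j, locally_holder g (partial j f)) ->
  second_diff_bound f (1 + g).
Proof.
move=> g0 df hf M.
apply: (@local_to_cube (fun x C => forall z, `|z| <= C^-1 ->
   `|f (x + z) + f (x - z) - 2 * f x| <= C * `|z| `^ (1 + g)) M).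
  by move=> x C C'; exact: second_diff_mono.
move=> x0.
have loc (j : 'I_N) : exists Ce : R * R, 0 < Ce.2 /\ forall y z,
    `|x0 - y| < Ce.2 -> `|x0 - z| < Ce.2 ->
    `|partial j f y - partial j f z| <= `|Ce.1| * eucl (y - z) `^ g.
  have [C [U /nbhs_ballP[e /= e0 eU] HU]] := hf j x0.
  rewrite mx_norm_ball in eU; exists (C, e); split => //= y z y0 z0.
  rewrite (le_trans (HU _ _ (eU _ y0) (eU _ z0)))//.
  by rewrite ler_wpM2r ?powR_ge0// ler_norm.
have [Ce HCe] := choice loc.
pose C0 := \sum_(j < N) `|(Ce j).1|.
(* The intermediate points are within [3 / C'] of [x0] and their translates by [z] within [4 / C'],
   hence the 4; the sum over [j] serves all radii at once. *)
pose e' := \sum_(j < N) 4 / (Ce j).2.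
have e'0 : 0 <= e' by apply: sumr_ge0 => j _; rewrite divr_ge0// ltW//; have [] := HCe j.
have C00 : 0 <= C0 by apply: sumr_ge0.
pose C' := C0 * N%:R `^ g + e' + 1.
have C'0 : 0 < C' by rewrite ltr_wpDl// addr_ge0 ?mulr_ge0 ?powR_ge0.
exists C' => //; near=> x => z zC'.
have xC' : `|x0 - x| < C'^-1.
  near: x; apply/nbhs_ballP; exists C'^-1 => /=; first by rewrite invr_gt0.
  by rewrite mx_norm_ball.
have Cj (j : 'I_N) : C'^-1 < (Ce j).2 / 4.
  have [h _] := HCe j.
  rewrite -[ltRHS]invrK ltf_pV2 ?posrE ?invr_gt0 ?divr_gt0// invf_div.
  rewrite /C' (le_lt_trans (y := e'))//.
    rewrite /e' (bigD1 j)//= lerDl; apply: sumr_ge0 => i _.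
    by rewrite divr_ge0// ltW//; have [] := HCe i.
  by rewrite addrAC ltrDr ltr_wpDl// mulr_ge0 ?powR_ge0.
have dg y (j : 'I_N) : is_derive y (basis_vec j) (fun y => f (y + z) - f y)
    (partial j f (y + z) - partial j f y).
  have shift0 : is_derive y (basis_vec j) (fun y => f (y + z)) (partial j f (y + z)).
    have q : (fun h : R => h^-1 *: (((fun y => f (y + z)) \o shift y) (h *: basis_vec j) - f (y + z)))
      = (fun h : R => h^-1 *: ((f \o shift (y + z)) (h *: basis_vec j) - f (y + z))).
      by apply/funext => h /=; rewrite addrA.
    apply: DeriveDef; first by rewrite /derivable q; exact: df.
    by rewrite /derive q.
  have : is_derive y (basis_vec j) f (partial j f y) by apply: DeriveDef.
  by move=> h; apply: is_deriveB.
have [xi [xiz E]] := @corner_path (fun y => f (y + z) - f y) (x - z) z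
    (fun y j => let: DeriveDef d _ := dg y j in d).
rewrite subrK in E.
rewrite (_ : _ + _ - _ = f (x + z) - f x - (f x - f (x - z))); last by ring.
rewrite E (le_trans (ler_norm_sum _ _ _))//.
apply: (@le_trans _ _ (\sum_(j < N) `|z| * (`|(Ce j).1| * (N%:R `^ g * `|z| `^ g)))).
  apply: ler_sum => j _; rewrite normrM ler_pM// ?rV_coord_le//.
  rewrite {1}/partial; have [_ ->] := dg (xi j) j.
  have [ej Hj] := HCe j.
  have := xiz j => xij.
  have xx : `|x0 - xi j| <= 3 * C'^-1.
    rewrite (_ : x0 - xi j = (x0 - x) + z - (xi j - (x - z))); last first.
      by apply/rowP => i; rewrite !mxE; ring.
    rewrite (le_trans (ler_normB _ _))// (le_trans (lerD (ler_normD _ _) (lexx _)))//.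
    lra.
  have cj := Cj j.
  rewrite (le_trans (Hj _ _ _ _))//.
  - by rewrite opprD addrA (le_lt_trans (ler_normB _ _))//; lra.
  - by lra.
  by rewrite (addrAC (xi j)) subrr add0r ler_wpM2l// eucl_powR_le// ltW.
rewrite -mulr_sumr -mulr_suml -/C0 mulrCA mulrA.
have [->|z0] := eqVneq z 0.
  by rewrite normr0 mulr0 mul0r mulr_ge0 ?powR_ge0// ltW.
rewrite powRD_gt0 ?normr_gt0// powRr1//.
rewrite (_ : C0 * `|z| * _ = C0 * N%:R `^ g * (`|z| * `|z| `^ g)); last by ring.
by rewrite ler_wpM2r ?mulr_ge0 ?powR_ge0// /C' -addrA lerDl addr_ge0.
Unshelve. all: by end_near. Qed.

(** Up to order 1 first differences suffice; up to order 2 the Hölder bound on first derivatives is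
    used. Above order 2 the exponent 2 is enough because [s < 1]: the first derivatives are C^1,
    hence locally Lipschitz. *)
Lemma holder_space_second_diff f (s sigma : R) : 0 < s < 1 -> s < sigma ->
  holder_space (2 * sigma) f -> exists2 b, 2 * s < b & second_diff_bound f b.
Proof.
move=> /andP[s0 s1] ssigma [k [g [/andP[g0 g1] E cf hf]]].
case: k => [|[|k]] in E cf hf *.
- exists g; first by move: E; rewrite add0r; lra.
  by apply: holder_second_diff => //; exact: (hf [tuple]).
- exists (1 + g); first by lra.
  have [_ df] := cf.
  apply: C1_second_diff => // [y j|j]; first by have [] := df j.
  exact: (hf [tuple j]).
- exists (1 + 1); first by lra.
  have [_ df] := cf.
  apply: C1_second_diff => // [y j|j]; first by have [] := df j.
  apply: classC1_locally_lipschitz.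
  have [_ [c h]] := df j; split; first exact: c.
  move=> i; have [d ci] := h i; split; first exact: d.
  by case: (k) ci => [|k'] [].
Qed.

End second_difference.

(** * The equation in weak form *)

Section signed_integral_invariance.
Local Open Scope ereal_scope.
Context {R : realType} {N : nat}.
Local Notation mu := (@lebesgueN R N).
Local Notation V := 'rV[R]_N.

Lemma integral_lebesgueN_shift (a : V) (f : V -> \bar R) :
  measurable_fun setT f -> \int[mu]_x f (x + a)%R = \int[mu]_x f x.
Proof.
move=> mf; rewrite integralE [RHS]integralE; congr (_ - _).
- rewrite -(ge0_integral_lebesgueN_shift a (measurable_funepos mf) (funepos_ge0 f)).
  by apply: eq_integral => x _; rewrite !funeposE.
- rewrite -(ge0_integral_lebesgueN_shift a (measurable_funeneg mf) (funeneg_ge0 f)).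
  by apply: eq_integral => x _; rewrite !funenegE.
Qed.

Lemma integral_lebesgueN_opp (f : V -> \bar R) :
  measurable_fun setT f -> \int[mu]_x f (- x)%R = \int[mu]_x f x.
Proof.
move=> mf; rewrite integralE [RHS]integralE; congr (_ - _).
- rewrite -(ge0_integral_lebesgueN_opp (measurable_funepos mf) (funepos_ge0 f)).
  by apply: eq_integral => x _; rewrite !funeposE.
- rewrite -(ge0_integral_lebesgueN_opp (measurable_funeneg mf) (funeneg_ge0 f)).
  by apply: eq_integral => x _; rewrite !funenegE.
Qed.

Lemma cube_growth1 : cube_growth (fun _ : V => 1%R) (2 ^+ N) N%:R.
Proof.
move=> r r0; rewrite integral_cst ?mul1e; last exact: measurable_rV_cube.
by rewrite [leLHS]lebesgueN_cube ?(ltW r0)// lee_fin exprMn powR_mulrn ?(ltW r0).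
Qed.

End signed_integral_invariance.

(** * Truncated singular integrals and their uniform bound *)

Section truncation.
Local Open Scope ereal_scope.
Context {R : realType} {N : nat}.
Variables (s : R) (u : 'rV[R]_N -> R).
Hypothesis s0 : (0 < s)%R.
Local Notation mu := (@lebesgueN R N).
Local Notation V := 'rV[R]_N.
Local Notation p := (N%:R + 2 * s)%R.

Definition weight (y : V) : R := (((1 + eucl y) `^ p)^-1)%R.

Lemma p_gt0 : (0 < p)%R.
Proof. by rewrite ltr_wpDl// mulr_gt0. Qed.

Lemma eucl1_gt0 (y : V) : (0 < 1 + eucl y)%R.
Proof. by rewrite ltr_wpDr// eucl_ge0. Qed.

Lemma weight_ge0 y : (0 <= weight y)%R.
Proof. by rewrite invr_ge0 powR_ge0. Qed.

Lemma measurable_weight : measurable_fun setT weight.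
Proof.
rewrite (_ : weight = fun y => (1 + eucl y) `^ (- p))%R.
  apply: (measurableT_comp (f := fun t : R => t `^ (- p))%R); first exact: measurable_powR.
  by apply: measurable_funD => //; exact: measurable_eucl.
by apply/funext => y; rewrite powRN.
Qed.

Lemma kern_le_norm (z : V) : z != 0%R -> (kern s z <= `|z| `^ (- p))%R.
Proof.
move=> z0; have n0 : (0 < `|z|)%R by rewrite normr_gt0.
rewrite powRN /kern lef_pV2 ?posrE ?powR_gt0//; last first.
  by rewrite (lt_le_trans n0)// rV_norm_le_eucl.
by rewrite ge0_ler_powR ?nnegrE ?eucl_ge0 ?(ltW p_gt0)// rV_norm_le_eucl.
Qed.

(** By the conventions for powers and inverses of 0 the diagonal contributes nothing, so integrals
    can run over the whole product space. *)
Lemma kern0 : kern s (0 : V) = 0%R.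
Proof. by rewrite /kern eucl0 powR0 ?invr0// gt_eqF// p_gt0. Qed.

Lemma kern_tail (e M : R) : (0 < e)%R -> exists2 C : R, (0 <= C)%R &
  forall x y : V, (`|x| <= M)%R -> (e <= eucl (x - y))%R ->
  (kern s (x - y) <= C * weight y)%R.
Proof.
(* [D] is made for [1 + eucl y <= D * eucl (x - y)]: the triangle inequality bounds the left by a
   constant plus [N] times the distance, and the constant is absorbed because the distance is at
   least [e]. *)
move=> e0; pose D := ((1 + N%:R * `|M|) / e + N%:R)%R.
have D0 : (0 < D)%R by rewrite ltr_wpDr// divr_gt0// ltr_wpDr// mulr_ge0.
exists (D `^ p)%R => [|x y xM exy]; first exact: powR_ge0.
have E0 : (0 < eucl (x - y))%R by exact: lt_le_trans exy.
have yD : (1 + eucl y <= D * eucl (x - y))%R.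
  rewrite mulrDl; apply: (@le_trans _ _ (1 + N%:R * `|M| + N%:R * eucl (x - y))%R).
    rewrite -addrA lerD2l (le_trans (eucl_le_rV_norm y))// -mulrDr ler_wpM2l//.
    rewrite -{1}(subKr x y) (le_trans (ler_normB _ _))// lerD ?rV_norm_le_eucl//.
    by rewrite (le_trans xM)// ler_norm.
  rewrite lerD2r mulrAC ler_pdivlMr// ler_wpM2l// addr_ge0// mulr_ge0//.
rewrite /kern /weight -ler_pdivrMr ?invr_gt0 ?powR_gt0 ?eucl1_gt0// invrK.
rewrite mulrC ler_pdivrMr ?powR_gt0// -powRM ?(ltW D0) ?(ltW E0)//.
by rewrite ge0_ler_powR ?nnegrE ?(ltW p_gt0) ?(ltW (eucl1_gt0 _)) ?mulr_ge0 ?(ltW D0) ?(ltW E0).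
Qed.

Lemma integral_weight_lty : \int[mu]_y (weight y)%:E < +oo.
Proof.
have mw : measurable_fun setT (EFin \o weight) by apply/measurable_EFinP; exact: measurable_weight.
have mc1 := @measurable_rV_cube R N 1%R.
rewrite -(setUv [set x : V | `|x| <= 1]%R) ge0_integral_setU//=; last 4 first.
- exact: measurableC.
- by rewrite setUv.
- by move=> x _; rewrite lee_fin weight_ge0.
- exact/disj_setPCl.
apply: lte_add_pinfty.
  apply: (@le_lt_trans _ _ (\int[mu]_(x in [set x : V | `|x| <= 1]%R) (1%:E))).
    apply: ge0_le_integral => //.
    - by move=> x _; rewrite lee_fin weight_ge0.
    - exact: measurable_funTS.
    - move=> x _; rewrite lee_fin /weight invf_le1 ?powR_gt0 ?eucl1_gt0//.
      by rewrite -[leLHS](powRr0 (1 + eucl x)) ler_powR ?lerDl ?eucl_ge0 ?(ltW p_gt0).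
  apply: le_lt_trans (cube_growth1 ltr01) _; exact: ltry.
have pN : (N%:R < p)%R by rewrite ltrDl mulr_gt0.
have [C C0 hC] := @integral_tail R N (fun _ => 1%R) _ _ p
  (measurable_cst _) (fun _ => ler01) cube_growth1 (ltW p_gt0) pN.
apply: (@le_lt_trans _ _ _ _ _ (le_trans _ (hC _ ltr01)) (ltry _)).
rewrite (_ : ~` _ = [set x : V | 1 < `|x|]%R); last first.
  by apply/seteqP; split => x /=; rewrite ltNge => /negP.
have m1 : measurable [set x : V | 1 < `|x|]%R.
  have := @measurable_rV_normitv R N `]1%R, +oo[.
  by congr measurable; apply/seteqP; split => x /=; rewrite in_itv/= andbT.
apply: ge0_le_integral => //.
- by move=> x _; rewrite lee_fin weight_ge0.
- exact: measurable_funTS.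
- by apply: measurable_funTS; apply/measurable_EFinP; apply: measurable_funM => //; exact: measurable_rV_norm_powR.
move=> x /= x1; rewrite lee_fin mul1r powRN /weight lef_pV2 ?posrE ?powR_gt0 ?eucl1_gt0 ?(lt_trans ltr01)//.
rewrite ge0_ler_powR ?nnegrE ?(ltW p_gt0) ?(ltW (eucl1_gt0 _))//.
by rewrite (le_trans (rV_norm_le_eucl x))// lerDr.
Qed.

Hypothesis cu : continuous u.
Hypothesis uW : \int[mu]_x (`|u x| / (1 + eucl x) `^ p)%:E < +oo.

Lemma integrable_affine_weight (B : R) : (0 <= B)%R ->
  mu.-integrable setT (fun y => ((B + `|u y|) * weight y)%:E).
Proof.
move=> B0.
have mu_ := continuous_measurable_rV cu.
have m1 : measurable_fun setT (fun y => (B * weight y)%:E).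
  by apply/measurable_EFinP; apply: measurable_funM => //; exact: measurable_weight.
have m2 : measurable_fun setT (fun y => (`|u y| * weight y)%:E).
  apply/measurable_EFinP; apply: measurable_funM; last exact: measurable_weight.
  exact: (measurableT_comp (@normr_measurable R setT) mu_).
rewrite (_ : (fun y => _) = (fun y => (B * weight y)%:E) \+ (fun y => (`|u y| * weight y)%:E)); last first.
  by apply/funext => y /=; rewrite -EFinD mulrDl.
apply: integrableD => //; apply/integrableP; split => //.
- under eq_integral do rewrite gee0_abs ?lee_fin ?mulr_ge0 ?weight_ge0// EFinM.
  rewrite ge0_integralZl ?lee_fin//.
  + by rewrite lte_mul_pinfty ?lee_fin// integral_weight_lty.
  + by apply/measurable_EFinP; exact: measurable_weight.
  + by move=> y _; rewrite lee_fin weight_ge0.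
- under eq_integral do rewrite gee0_abs ?lee_fin ?mulr_ge0 ?weight_ge0//.
  exact: uW.
Qed.

(** The truncation set is general because the exterior of a ball is later split into a part near the
    origin, treated by symmetry, and a far part. *)
Definition tkern (D : set V) (z : V) : R := (kern s z * \1_D z)%R.

Lemma tkern_ge0 D z : (0 <= tkern D z)%R.
Proof. by rewrite mulr_ge0 ?kern_ge0. Qed.

Lemma measurable_tkern D : measurable D -> measurable_fun setT (tkern D).
Proof.
move=> mD; apply: measurable_funM; first exact: measurable_kern.
exact/measurable_indicP.
Qed.

Definition tint (D : set V) (x : V) : \bar R :=
  \int[mu]_y ((u x - u y) * tkern D (x - y))%:E.

(** The constants depend on [D] only through its distance [e] to the origin, so one majorant serves
    all truncations of the far part. *)
Lemma tint_dom (e M : R) : (0 < e)%R -> exists C B : R, [/\ (0 <= C)%R, (0 <= B)%R &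
  forall (D : set V) (x y : V), (forall z, D z -> e <= eucl z)%R -> (`|x| <= M)%R ->
  (`|(u x - u y) * tkern D (x - y)| <= C * ((B + `|u y|) * weight y))%R].
Proof.
move=> e0; have [C C0 hC] := kern_tail M e0.
have [B B0 hB] := continuous_cube_bounded M cu.
exists C, B; split => // D x y De xM.
have rhs0 : (0 <= C * ((B + `|u y|) * weight y))%R.
  by rewrite mulr_ge0// mulr_ge0 ?weight_ge0// addr_ge0.
rewrite /tkern indicE; case: (boolP ((x - y)%R \in D)) => [|_]; last by rewrite !mulr0 normr0.
rewrite inE mulr1 => /De exy.
rewrite normrM (ger0_norm (kern_ge0 _ _)) mulrCA ler_pM ?kern_ge0//; last exact: hC.
by rewrite (le_trans (ler_normB _ _))// lerD2r hB.
Qed.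

Lemma measurable_tint_arg D x : measurable D ->
  measurable_fun setT (fun y => ((u x - u y) * tkern D (x - y))%:E).
Proof.
move=> mD; apply/measurable_EFinP; apply: measurable_funM.
  by apply: measurable_funB => //; exact: continuous_measurable_rV.
apply: (measurableT_comp (measurable_tkern mD)).
exact: (measurableT_comp measurable_rV_sub (@pair1_measurable _ _ _ _ x)).
Qed.

Lemma integrable_tint D (e : R) x : measurable D -> (0 < e)%R ->
  (forall z, D z -> e <= eucl z)%R ->
  mu.-integrable setT (fun y => ((u x - u y) * tkern D (x - y))%:E).
Proof.
move=> mD e0 De; have [C [B [C0 B0 dom]]] := @tint_dom e `|x|%R e0.
apply: (@le_integrable _ _ _ _ _ measurableT _ (fun y => C%:E * ((B + `|u y|) * weight y)%:E)).
- exact: measurable_tint_arg.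
- move=> y _; rewrite -EFinM /= lee_fin [leRHS]ger0_norm; first exact: dom.
  by rewrite mulr_ge0// mulr_ge0 ?weight_ge0// addr_ge0.
- by apply: integrableZl => //; exact: integrable_affine_weight.
Qed.

Lemma tint_bounded (e M : R) : (0 < e)%R -> exists2 C : R, (0 <= C)%R &
  forall (D : set V) (x : V), measurable D -> (forall z, D z -> e <= eucl z)%R ->
  (`|x| <= M)%R -> `|tint D x| <= C%:E.
Proof.
move=> e0; have [C [B [C0 B0 dom]]] := tint_dom M e0.
have iW : mu.-integrable setT (fun y => C%:E * ((B + `|u y|) * weight y)%:E).
  by apply: integrableZl => //; exact: integrable_affine_weight.
exists (fine (\int[mu]_y (C%:E * ((B + `|u y|) * weight y)%:E))).
  apply: fine_ge0; apply: integral_ge0 => y _.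
  by rewrite -EFinM lee_fin mulr_ge0// mulr_ge0 ?weight_ge0// addr_ge0.
move=> D x mD De xM; rewrite fineK; last exact: integrable_fin_num.
apply: le_trans (le_abse_integral _ _ _) _ => //; first exact: measurable_tint_arg.
apply: ge0_le_integral => //.
- by apply: measurableT_comp => //; exact: measurable_tint_arg.
- exact: measurable_int iW.
- by move=> y _; rewrite -EFinM /= lee_fin; exact: dom.
Qed.

(** Substituting [- z] for [z] expresses twice the integral through the second difference, which
    cancels the first-order part of the singularity. The gained factor 2 is discarded. *)
Lemma tint_sym_le (D : set V) (e : R) (x : V) : measurable D -> (0 < e)%R ->
  (forall z, D z -> e <= eucl z)%R -> (forall z, D (- z)%R = D z) ->
  `|tint D x| <= \int[mu]_z (`|u (x + z) + u (x - z) - 2 * u x| * tkern D z)%:E.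
Proof.
move=> mD e0 De symD.
have ig := integrable_tint x mD e0 De.
have mg := measurable_tint_arg x mD.
have tN z : tkern D (- z) = tkern D z.
  rewrite /tkern kernN !indicE; congr (_ * (_ : bool)%:R)%R.
  by apply/idP/idP; rewrite !inE symD.
pose h z := ((u x - u (z + x)) * tkern D z)%:E.
have hE z : h z = ((u x - u (z + x)) * tkern D (x - (z + x)))%:E.
  by rewrite /h opprD addrCA subrr addr0 tN.
have mh : measurable_fun setT h.
  rewrite (_ : h = (fun z => ((u x - u (z + x)) * tkern D (x - (z + x)))%:E)); last exact/funext.
  exact: (measurableT_comp mg (measurable_rV_shift x)).
have Jh : tint D x = \int[mu]_z h z.
  by rewrite /tint -(integral_lebesgueN_shift x mg); apply: eq_integral => z _; rewrite hE.
have mh' : measurable_fun setT (fun z : V => h (- z)%R).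
  exact: (measurableT_comp mh (@measurable_rV_opp R N)).
have ih : mu.-integrable setT h.
  apply/integrableP; split => //; move/integrableP : ig => [_].
  rewrite -(@integral_lebesgueN_shift _ _ x (fun y => `|((u x - u y) * tkern D (x - y))%:E|)).
    by under eq_integral do rewrite -hE.
  exact: measurableT_comp.
have ih' : mu.-integrable setT (fun z : V => h (- z)%R).
  apply/integrableP; split => //; move/integrableP : ih => [_].
  by rewrite -(@integral_lebesgueN_opp _ _ (fun y => `|h y|))//; exact: measurableT_comp.
have J2 : tint D x + tint D x = \int[mu]_z (h z + h (- z)%R).
  rewrite integralD// {1}Jh; congr (_ + _).
  by rewrite Jh -integral_lebesgueN_opp.
apply: (@le_trans _ _ `|tint D x + tint D x|).
  have Jf : tint D x \is a fin_num by rewrite Jh; exact: integrable_fin_num.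
  rewrite -(fineK Jf) -EFinD /= lee_fin -mulr2n normrMn mulr2n lerDl//.
rewrite J2; apply: le_trans (le_abse_integral _ _ _) _ => //; first exact: emeasurable_funD.
rewrite le_eqVlt; apply/orP; left; apply/eqP; apply: eq_integral => z _.
rewrite /h tN -EFinD /=; congr (_%:E).
rewrite -mulrDl normrM (ger0_norm (tkern_ge0 _ _)); congr (_ * _)%R.
by rewrite -normrN; congr (`|_|%R); rewrite (addrC z) (addrC (- z)%R); ring.
Qed.

Definition outer (e : R) : set V := [set z | (e <= eucl z)%R].

Lemma measurable_outer e : measurable (outer e).
Proof.
have := @measurable_eucl R N measurableT _ (measurable_itv `[e, +oo[).
by rewrite setTI; congr measurable; apply/seteqP; split => z /=; rewrite in_itv/= andbT.
Qed.

(** Uniformity in [e] provides the majorant for letting the truncation tend to 0. Within radius [r]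
    the symmetrised integrand is at most [C0] times the norm to the power [b - p], integrable since
    [2 * s < b]; beyond [r] the bound is independent of [e]. *)
Lemma tint_outer_bounded (b M : R) : (2 * s < b)%R -> second_diff_bound u b ->
  exists2 C : R, (0 <= C)%R & forall e x, (0 < e)%R -> (`|x| <= M)%R ->
  `|tint (outer e) x| <= C%:E.
Proof.
move=> sb sd; have [C0 C00 hC0] := sd M.
pose r := (C0^-1)%R; have r0 : (0 < r)%R by rewrite invr_gt0.
have [C1 C10 hC1] := tint_bounded M r0.
have pbN : (p - b < N%:R)%R by rewrite ltrBlDr ltrD2l.
have [C2 C20 hC2] := @integral_head R N (fun _ => 1%R) _ _ (p - b)%R
  (measurable_cst _) (fun _ => ler01) cube_growth1 (ler0n _ _) pbN.
exists (C0 * (C2 * r `^ (N%:R - (p - b))) + C1)%R.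
  by rewrite addr_ge0// !mulr_ge0 ?powR_ge0// ltW.
move=> e x e0 xM.
pose D1 := outer e `&` [set z | `|z| <= r]%R.
pose D2 := outer e `&` ~` [set z | `|z| <= r]%R.
have mc := @measurable_rV_cube R N r.
have mD1 : measurable D1 by apply: measurableI => //; exact: measurable_outer.
have mD2 : measurable D2 by apply: measurableI; [exact: measurable_outer|exact: measurableC].
have D1e z : D1 z -> (e <= eucl z)%R by case.
have D2e z : D2 z -> (e <= eucl z)%R by case.
have D2r z : D2 z -> (r <= eucl z)%R.
  by move=> [_ /negP]; rewrite -ltNge => rz; rewrite (le_trans (ltW rz))// rV_norm_le_eucl.
have JD : tint (outer e) x = tint D1 x + tint D2 x.
  rewrite /tint -integralD//; [|exact: (integrable_tint x mD1 e0)|exact: (integrable_tint x mD2 e0)].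
  apply: eq_integral => y _; rewrite -EFinD -mulrDr; congr (_ * _)%:E.
  rewrite /tkern -mulrDr; congr (_ * _)%R.
  rewrite !indicE -natrD; congr (_%:R)%R.
  have -> : ((x - y)%R \in D1) = ((x - y)%R \in outer e) && (`|x - y| <= r)%R.
    by rewrite in_setI; congr (_ && _); apply/idP/idP; rewrite inE.
  have -> : ((x - y)%R \in D2) = ((x - y)%R \in outer e) && ~~ (`|x - y| <= r)%R.
    by rewrite in_setI in_setC; congr (_ && ~~ _); apply/idP/idP; rewrite inE.
  by case: (_ \in _); case: (_ <= _)%R.
rewrite JD EFinD; apply: le_trans (lee_abs_add _ _) _; apply: leeD; last exact: hC1.
have symD1 z : D1 (- z)%R = D1 z by rewrite /D1/= /outer/= /setI/= euclN normrN.
apply: le_trans (tint_sym_le x mD1 e0 D1e symD1) _.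
rewrite EFinM; apply: le_trans (lee_wpmul2l _ (hC2 _ r0)); last by rewrite lee_fin ltW.
have mB : measurable [set z : V | 0 < `|z| <= r]%R.
  exact: (@measurable_rV_normitv R N `]0%R, r]).
have mw : measurable_fun setT (fun z : V => (1 * `|z| `^ (- (p - b)))%:E).
  by apply/measurable_EFinP; apply: measurable_funM => //; exact: measurable_rV_norm_powR.
rewrite -ge0_integralZl//; last 2 first.
- exact: measurable_funTS.
- by rewrite lee_fin ltW.
rewrite [leRHS]integral_mkcond; apply: ge0_le_integral => //.
- by move=> z _; rewrite lee_fin mulr_ge0 ?tkern_ge0.
- apply/measurable_EFinP; apply: measurable_funM; last exact: measurable_tkern.
  apply: (measurableT_comp (@normr_measurable R setT)); apply: measurable_funB => //.
  have mux : measurable_fun setT (fun z : V => u (z + x)%R).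
    by apply: continuous_measurable_rV; exact: continuous_rV_shift.
  apply: measurable_funD.
    by rewrite (_ : (fun z : V => u (x + z)%R) = (fun z : V => u (z + x)%R))//; apply/funext => z; rewrite addrC.
  rewrite (_ : (fun z : V => u (x - z)%R) = (fun z : V => u (- z + x)%R)); last first.
    by apply/funext => z; rewrite addrC.
  exact: (measurableT_comp mux (@measurable_rV_opp R N)).
- apply/(measurable_restrictT _ mB); apply: measurable_funTS.
  exact: measurable_funeM.
move=> z _; rewrite patchE /tkern.
have [zD1|zD1] := boolP (z \in D1); last first.
  rewrite indicE (negbTE zD1) !mulr0; case: ifP => // _.
  by rewrite -EFinM lee_fin mulr_ge0 ?(ltW C00)// mulr_ge0// powR_ge0.
have [ez zr] : D1 z by rewrite inE in zD1.
have z0 : z != 0%R.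
  by apply: contraTneq e0 => z0; rewrite -leNgt; move: ez; rewrite /outer/= z0 eucl0.
have nz0 : (0 < `|z|)%R by rewrite normr_gt0.
rewrite ifT; last by rewrite inE/= nz0.
rewrite indicE zD1 mulr1 -EFinM lee_fin mul1r.
rewrite opprB (powRD_gt0 b (- p) nz0) mulrA.
by rewrite ler_pM ?kern_ge0 ?kern_le_norm// hC0.
Qed.

End truncation.

Section integral_swap.
Local Open Scope ereal_scope.
Context d (T : measurableType d) (R : realType).
Variable m : {sigma_finite_measure set T -> \bar R}.
Implicit Types f : T * T -> \bar R.

Lemma ge0_integral_swap f : measurable_fun setT f -> (forall z, 0 <= f z) ->
  \int[m \x m]_z f (z.2, z.1) = \int[m \x m]_z f z.
Proof.
move=> mf f0.
rewrite fubini_tonelli1//; last exact: (measurableT_comp mf (@measurable_swap _ _ T T)).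
by rewrite -[LHS]fubini_tonelli// fubini_tonelli1.
Qed.

Lemma integral_swap f : measurable_fun setT f ->
  \int[m \x m]_z f (z.2, z.1) = \int[m \x m]_z f z.
Proof.
move=> mf; rewrite integralE [RHS]integralE; congr (_ - _).
- rewrite -(ge0_integral_swap (measurable_funepos mf) (funepos_ge0 f)).
  by apply: eq_integral => x _; rewrite !funeposE.
- rewrite -(ge0_integral_swap (measurable_funeneg mf) (funeneg_ge0 f)).
  by apply: eq_integral => x _; rewrite !funenegE.
Qed.

Lemma integrable_swap f : (m \x m).-integrable setT f ->
  (m \x m).-integrable setT (fun z => f (z.2, z.1)).
Proof.
move=> /integrableP[mf foo]; apply/integrableP; split.
  exact: (measurableT_comp mf (@measurable_swap _ _ T T)).
by rewrite (ge0_integral_swap (f := fun z => `|f z|))//; exact: measurableT_comp.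
Qed.

End integral_swap.

(** * Weak form of the equation as an inequality *)

Section weak_inequality.
Local Open Scope ereal_scope.
Context {R : realType} {N : nat}.
Variables (s : R) (u : 'rV[R]_N -> R).
Hypothesis s0 : (0 < s)%R.
Local Notation mu := (@lebesgueN R N).
Local Notation V := 'rV[R]_N.
Local Notation p := (N%:R + 2 * s)%R.
Local Notation c := (frac_const N s).
Hypothesis cu : continuous u.
Hypothesis uW : \int[mu]_x (`|u x| / (1 + eucl x) `^ p)%:E < +oo.

Lemma integrable_bounded_support (phi : V -> R) : continuous phi ->
  bounded_support phi -> mu.-integrable setT (EFin \o phi).
Proof.
move=> cphi [M Mphi]; have [B B0 hB] := continuous_cube_bounded `|M| cphi.
have mphi := continuous_measurable_rV cphi.
have mc := @measurable_rV_cube R N `|M|%R.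
have -> : EFin \o phi = (EFin \o phi) \_ [set x : V | `|x| <= `|M|]%R.
  apply/funext => x; rewrite patchE; case: ifPn => //.
  rewrite notin_setE/= => /negP; rewrite -ltNge => Mx.
  by rewrite Mphi// (le_lt_trans (ler_norm _)).
apply: (integrable_mkcond (EFin \o phi) mc).1.
apply: measurable_bounded_integrable => //.
- by rewrite [ltLHS]lebesgueN_cube ?ltry.
- exact: measurable_funTS.
- exists B; split; first exact: num_real.
  by move=> B' BB' x /= xM; rewrite (le_trans (hB _ xM))// ltW.
Qed.

Lemma frac_lap_truncE x (e : R) :
  frac_lap_trunc s u x e = (c * fine (tint s u (outer e) x))%R.
Proof.
rewrite /frac_lap_trunc /Rintegral; congr (_ * fine _)%R.
rewrite integral_mkcond; apply: eq_integral => y _.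
rewrite patchE /tkern /kern indicE.
have -> : (y \in ~` eball x e) = ((x - y)%R \in outer e).
  apply/idP/idP; rewrite !inE/= /eball/= /outer/= eucl_distC.
    by move/negP; rewrite -leNgt.
  by move=> h; apply/negP; rewrite -leNgt.
by case: ifPn => _; rewrite ?mulr1 ?mulr0.
Qed.

Variable psi : V -> R.
Hypothesis cpsi : continuous psi.
Hypothesis bpsi : bounded_support psi.

(** Half of the symmetric form: adding the swapped pairing gives the product of the differences of
    [u] and [psi] times the truncated kernel. *)
Definition pairing (e : R) (z : V * V) : R :=
  (psi z.1 * ((u z.1 - u z.2) * tkern s (outer e) (z.1 - z.2)))%R.

Lemma measurable_tkern_sub (e : R) :
  measurable_fun setT (fun z : V * V => tkern s (outer e) (z.1 - z.2)).
Proof.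
exact: (measurableT_comp (measurable_tkern s (measurable_outer e)) measurable_rV_sub).
Qed.

Lemma measurable_pairing e : measurable_fun setT (EFin \o pairing e).
Proof.
have mphi := continuous_measurable_rV cpsi; have mu_ := continuous_measurable_rV cu.
apply/measurable_EFinP; apply: measurable_funM.
  exact: (measurableT_comp mphi measurable_fst).
apply: measurable_funM; last exact: measurable_tkern_sub.
apply: measurable_funB; first exact: (measurableT_comp mu_ measurable_fst).
exact: (measurableT_comp mu_ measurable_snd).
Qed.

Lemma integrable_pairing e : (0 < e)%R -> (mu \x mu).-integrable setT (EFin \o pairing e).
Proof.
move=> e0; apply/integrable12ltyP; first exact: measurable_pairing.
have [M Mpsi] := bpsi.
have [C [B [C0 B0 dom]]] := tint_dom s0 cu M e0.
have iW := integrable_affine_weight s0 cu uW B0.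
pose K := \int[mu]_y ((B + `|u y|) * weight s y)%:E.
have Kf : K \is a fin_num by exact: integrable_fin_num.
have ipsi := integrable_bounded_support cpsi bpsi.
have mpsi := continuous_measurable_rV cpsi.
have mW : measurable_fun setT (fun y => ((B + `|u y|) * weight s y)%:E) by exact: measurable_int iW.
have W0 y : (0 <= (B + `|u y|) * weight s y)%R by rewrite mulr_ge0 ?weight_ge0// addr_ge0.
apply: (@le_lt_trans _ _ (\int[mu]_x (`|(psi x)%:E| * (C%:E * K)))).
  apply: ge0_le_integral => //.
  - by move=> x _; apply: integral_ge0.
  - apply: (@measurable_fun_fubini_tonelli_F _ _ _ _ _ mu (fun z => `|(pairing e z)%:E|)) => //.
    by apply: measurableT_comp => //; exact: measurable_pairing.
  - apply: emeasurable_funM => //; apply: measurableT_comp => //.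
    exact/measurable_EFinP.
  move=> x _; rewrite /K -ge0_integralZl//; last by move=> y _; rewrite lee_fin.
  rewrite -ge0_integralZl//; last 2 first.
  - exact: measurable_funeM.
  - by move=> y _; rewrite -EFinM lee_fin mulr_ge0.
  apply: ge0_le_integral => //.
  - apply: measurableT_comp => //.
    exact: (measurable_fun_pair2 _ (measurable_pairing e)).
  - by apply: measurable_funeM; exact: measurable_funeM.
  move=> y _; rewrite /pairing/= normrM -!EFinM lee_fin.
  have [Mx|xM] := ltP M `|x|%R; first by rewrite Mpsi// normr0 !mul0r.
  by rewrite ler_wpM2l//; apply: dom.
rewrite ge0_integralZr//; last 2 first.
- by apply: measurableT_comp => //; exact/measurable_EFinP.
- by rewrite mule_ge0// ?lee_fin//; apply: integral_ge0 => y _; rewrite lee_fin.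
have /integrableP[_ ipsi'] := ipsi.
rewrite -(fineK Kf) -EFinM.
apply: lte_mul_pinfty => //; last exact: ltry.
- exact: integral_ge0.
- by rewrite ge0_fin_numE//; exact: integral_ge0.
Qed.

Lemma integral_pairing e : (0 < e)%R ->
  c%:E * \int[mu \x mu]_z (pairing e z)%:E =
  \int[mu]_x (psi x * frac_lap_trunc s u x e)%:E.
Proof.
move=> e0; have ip := integrable_pairing e0.
have := integral12_prod_meas1 ip; rewrite /= => <-.
rewrite -integralZl//; last exact: integrable_fubini_F.
apply: eq_integral => x _; rewrite /fubini_F/= frac_lap_truncE.
have it : mu.-integrable setT (fun y => ((u x - u y) * tkern s (outer e) (x - y))%:E).
  by apply: (integrable_tint s0 cu uW _ _ e0) => //; exact: measurable_outer.
rewrite (_ : \int[mu]_y _ = (psi x)%:E * tint s u (outer e) x).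
  have tf : tint s u (outer e) x \is a fin_num by exact: integrable_fin_num it.
  by rewrite -{1}(fineK tf) -!EFinM mulrCA.
by rewrite /tint -integralZl//.
Qed.

(** The pointwise bound is integrated against the truncated kernel. Symmetrisation produces twice
    the pairing, which cancels the 2 in [c / 2]; in the error term the truncation is dropped as an
    upper bound. *)
Lemma truncated_inequality (A E : V * V -> R) (a e : R) : (0 < e)%R ->
  measurable_fun setT A -> measurable_fun setT E ->
  (forall z, 0 <= A z)%R -> (forall z, 0 <= E z)%R -> (0 <= a)%R ->
  (forall z, A z <= a * ((u z.1 - u z.2) * (psi z.1 - psi z.2)) + E z)%R ->
  (c / 2)%:E * \int[mu \x mu]_z (A z * tkern s (outer e) (z.1 - z.2))%:E <=
  a%:E * \int[mu]_x (psi x * frac_lap_trunc s u x e)%:E +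
  (c / 2)%:E * \int[mu \x mu]_z (E z * kern s (z.1 - z.2))%:E.
Proof.
move=> e0 mA mE A0 E0 a0 AE.
have c0 : (0 <= c)%R by exact: frac_const_ge0.
rewrite -integral_pairing//.
set IE := \int[mu \x mu]_z (E z * kern s (z.1 - z.2))%:E.
set G := \int[mu \x mu]_z (pairing e z)%:E.
have ip := integrable_pairing e0.
have Gf : G \is a fin_num by exact: integrable_fin_num.
have tk0 z : (0 <= tkern s (outer e) (z.1 - z.2 : V))%R by exact: tkern_ge0.
have mtk := measurable_tkern_sub e.
have IE0 : 0 <= IE by apply: integral_ge0 => z _; rewrite lee_fin mulr_ge0 ?kern_ge0.
have main : \int[mu \x mu]_z (A z * tkern s (outer e) (z.1 - z.2))%:E <= (a *+ 2)%:E * G + IE.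
  (* An infinite error makes the bound trivial; otherwise the truncated error is integrable and
     linearity applies. *)
  have [IEoo|IEfin] := eqVneq IE +oo.
    by rewrite IEoo addey ?leey// -(fineK Gf) -EFinM.
  have mEt : measurable_fun setT (fun z => (E z * tkern s (outer e) (z.1 - z.2))%:E).
    by apply/measurable_EFinP; exact: measurable_funM.
  have EtIE : \int[mu \x mu]_z (E z * tkern s (outer e) (z.1 - z.2))%:E <= IE.
    apply: ge0_le_integral => //.
    - by move=> z _; rewrite lee_fin mulr_ge0.
    - apply/measurable_EFinP; apply: measurable_funM => //; exact: measurable_kern_sub.
    move=> z _; rewrite lee_fin; apply: ler_wpM2l => //; apply: ler_piMr.
      exact: kern_ge0.
    by rewrite indicE lern1 leq_b1.
  have iEt : (mu \x mu).-integrable setT (fun z => (E z * tkern s (outer e) (z.1 - z.2))%:E).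
    apply/integrableP; split => //.
    rewrite (_ : \int[_]_x _ = \int[mu \x mu]_z (E z * tkern s (outer e) (z.1 - z.2))%:E).
      by rewrite (le_lt_trans EtIE)// ltey.
    by apply: eq_integral => z _; rewrite gee0_abs// lee_fin mulr_ge0.
  have is_ := integrable_swap ip.
  have iS : (mu \x mu).-integrable setT (fun z => (pairing e z)%:E + (pairing e (z.2, z.1))%:E).
    exact: integrableD.
  have SE z : (pairing e z)%:E + (pairing e (z.2, z.1))%:E =
      ((u z.1 - u z.2) * (psi z.1 - psi z.2) * tkern s (outer e) (z.1 - z.2))%:E.
    rewrite /pairing -EFinD/=; congr (_%:E).
    have -> : tkern s (outer e) (z.2 - z.1) = tkern s (outer e) (z.1 - z.2).
      rewrite -(opprB z.1) /tkern kernN !indicE; congr (_ * (_ : bool)%:R)%R.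
      by apply/idP/idP; rewrite !inE /outer/= euclN.
    by ring.
  apply: (@le_trans _ _ (\int[mu \x mu]_z (a%:E * ((pairing e z)%:E + (pairing e (z.2, z.1))%:E)
       + (E z * tkern s (outer e) (z.1 - z.2))%:E))).
    apply: ge0_le_integral => //.
    - by move=> z _; rewrite lee_fin mulr_ge0.
    - by apply/measurable_EFinP; exact: measurable_funM.
    - apply: emeasurable_funD => //; apply: measurable_funeM.
      exact: measurable_int iS.
    move=> z _; rewrite SE -EFinM -EFinD lee_fin.
    rewrite (_ : (a * _ + _)%R = ((a * ((u z.1 - u z.2) * (psi z.1 - psi z.2)) + E z)
      * tkern s (outer e) (z.1 - z.2))%R); last by ring.
    by rewrite ler_wpM2r.
  rewrite integralD//=; last exact: integrableZl.
  rewrite leeD// integralZl// integralD//=.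
  have /= -> := integral_swap mu (measurable_pairing e).
  by rewrite -/G -(fineK Gf) -EFinD -!EFinM lee_fin -mulr2n mulrnAl mulrnAr.
apply: (@le_trans _ _ ((c / 2)%:E * ((a *+ 2)%:E * G + IE))).
  by rewrite lee_wpmul2l// lee_fin divr_ge0.
rewrite muleDr//; last by rewrite fin_num_adde_defr// -(fineK Gf).
rewrite leeD// -(fineK Gf) -!EFinM lee_fin le_eqVlt; apply/orP; left; apply/eqP.
by field.
Qed.

Hypothesis sol : forall x, is_frac_lap s u x (expR (u x)).
Variable b : R.
Hypothesis sb : (2 * s < b)%R.
Hypothesis sd : second_diff_bound u b.

(** On the left the truncated kernels increase to the full one. On the right the truncated operators
    converge pointwise by the equation and are uniformly bounded on the support of [psi], so
    dominated convergence applies. *)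
Lemma weak_inequality (A E : V * V -> R) (a : R) :
  measurable_fun setT A -> measurable_fun setT E ->
  (forall z, 0 <= A z)%R -> (forall z, 0 <= E z)%R -> (0 <= a)%R ->
  (forall z, A z <= a * ((u z.1 - u z.2) * (psi z.1 - psi z.2)) + E z)%R ->
  (c / 2)%:E * \int[mu \x mu]_z (A z * kern s (z.1 - z.2))%:E <=
  a%:E * \int[mu]_x (psi x * expR (u x))%:E +
  (c / 2)%:E * \int[mu \x mu]_z (E z * kern s (z.1 - z.2))%:E.
Proof.
move=> mA mE A0 E0 a0 AE.
pose e_ n : R := (n.+1%:R^-1)%R.
have e_0 n : (0 < e_ n)%R by rewrite invr_gt0.
have lhs : (c / 2)%:E * \int[mu \x mu]_z (A z * tkern s (outer (e_ n)) (z.1 - z.2))%:E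
    @[n --> \oo] --> (c / 2)%:E * \int[mu \x mu]_z (A z * kern s (z.1 - z.2))%:E.
  apply: cvgeZl => //.
  have : forall z, (A z * tkern s (outer (e_ n)) (z.1 - z.2))%:E @[n --> \oo]
      --> (A z * kern s (z.1 - z.2))%:E.
    move=> z; apply: cvg_EFin; first exact: nearW.
    apply: cvgM; first exact: cvg_cst.
    rewrite /= /tkern.
    have [z0|z0] := eqVneq (z.1 - z.2)%R 0%R.
      rewrite z0 kern0//; under eq_fun do rewrite mul0r.
      exact: cvg_cst.
    have ez0 : (0 < eucl (z.1 - z.2))%R.
      by rewrite lt_neqAle eucl_ge0 andbT eq_sym; apply: contra z0 => /eqP/eucl_eq0 ->.
    apply: (@cvg_near_cst).
    near=> n; rewrite indicE mem_set ?mulr1// /outer/=.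
    apply: ltW; near: n; exact: near_infty_natSinv_lt (PosNum ez0).
  move=> cv.
  have mn n : measurable_fun setT (fun z => (A z * tkern s (outer (e_ n)) (z.1 - z.2))%:E).
    by apply/measurable_EFinP; apply: measurable_funM => //; exact: measurable_tkern_sub.
  have := @cvg_monotone_convergence _ _ _ (mu \x mu) _ measurableT
    (fun n z => (A z * tkern s (outer (e_ n)) (z.1 - z.2))%:E) mn.
  rewrite (_ : \int[mu \x mu]_z limn _ = \int[mu \x mu]_z (A z * kern s (z.1 - z.2))%:E).
    apply.
    - by move=> n z _; rewrite lee_fin mulr_ge0 ?tkern_ge0.
    - move=> z _ n m nm; rewrite lee_fin ler_wpM2l// /tkern ler_wpM2l ?kern_ge0// !indicE ler_nat.
      case: (boolP (_ \in outer (e_ n))) => // h; rewrite mem_set//.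
      move: h; rewrite inE /outer/=; apply: le_trans.
      by rewrite lef_pV2 ?posrE// ler_nat.
  by apply: eq_integral => z _; apply/cvg_lim => //; exact: cv.
have rhs : a%:E * \int[mu]_x (psi x * frac_lap_trunc s u x (e_ n))%:E
    @[n --> \oo] --> a%:E * \int[mu]_x (psi x * expR (u x))%:E.
  apply: cvgeZl => //.
  have [M Mpsi] := bpsi.
  have [C C0 hC] := tint_outer_bounded s0 cu uW M sb sd.
  have ipsi := integrable_bounded_support cpsi bpsi.
  have c0 : (0 <= c)%R by exact: frac_const_ge0.
  apply: (@dominated_cvg _ _ _ mu _ measurableT _ _ (fun x => (c * C)%:E * `|(psi x)%:E|)).
  - move=> n.
    rewrite (_ : (fun x => _) = (fun x => c%:E * \int[mu]_y (pairing (e_ n) (x, y))%:E)).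
      apply: measurable_funeM.
      exact: (measurable_fubini_F (integrable_pairing (e_0 n))).
    apply/funext => x; rewrite frac_lap_truncE.
    have it : mu.-integrable setT (fun y => ((u x - u y) * tkern s (outer (e_ n)) (x - y))%:E).
      by apply: (integrable_tint s0 cu uW _ _ (e_0 n)) => //; exact: measurable_outer.
    have tf : tint s u (outer (e_ n)) x \is a fin_num by exact: integrable_fin_num it.
    rewrite (_ : \int[mu]_y _ = (psi x)%:E * tint s u (outer (e_ n)) x).
      by rewrite -{2}(fineK tf) -!EFinM mulrCA.
    by rewrite /tint -integralZl//.
  - move=> x _; apply: cvg_EFin; first exact: nearW.
    apply: cvgM; first exact: cvg_cst.
    have e_cvg : (forall n, 0 < e_ n)%R /\ e_ @ \oo --> 0%R.
      by split => //; exact: cvg_harmonic.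
    exact: ((cvg_at_rightP (frac_lap_trunc s u x) 0%R (expR (u x))).1 (@sol x) e_ e_cvg).
  - by move=> x _; rewrite fin_numM//.
  - apply: integrableZl => //; exact: integrable_abse.
  - move=> n x _; rewrite /= lee_fin normrM [leLHS]mulrC.
    have [Mx|xM] := ltP M `|x|%R; first by rewrite Mpsi// normr0 !mulr0.
    rewrite ler_wpM2r// frac_lap_truncE normrM (ger0_norm c0) ler_wpM2l//.
    have it : mu.-integrable setT (fun y => ((u x - u y) * tkern s (outer (e_ n)) (x - y))%:E).
      by apply: (integrable_tint s0 cu uW _ _ (e_0 n)) => //; exact: measurable_outer.
    have tf : tint s u (outer (e_ n)) x \is a fin_num by exact: integrable_fin_num it.
    by have := hC _ _ (e_0 n) xM; rewrite -{1}(fineK tf) lee_fin.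
apply: (lee_cvg_to lhs).
  apply: cvgeD; [|exact: rhs|exact: cvg_cst].
  rewrite fin_num_adde_defr// fin_numM//.
  have [M Mpsi] := bpsi.
  have := @integrable_bounded_support (fun x => psi x * expR (u x))%R
    (continuous_funM cpsi (continuous_funexp cu)).
  move=> /(_ _)/integrable_fin_num; apply => //.
  by exists M => x /Mpsi ->; rewrite mul0r.
by apply: nearW => n; apply: truncated_inequality.
Unshelve. all: by end_near. Qed.

End weak_inequality.

(** * The Caccioppoli inequality *)

Section pointwise_inequality.
Context {R : realType}.

(** The trapezoid rule overestimates the integral of the convex exponential over [[0, t]]. The
    difference of the two sides has derivative [1 - expR x + x * expR x], nonnegative because
    [1 - x <= expR (- x)]. *)
Lemma expR_trapezoid (t : R) : 0 <= t -> 2 * (expR t - 1) <= t * (expR t + 1).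
Proof.
move=> t0.
pose f (t : R) := t * (expR t + 1) - 2 * (expR t - 1).
have df x : is_derive x (1 : R) f (1 - expR x + x * expR x).
  rewrite (_ : 1 - expR x + x * expR x =
    (x *: (expR x + 0) + (expR x + 1) *: 1) - 2 *: (expR x - 0)); last first.
    by rewrite /GRing.scale/=; ring.
  have dE1 : is_derive x (1 : R) (expR \+ cst 1) (expR x + 0).
    exact: (@is_deriveD _ _ _ _ _ _ _ _ _ (is_derive_expR x) (is_derive_cst _ _ _)).
  have dE2 : is_derive x (1 : R) (expR \- cst 1) (expR x - 0).
    exact: (@is_deriveB _ _ _ _ _ _ _ _ _ (is_derive_expR x) (is_derive_cst _ _ _)).
  have dM := @is_deriveM _ _ _ _ _ _ _ _ (is_derive_id x (1 : R)) dE1.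
  exact: (@is_deriveB _ _ _ _ _ _ _ _ _ dM (@is_deriveZ _ _ _ _ 2 _ _ _ dE2)).
have [->|tn0] := eqVneq t 0; first by rewrite expR0 subrr mulr0 mul0r.
have tp : 0 < t by rewrite lt_neqAle eq_sym tn0.
have cf : continuous f.
  by move=> x; apply/differentiable_continuous/derivable1_diffP; have [] := df x.
have [c] := MVT tp (fun x _ => df x) (continuous_subspaceT cf).
rewrite in_itv/= => /andP[c0 ct].
have f0 : f 0 = 0 by rewrite /f expR0 subrr mulr0 mul0r subr0.
rewrite f0 !subr0 => ft.
have h : 0 <= 1 - expR c + c * expR c.
  have := expR_ge1Dx (- c) => h.
  have e0 := expR_gt0 c.
  have E : expR (- c) * expR c = 1 by rewrite -expRD addNr expR0.
  nra.
have : 0 <= f t by rewrite ft mulr_ge0// ltW.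
by rewrite /f subr_ge0.
Qed.

(** With [X = (E - 1) * p] and [D = q - p] the left square is that of [X - D], and the trapezoid
    bound makes the main term at least [2 * X ^+ 2]. Young's inequality spends [d / 2 * X ^+ 2] on
    each of two cross terms: this is the loss from 2 to [2 - d], and [10 / d] is [2 / d + 8 / d]. *)
Lemma cutoff_quadratic (t E p q d : R) : 0 <= t -> t <= E - 1 -> 0 < d <= 1 ->
  2 * (E - 1) <= t * (E + 1) ->
  (2 - d) * (E * p - q) ^+ 2 <=
    t * (E ^+ 2 * p ^+ 2 - q ^+ 2) + (10 / d + 3) * ((E ^+ 2 + 1) * (p - q) ^+ 2).
Proof.
move=> t0 tE /andP[d0 d1] tr.
have x0 : 0 <= E - 1 by exact: le_trans tE.
pose X := (E - 1) * p; pose D := q - p.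
have key : 2 * X ^+ 2 <= t * (E ^+ 2 - 1) * p ^+ 2.
  have : 0 <= (E - 1) * (t * (E + 1) - 2 * (E - 1)) by apply: mulr_ge0 => //; rewrite subr_ge0.
  move=> /(mulr_ge0 (sqr_ge0 p)) h; rewrite /X -subr_ge0.
  by rewrite (_ : _ - _ = p ^+ 2 * ((E - 1) * (t * (E + 1) - 2 * (E - 1)))) //; ring.
have tp2 : t ^+ 2 * p ^+ 2 <= X ^+ 2.
  by rewrite /X exprMn ler_wpM2r ?sqr_ge0// lerXn2r ?nnegrE.
have dn0 : d != 0 by rewrite gt_eqF.
have c1 : 2 * (t * p) * D <= d / 2 * (t ^+ 2 * p ^+ 2) + 2 / d * D ^+ 2.
  have : 0 <= d / 2 * (t * p - 2 / d * D) ^+ 2 by rewrite mulr_ge0 ?sqr_ge0// divr_ge0// ltW.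
  move=> h; rewrite -subr_ge0 [leRHS](_ : _ = d / 2 * (t * p - 2 / d * D) ^+ 2)//.
  by field.
have c2 : - (2 * (2 - d)) * X * D <= d / 2 * X ^+ 2 + 8 / d * D ^+ 2.
  have h : 0 <= d / 2 * (X + 2 * (2 - d) / d * D) ^+ 2 by rewrite mulr_ge0 ?sqr_ge0// divr_ge0// ltW.
  have h2 : 0 <= (8 - 2 * (2 - d) ^+ 2) / d * D ^+ 2.
    by rewrite mulr_ge0 ?sqr_ge0// divr_ge0 ?(ltW d0)//; nra.
  rewrite -subr_ge0; apply: le_trans (addr_ge0 h h2) _.
  by rewrite le_eqVlt; apply/orP; left; apply/eqP; field.
have c3 : d / 2 * (t ^+ 2 * p ^+ 2) <= d / 2 * X ^+ 2 by rewrite ler_wpM2l// divr_ge0// ltW.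
have D2 := sqr_ge0 D.
have c4 : (2 - d) * D ^+ 2 + t * D ^+ 2 <= 3 * ((E ^+ 2 + 1) * D ^+ 2).
  rewrite -mulrDl mulrA ler_wpM2r//; nra.
have c5 : 10 / d * D ^+ 2 <= 10 / d * ((E ^+ 2 + 1) * D ^+ 2).
  by rewrite ler_wpM2l ?divr_ge0 ?(ltW d0)// ler_peMl// lerDr sqr_ge0.
have -> : E * p - q = X - D by rewrite /X /D; ring.
have -> : (p - q) ^+ 2 = D ^+ 2 by rewrite /D; ring.
have -> : q = p + D by rewrite /D; ring.
have c6 : 10 / d * D ^+ 2 = 2 / d * D ^+ 2 + 8 / d * D ^+ 2 by field.
rewrite [(10 / d + 3) * _]mulrDl.
have -> : (2 - d) * (X - D) ^+ 2 = (2 - d) * X ^+ 2 + - (2 * (2 - d)) * X * D + (2 - d) * D ^+ 2 by ring.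
have -> : t * (E ^+ 2 * p ^+ 2 - (p + D) ^+ 2) = t * (E ^+ 2 - 1) * p ^+ 2 - 2 * (t * p) * D - t * D ^+ 2 by ring.
lra.
Qed.

(* Nonlocal counterpart of
   2 |grad (w phi)|^2 = al grad u . grad (w^2 phi^2)
                        + 2 al w^2 phi grad u . grad phi + 2 w^2 |grad phi|^2,
   w = exp (al u); absorbing the cross term lowers 2 to 1 + al / 2. *)
Lemma expR_pointwise (al : R) : 0 <= al < 2 -> exists2 C : R, 0 <= C &
  forall a b p q : R,
  (1 + al / 2) * (expR (al * a) * p - expR (al * b) * q) ^+ 2 <=
  al * ((a - b) * (expR (al * a) ^+ 2 * p ^+ 2 - expR (al * b) ^+ 2 * q ^+ 2))
  + C * ((expR (al * a) ^+ 2 + expR (al * b) ^+ 2) * (p - q) ^+ 2).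
Proof.
move=> /andP[al0 al2]; pose d := 1 - al / 2.
have d01 : 0 < d <= 1 by rewrite /d; apply/andP; split; lra.
have d0 : 0 < d by case/andP: d01.
exists (10 / d + 3); first by rewrite addr_ge0// divr_ge0// ltW.
have main a b p q : b <= a ->
  (1 + al / 2) * (expR (al * a) * p - expR (al * b) * q) ^+ 2 <=
  al * ((a - b) * (expR (al * a) ^+ 2 * p ^+ 2 - expR (al * b) ^+ 2 * q ^+ 2))
  + (10 / d + 3) * ((expR (al * a) ^+ 2 + expR (al * b) ^+ 2) * (p - q) ^+ 2).
  (* Factoring out [expR (al * b) ^+ 2] leaves only the ratio [expR t] of the two exponentials. *)
  move=> ba; pose t := al * (a - b).
  have t0 : 0 <= t by rewrite mulr_ge0// subr_ge0.
  have tE : t <= expR t - 1 by rewrite lerBrDl expR_ge1Dx.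
  have E : expR (al * a) = expR (al * b) * expR t.
    by rewrite -expRD; congr expR; rewrite /t; ring.
  have := cutoff_quadratic p q t0 tE d01 (expR_trapezoid t0).
  move=> /(ler_wpM2l (sqr_ge0 (expR (al * b)))); rewrite E.
  set B := expR (al * b); set Et := expR t => h.
  rewrite (_ : 1 + al / 2 = 2 - d); last by rewrite /d; ring.
  apply: (le_trans _ (le_trans h _)); rewrite le_eqVlt; apply/orP; left; apply/eqP.
    by ring.
  by rewrite /t; ring.
move=> a b p q; have [ab|ba] := leP b a; first exact: main.
have := main b a q p (ltW ba).
rewrite -(opprB (expR (al * b) * q)) sqrrN.
rewrite -(opprB q p) sqrrN -(opprB b a) -(opprB (expR (al * b) ^+ 2 * q ^+ 2)) mulrNN.
by rewrite [expR (al * a) ^+ 2 + _]addrC.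
Qed.

End pointwise_inequality.

(** * Caccioppoli estimate from stability *)

Section caccioppoli.
Local Open Scope ereal_scope.
Context {R : realType} {N : nat}.
Variables (s : R) (u : 'rV[R]_N -> R).
Hypothesis s01 : (0 < s)%R.
Local Notation mu := (@lebesgueN R N).
Local Notation V := 'rV[R]_N.
Local Notation c := (frac_const N s).
Hypothesis cu : continuous u.
Hypothesis uW : \int[mu]_x (`|u x| / (1 + eucl x) `^ (N%:R + 2 * s))%:E < +oo.
Hypothesis sol : forall x, is_frac_lap s u x (expR (u x)).
Hypothesis stab : is_stable s u.
Variable b : R.
Hypothesis sb : (2 * s < b)%R.
Hypothesis sd : second_diff_bound u b.

(** Nonlocal analogue of the squared gradient of [phi] at [x]. *)
Definition energy_at (phi : V -> R) (x : V) : \bar R :=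
  \int[mu]_y (energy_density s phi (x, y))%:E.

Lemma energy_at_ge0 phi x : 0 <= energy_at phi x.
Proof. by apply: integral_ge0 => y _; rewrite lee_fin energy_density_ge0. Qed.

Lemma measurable_energy_at phi : measurable_fun setT phi ->
  measurable_fun setT (energy_at phi).
Proof.
move=> mphi; apply: (@measurable_fun_fubini_tonelli_F _ _ _ _ _ mu
  (fun z : V * V => (energy_density s phi z)%:E)).
  by apply/measurable_EFinP; exact: measurable_energy_density.
by move=> z; rewrite lee_fin energy_density_ge0.
Qed.

(** Swapping the two points shows that both weights contribute equally; the resulting 2 cancels
    against [c / 2]. *)
Lemma integral_weighted_energy_density (w phi : V -> R) :
  measurable_fun setT w -> (forall x, 0 <= w x)%R -> measurable_fun setT phi ->
  \int[mu \x mu]_z ((w z.1 + w z.2) * energy_density s phi z)%:E =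
  2%:E * \int[mu]_x ((w x)%:E * energy_at phi x).
Proof.
move=> mw w0 mphi.
pose F (z : V * V) : \bar R := (w z.1 * energy_density s phi z)%:E.
have F0 z : 0 <= F z by rewrite lee_fin mulr_ge0 ?energy_density_ge0.
have mF : measurable_fun setT F.
  apply/measurable_EFinP; apply: measurable_funM.
    exact: (measurableT_comp mw measurable_fst).
  exact: measurable_energy_density.
have FE : \int[mu \x mu]_z F z = \int[mu]_x ((w x)%:E * energy_at phi x).
  rewrite fubini_tonelli1//; apply: eq_integral => x _.
  rewrite /fubini_F /energy_at -ge0_integralZl//=.
  - apply/measurable_EFinP.
    exact: (measurableT_comp (measurable_energy_density s mphi) (measurable_pair1 x)).
  - by move=> y _; rewrite lee_fin energy_density_ge0.
  - by rewrite lee_fin.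
rewrite (eq_integral (fun z => F z + F (z.2, z.1))); last first.
  move=> z _; rewrite /F -EFinD; congr (_%:E); rewrite /energy_density/=.
  rewrite -(opprB z.1) kernN -(opprB (phi z.1)) sqrrN; ring.
have mS : measurable_fun setT (fun z => F (z.2, z.1)).
  exact: (measurableT_comp mF (@measurable_swap _ _ V V)).
rewrite (ge0_integralD _ measurableT (fun z _ => F0 z) mF (fun z _ => F0 (z.2, z.1)) mS).
clearbody F.
have /= -> := ge0_integral_swap mu mF F0.
by rewrite FE -[2%:E]/((1 + 1)%:E) EFinD ge0_muleDl ?lee_fin// mul1e.
Qed.

Lemma caccioppoli (m : R) : (0 <= m < 4)%R -> exists2 C : R, (0 <= C)%R &
  forall phi : V -> R, continuous phi -> bounded_support phi ->
  \int[mu]_x (expR ((m + 1) * u x) * phi x ^+ 2)%:E <=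
  C%:E * \int[mu]_x ((expR (m * u x))%:E * energy_at phi x).
Proof.
move=> /andP[m0 m4]; pose al := (m / 2)%R.
have al02 : (0 <= al < 2)%R by rewrite /al; apply/andP; split; lra.
have [C C0 hC] := expR_pointwise al02.
have al0 : (0 <= al)%R by case/andP: al02.
have al2 : (0 < 1 - al / 2)%R by case/andP: al02 => _ h; lra.
have c0 : (0 <= c)%R by exact: frac_const_ge0.
pose W (x : V) : R := expR (al * u x).
have cW : continuous W.
  by apply: continuous_funexp; apply: continuous_funM => //; exact: cst_continuous.
exists (c * C / (1 - al / 2))%R; first by apply: divr_ge0; [exact: mulr_ge0|exact: ltW].
move=> phi cphi bphi.
have [M Mphi] := bphi.
have mphi := continuous_measurable_rV cphi.
have mW := continuous_measurable_rV cW.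
pose Wphi (x : V) := (W x * phi x)%R.
have cWphi : continuous Wphi by exact: continuous_funM.
have bWphi : bounded_support Wphi by exists M => x /Mphi; rewrite /Wphi => ->; rewrite mulr0.
(* With this choice [psi * expR u] is the stability integrand of [Wphi], so both inequalities
   involve the same integral. *)
pose psi (x : V) := (Wphi x ^+ 2)%R.
have cpsi : continuous psi by exact: continuous_funX2.
have bpsi : bounded_support psi by exists M => x /Mphi; rewrite /psi /Wphi => ->; rewrite mulr0 expr0n.
pose A (z : V * V) : R := ((1 + al / 2) * (Wphi z.1 - Wphi z.2) ^+ 2)%R.
pose E (z : V * V) : R := (C * ((W z.1 ^+ 2 + W z.2 ^+ 2) * (phi z.1 - phi z.2) ^+ 2))%R.
have mfst (f : V -> R) : measurable_fun setT f -> measurable_fun setT (fun z : V * V => f z.1).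
  by move=> mf; exact: (measurableT_comp mf measurable_fst).
have msnd (f : V -> R) : measurable_fun setT f -> measurable_fun setT (fun z : V * V => f z.2).
  by move=> mf; exact: (measurableT_comp mf measurable_snd).
have mWphi := continuous_measurable_rV cWphi.
have mA : measurable_fun setT A.
  apply: measurable_funM => //; apply: measurable_funX.
  by apply: measurable_funB; [exact: mfst|exact: msnd].
have mE : measurable_fun setT E.
  apply: measurable_funM => //; apply: measurable_funM.
    by apply: measurable_funD; apply: measurable_funX; [exact: mfst|exact: msnd].
  by apply: measurable_funX; apply: measurable_funB; [exact: mfst|exact: msnd].
have A0 z : (0 <= A z)%R by rewrite mulr_ge0 ?sqr_ge0// addr_ge0// divr_ge0.
have E0 z : (0 <= E z)%R by apply/mulr_ge0/mulr_ge0; rewrite ?sqr_ge0// addr_ge0 ?sqr_ge0.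
have AE z : (A z <= al * ((u z.1 - u z.2) * (psi z.1 - psi z.2)) + E z)%R.
  by have := hC (u z.1) (u z.2) (phi z.1) (phi z.2); rewrite /A /E /psi /Wphi !exprMn.
have := weak_inequality s01 cu uW cpsi bpsi sol sb sd mA mE A0 E0 al0 AE.
rewrite (eq_integral (fun z => (1 + al / 2)%:E * (energy_density s Wphi z)%:E)); last first.
  by move=> z _; rewrite -EFinM /A /energy_density -mulrA.
rewrite ge0_integralZl//=; last 3 first.
- by apply/measurable_EFinP; exact: measurable_energy_density.
- by move=> z _; rewrite lee_fin energy_density_ge0.
- by rewrite lee_fin addr_ge0// divr_ge0.
rewrite -energy_prodE//.
rewrite [X in _ + _ * X](eq_integral (fun z => C%:E * ((W z.1 ^+ 2 + W z.2 ^+ 2) * energy_density s phi z)%:E));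
  last first.
  by move=> z _; rewrite -EFinM /E /energy_density; congr (_%:E); ring.
rewrite ge0_integralZl//=; last 2 first.
- apply/measurable_EFinP; apply: measurable_funM; last exact: measurable_energy_density.
  by apply: measurable_funD; apply: measurable_funX; [exact: mfst|exact: msnd].
- by move=> z _; rewrite lee_fin mulr_ge0 ?energy_density_ge0// addr_ge0 ?sqr_ge0.
rewrite (@integral_weighted_energy_density (fun x => W x ^+ 2)%R)//; last 2 first.
- exact: measurable_funX.
- by move=> x; exact: sqr_ge0.
have W2 x : (W x ^+ 2 = expR (m * u x))%R.
  by rewrite /W expr2 -expRD; congr expR; rewrite /al; field.
rewrite [X in _ * (_ * (_ * X))](eq_integral (fun x => (expR (m * u x))%:E * energy_at phi x)); last first.
  by move=> x _; rewrite W2.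
set J := \int[mu]_x ((expR (m * u x))%:E * energy_at phi x).
rewrite [X in X <= (_ / _)%:E * _](eq_integral (fun x => (psi x * expR (u x))%:E)); last first.
  by move=> x _; rewrite /psi /Wphi exprMn W2 mulrDl mul1r expRD; congr (_%:E); ring.
(* Finiteness is what allows [al * I] to be moved to the other side below. *)
have If : \int[mu]_x (psi x * expR (u x))%:E \is a fin_num.
  apply: (@integrable_fin_num _ _ _ mu _ measurableT).
  apply: (@integrable_bounded_support _ _ (fun x => psi x * expR (u x))%R).
    by apply: continuous_funM => //; exact: continuous_funexp.
  by exists M => x /Mphi; rewrite /psi /Wphi => ->; rewrite mulr0 expr0n mul0r.
have : \int[mu]_x (psi x * expR (u x))%:E <= (c / 2)%:E * energy s Wphi.
  apply: le_trans (stable_at_continuous cu s01 stab cWphi bWphi).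
  by rewrite le_eqVlt; apply/orP; left; apply/eqP/eq_integral => x _; rewrite mulrC.
have J0 : 0 <= J by apply: integral_ge0 => x _; rewrite mule_ge0 ?lee_fin ?expR_ge0 ?energy_at_ge0.
have e0 : 0 <= energy s Wphi
  by rewrite energy_prodE//; apply: integral_ge0 => z _; rewrite lee_fin energy_density_ge0.
move: If; set I := \int[mu]_x _; move=> If Ie.
have I0 : 0 <= I by apply: integral_ge0 => x _; rewrite lee_fin mulr_ge0 ?sqr_ge0 ?expR_ge0.
move=> main.
have {}main : (1 + al / 2)%:E * I <= al%:E * I + (c * C)%:E * J.
  apply: (@le_trans _ _ ((1 + al / 2)%:E * ((c / 2)%:E * energy s Wphi))).
    by rewrite lee_wpmul2l// lee_fin addr_ge0// divr_ge0.
  rewrite muleCA; apply: (le_trans main); rewrite leeD2l//.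
  rewrite [leLHS](_ : _ = (c / 2)%:E * (C%:E * 2%:E) * J); last by rewrite !muleA.
  rewrite -!EFinM (_ : c / 2 * (C * 2) = c * C)%R//; by field.
(* An infinite [J] makes the claim trivial unless [c * C = 0]. In that case [0 * +oo = 0], and
   [(1 + al / 2) * I <= al * I] forces [I] to vanish. *)
have [Joo|Jfin] := eqVneq J +oo.
  have [cC0|cC] := eqVneq (c * C)%R 0%R.
    move: main; rewrite cC0 mul0r !mul0e adde0 -(fineK If) -!EFinM !lee_fin => h.
    have : (0 <= fine I)%R by rewrite fine_ge0.
    by move=> ?; nra.
  rewrite Joo gt0_muley ?leey//.
  by rewrite lte_fin divr_gt0// lt_neqAle eq_sym cC mulr_ge0.
have Jf : J \is a fin_num by rewrite ge0_fin_numE// ltey.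
move: main; rewrite -(fineK If) -(fineK Jf) -!EFinM -EFinD !lee_fin => main.
rewrite mulrAC ler_pdivlMr//; lra.
Qed.

End caccioppoli.

Lemma ge0_integral_cover_le d (T : measurableType d) (R : realType)
    (mu : {measure set T -> \bar R}) (g f1 f2 : T -> \bar R) (D1 D2 : set T) :
  measurable D1 -> measurable D2 -> measurable_fun setT g ->
  measurable_fun setT f1 -> measurable_fun setT f2 ->
  (forall x, 0 <= g x)%E -> (forall x, 0 <= f1 x)%E -> (forall x, 0 <= f2 x)%E ->
  (forall x, g x <= (f1 \_ D1) x + (f2 \_ D2) x)%E ->
  (\int[mu]_x g x <= \int[mu]_(x in D1) f1 x + \int[mu]_(x in D2) f2 x)%E.
Proof.
move=> mD1 mD2 mg mf1 mf2 g0 f10 f20 gf.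
have mr D (f : T -> \bar R) : measurable D -> measurable_fun setT f ->
    measurable_fun setT (f \_ D).
  by move=> mD mf; apply/(measurable_restrictT _ mD); exact: measurable_funTS.
have r0 D (f : T -> \bar R) : (forall x, 0 <= f x)%E -> (forall x, 0 <= (f \_ D) x)%E.
  by move=> f0 x; exact: erestrict_ge0.
rewrite [X in (_ <= X + _)%E]integral_mkcond [X in (_ <= _ + X)%E]integral_mkcond.
rewrite -ge0_integralD//.
- apply: ge0_le_integral => //.
  by apply: emeasurable_funD; exact: mr.
- by move=> x _; exact: r0.
- exact: mr.
- by move=> x _; exact: r0.
- exact: mr.
Qed.

(** * Growth of exponential integrals *)

Section cutoff.
Context {R : realType} {N : nat}.
Local Notation V := 'rV[R]_N.
Local Notation mu := (@lebesgueN R N).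

Definition clamp (t : R) : R := Num.max 0 (Num.min 1 t).

Lemma clamp_bounds t : 0 <= clamp t <= 1.
Proof. by rewrite /clamp le_max lexx/= ge_max ler01 ge_min lexx. Qed.

Lemma clamp_lipschitz t t' : `|clamp t - clamp t'| <= `|t - t'|.
Proof.
wlog tt : t t' / t <= t'.
  by move=> h; case: (leP t t') => [|/ltW] /h//; rewrite distrC [leRHS]distrC.
rewrite distrC [leRHS]distrC [leRHS]ger0_norm ?subr_ge0// ger0_norm.
  by rewrite /clamp /Num.max /Num.min; do !case: ifPn; rewrite -?leNgt => *; lra.
by rewrite subr_ge0 /clamp /Num.max /Num.min; do !case: ifPn; rewrite -?leNgt => *; lra.
Qed.

(** Piecewise linear in the norm, falling from 1 at [r] to 0 at [2 * r]; such a non-smooth function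
    is admissible because stability has been extended. *)
Definition cutoff (r : R) (x : V) : R := clamp (2 - `|x| / r).

Variable r : R.
Hypothesis r0 : 0 < r.

Lemma cutoff_in x : `|x| <= r -> cutoff r x = 1.
Proof.
rewrite -[X in _ <= X]mul1r -ler_pdivrMr// => xr.
by rewrite /cutoff /clamp min_l ?max_r ?ler01//; lra.
Qed.

Lemma cutoff_out x : 2 * r < `|x| -> cutoff r x = 0.
Proof.
rewrite -ltr_pdivlMr// => xr.
rewrite /cutoff /clamp max_l// ge_min; apply/orP; right; lra.
Qed.

Lemma cutoff_bounds x : 0 <= cutoff r x <= 1.
Proof. exact: clamp_bounds. Qed.

Lemma cutoff_lipschitz x y : `|cutoff r x - cutoff r y| <= `|x - y| / r.
Proof.
apply: (le_trans (clamp_lipschitz _ _)).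
rewrite (_ : _ - _ = (`|y| - `|x|) / r); last by ring.
rewrite normrM [`|r^-1|]ger0_norm ?invr_ge0 ?(ltW r0)//.
by rewrite ler_pM2r ?invr_gt0// (distrC x) ler_dist_dist.
Qed.

Lemma cutoff_continuous : continuous (cutoff r).
Proof.
move=> x; apply/rV_continuousP => e e0.
have er0 : 0 < e * r by exact: mulr_gt0.
apply: (filterS _ (@nbhsx_ballx _ V x _ er0)) => y; rewrite -ball_normE /ball_/= => xy.
by apply: (le_trans (cutoff_lipschitz x y)); rewrite ler_pdivrMr// ltW.
Qed.

Lemma cutoff_bounded_support : bounded_support (cutoff r).
Proof. by exists (2 * r); exact: cutoff_out. Qed.

Lemma cutoff_sqr_le1 x y : (cutoff r x - cutoff r y) ^+ 2 <= 1.
Proof.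
rewrite -[leRHS](expr1n _ 2) -ler_sqrt// sqrtr_sqr expr1n sqrtr1.
have := cutoff_bounds x; have := cutoff_bounds y; rewrite ler_norml; lra.
Qed.

End cutoff.

(** * Energy density of the cutoff at scale [r] *)

Section cutoff_energy.
Local Open Scope ereal_scope.
Context {R : realType} {N : nat}.
Local Notation V := 'rV[R]_N.
Local Notation mu := (@lebesgueN R N).
Variable s : R.
Hypothesis s0 : (0 < s)%R.
Local Notation p := (N%:R + 2 * s)%R.

(** Within distance [r] the Lipschitz bound gains two powers of the distance, enough for
    integrability because [s < 1]; farther away the squared difference is at most 1 and the kernel
    is integrable. Both parts scale like [r] to the power [- 2 s]. *)
Lemma energy_at_cutoff_le : (s < 1)%R -> exists2 C : R, (0 <= C)%R &
  forall r x, (0 < r)%R -> energy_at s (@cutoff R N r) x <= (C * r `^ (- (2 * s)))%:E.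
Proof.
move=> s1.
have p2N : (p - 2 < N%:R)%R by lra.
have Np : (N%:R < p)%R by rewrite ltrDl mulr_gt0.
have m1 : measurable_fun setT (fun _ : V => 1%R : R) by exact: measurable_cst.
have [C1 C10 head] := integral_head m1 (fun _ => ler01) cube_growth1 (ler0n _ N) p2N.
have [C2 C20 tail] := integral_tail m1 (fun _ => ler01) cube_growth1 (ltW (p_gt0 s0)) Np.
exists (C1 + C2)%R; first by rewrite addr_ge0.
move=> r x r0; rewrite /energy_at.
have mcut := continuous_measurable_rV (@cutoff_continuous R N r r0).
have mE := measurable_energy_density s mcut.
pose g (z : V) : \bar R := (energy_density s (cutoff r) (x, z + x)%R)%:E.
have mEx : measurable_fun setT (fun y : V => (energy_density s (cutoff r) (x, y))%:E).
  by apply/measurable_EFinP; exact: (measurableT_comp mE (measurable_pair1 x)).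
rewrite -(ge0_integral_lebesgueN_shift x mEx); last first.
  by move=> y; rewrite lee_fin energy_density_ge0.
pose f1 (z : V) : \bar R := ((r ^+ 2)^-1)%:E * (1 * `|z| `^ (- (p - 2)))%:E.
pose f2 (z : V) : \bar R := (1 * `|z| `^ (- p))%:E.
have mpow q : measurable_fun setT (fun z : V => (1 * `|z| `^ q)%:E).
  apply/measurable_EFinP; apply: measurable_funM => //; exact: measurable_rV_norm_powR.
have r20 : (0 <= (r ^+ 2)^-1)%R by rewrite invr_ge0 sqr_ge0.
have mD1 : measurable [set z : V | 0 < `|z| <= r]%R by exact: (measurable_rV_normitv `]0%R, r]).
have mD2 : measurable [set z : V | r < `|z|]%R.
  have := @measurable_rV_normitv R N `]r, +oo[; congr measurable.
  by apply/seteqP; split => z /=; rewrite in_itv/= andbT.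
apply: (le_trans (@ge0_integral_cover_le _ _ _ mu g f1 f2 _ _ mD1 mD2 _ _ _ _ _ _ _)).
- exact: (measurableT_comp mEx (measurable_rV_shift x)).
- by apply: measurable_funeM; exact: mpow.
- exact: mpow.
- by move=> z; rewrite lee_fin energy_density_ge0.
- by move=> z; rewrite mule_ge0 ?lee_fin// mul1r powR_ge0.
- by move=> z; rewrite lee_fin mul1r powR_ge0.
- move=> z; rewrite /g /energy_density/= (_ : x - (z + x) = - z)%R; last first.
    by apply/rowP => i; rewrite !mxE; ring.
  rewrite kernN !patchE.
  have [->|z0] := eqVneq z 0%R.
    rewrite kern0// mulr0 !memNset ?adde0//=; last by rewrite normr0 ltxx.
    by rewrite normr0; apply/negP; rewrite -leNgt ltW.
  have nz : (0 < `|z|)%R by rewrite normr_gt0.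
  have kz := kern_le_norm s0 z0.
  have [zr|zr] := leP `|z|%R r.
    rewrite mem_set/= ?nz// memNset/=; last by apply/negP; rewrite -leNgt.
    rewrite adde0 /f1 -EFinM lee_fin mul1r.
    apply: (@le_trans _ _ ((`|z| / r) ^+ 2 * `|z| `^ (- p)))%R.
      apply: ler_pM => //; rewrite ?sqr_ge0 ?kern_ge0//.
      have := @cutoff_lipschitz R N r r0 x (z + x)%R.
      rewrite (_ : x - (z + x) = - z)%R ?normrN; last first.
        by apply/rowP => i; rewrite !mxE; ring.
      by rewrite -[X in _ -> (X <= _)%R]real_normK ?num_real// => h; rewrite lerXn2r ?nnegrE// divr_ge0// ltW.
    rewrite (_ : - (p - 2) = - p + 2)%R; last by ring.
    rewrite powRD_gt0// powR_mulrn ?(ltW nz)// le_eqVlt; apply/orP; left; apply/eqP.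
    by field; rewrite gt_eqF.
  rewrite memNset/=; last by apply/negP; rewrite nz/= -ltNge.
  rewrite mem_set//= add0e lee_fin mul1r -[leRHS]mul1r.
  by apply: ler_pM; rewrite ?sqr_ge0 ?kern_ge0// cutoff_sqr_le1.
rewrite ge0_integralZl//; last first.
  by apply: measurable_funTS; exact: mpow.
have h1 := head r r0; have h2 := tail r r0.
rewrite [((C1 + C2) * _)%R]mulrDl EFinD leeD//; last first.
  by apply: (le_trans h2); rewrite (_ : N%:R - p = - (2 * s))%R//; ring.
apply: le_trans (lee_wpmul2l _ h1) _; first by rewrite lee_fin.
rewrite -EFinM lee_fin mulrCA ler_wpM2l// le_eqVlt; apply/orP; left; apply/eqP.
rewrite (_ : N%:R - (p - 2) = - (2 * s) + 2)%R; last by ring.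
by rewrite powRD_gt0// powR_mulrn ?(ltW r0)// mulrCA mulVf ?mulr1// expf_neq0 ?gt_eqF.
Qed.

(** At such [x] the cutoff vanishes, and only [y] in the cube of radius [2 * r] counts, at distance
    at least half the norm of [x]. The cube has volume [(4 * r) ^+ N], and the halving costs 2 to
    the power [p]. *)
Lemma energy_at_cutoff_far : exists2 C : R, (0 <= C)%R &
  forall r x, (0 < r)%R -> (4 * r < `|x|)%R ->
  energy_at s (@cutoff R N r) x <= (C * r ^+ N * `|x| `^ (- p))%:E.
Proof.
exists (4 ^+ N * 2 `^ p)%R; first by rewrite mulr_ge0 ?exprn_ge0 ?powR_ge0.
move=> r x r0 rx.
have x0 : (0 < `|x|)%R by apply: lt_trans rx; rewrite mulr_gt0.
have x20 : (0 < `|x| / 2)%R by rewrite divr_gt0.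
have mcut := continuous_measurable_rV (@cutoff_continuous R N r r0).
have mE := measurable_energy_density s mcut.
have mEx : measurable_fun setT (fun y : V => (energy_density s (cutoff r) (x, y))%:E).
  by apply/measurable_EFinP; exact: (measurableT_comp mE (measurable_pair1 x)).
have mcube := @measurable_rV_cube R N (2 * r).
pose k : R := ((`|x| / 2) `^ (- p))%R.
apply: (@le_trans _ _ (\int[mu]_(y in [set y : V | `|y| <= 2 * r]%R) k%:E)).
  rewrite [leRHS]integral_mkcond; apply: ge0_le_integral => //.
  - by move=> y _; rewrite lee_fin energy_density_ge0.
  - by apply/(measurable_restrictT _ mcube); exact: measurable_cst.
  move=> y _; rewrite patchE /energy_density/=.
  rewrite (cutoff_out r0 (x := x)); last by lra.
  have [yr|yr] := leP `|y|%R (2 * r)%R; last first.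
    by rewrite memNset/= ?(cutoff_out r0 yr) ?subr0 ?expr0n ?mul0r//; apply/negP; rewrite -ltNge.
  rewrite mem_set//= lee_fin -[leRHS]mul1r; apply: ler_pM; rewrite ?sqr_ge0 ?kern_ge0//.
    have := @cutoff_sqr_le1 R N r x y.
    by rewrite (cutoff_out r0 (x := x)); last by lra.
  have xy : (`|x| / 2 <= `|x - y|)%R by have := lerB_dist x y; lra.
  have xy0 : (0 < `|x - y|)%R by exact: lt_le_trans xy.
  apply: le_trans (kern_le_norm s0 _) _; first by rewrite -normr_gt0.
  rewrite /k !powRN lef_pV2 ?posrE ?powR_gt0//.
  apply: ge0_ler_powR; rewrite ?nnegrE ?(ltW xy0) ?(ltW x20)//.
  by apply/ltW/p_gt0.
rewrite integral_cst// [X in _ * X]lebesgueN_cube; last by rewrite mulr_ge0// ltW.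
rewrite -EFinM lee_fin /k powRM ?(ltW x0)// -powR_inv1// -powRrM mulN1r opprK.
rewrite mulrA (_ : 2 * 2 = 4)%R; last by ring.
by rewrite exprMn le_eqVlt; apply/orP; left; apply/eqP; ring.
Qed.

End cutoff_energy.

(** * Growth exponents and the contradiction *)

Section growth.
Local Open Scope ereal_scope.
Context {R : realType} {N : nat}.
Variables (s : R) (u : 'rV[R]_N -> R).
Hypothesis s01 : (0 < s < 1)%R.
Local Notation mu := (@lebesgueN R N).
Local Notation V := 'rV[R]_N.
Local Notation p := (N%:R + 2 * s)%R.
Hypothesis cu : continuous u.
Hypothesis uW : \int[mu]_x (`|u x| / (1 + eucl x) `^ p)%:E < +oo.
Hypothesis sol : forall x, is_frac_lap s u x (expR (u x)).
Hypothesis stab : is_stable s u.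
Variable b : R.
Hypothesis sb : (2 * s < b)%R.
Hypothesis sd : second_diff_bound u b.

Let s0 : (0 < s)%R. Proof. by case/andP: s01. Qed.

(** The exponent is dictated by scaling: replacing [u (x)] by [u (r x) + 2 s ln r] preserves the
    equation. *)
Definition exp_growth (m : R) := exists C : R,
  cube_growth (fun x : V => expR (m * u x)) C (N%:R - 2 * s * m)%R.

Let mexp m : measurable_fun setT (fun x : V => expR (m * u x)).
Proof.
apply: continuous_measurable_rV; apply: continuous_funexp.
by apply: continuous_funM => //; exact: cst_continuous.
Qed.

Lemma exp_growth0 : exp_growth 0.
Proof.
exists (2 ^+ N)%R => r r0; rewrite mulr0 subr0; apply: le_trans (cube_growth1 r0).
by rewrite le_eqVlt; apply/orP; left; apply/eqP/eq_integral => x _; rewrite mul0r expR0.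
Qed.

(** The cube of radius [4 * r] contributes the power [M - 2 s] of [r] and its complement the power
    [N + (M - p)]; these agree because [p = N + 2 s]. The tail converges since [M < p], also when
    [M] is negative. *)
Lemma exp_growthS (m : R) : (0 <= m < 4)%R -> exp_growth m -> exp_growth (m + 1).
Proof.
move=> m04 [C gC]; have m0 : (0 <= m)%R by case/andP: m04.
have w0 (x : V) : (0 <= expR (m * u x))%R by exact: expR_ge0.
have C0 := cube_growth_ge0 w0 gC.
have [Cc Cc0 cacc] := caccioppoli s0 cu uW sol stab sb sd m04.
have [C1 C10 near_bound] := @energy_at_cutoff_le R N s s0 (proj2 (andP s01)).
have [C2 C20 far_bound] := @energy_at_cutoff_far R N s s0.
set M := (N%:R - 2 * s * m)%R in gC.
have Mp : (M < p)%R.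
  rewrite /M ltrD2l (@le_lt_trans _ _ 0%R)// ?mulr_gt0// oppr_le0.
  by apply: mulr_ge0 => //; rewrite mulr_ge0// ltW.
have [C3 C30 tail] := integral_tail (mexp m) w0 gC (ltW (p_gt0 s0)) Mp.
exists (Cc * (C1 * C * 4 `^ M + C2 * C3 * 4 `^ (M - p)))%R => r r0.
have r40 : (0 < 4 * r)%R by rewrite mulr_gt0.
have cphi := @cutoff_continuous R N r r0.
have mphi := continuous_measurable_rV cphi.
have mcube t := @measurable_rV_cube R N t.
have mD2 : measurable [set z : V | 4 * r < `|z|]%R.
  have := @measurable_rV_normitv R N `](4 * r)%R, +oo[; congr measurable.
  by apply/seteqP; split => z /=; rewrite in_itv/= andbT.
apply: (@le_trans _ _ (\int[mu]_x (expR ((m + 1) * u x) * cutoff r x ^+ 2)%:E)).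
  rewrite integral_mkcond; apply: ge0_le_integral => //.
  - by move=> x _; apply: erestrict_ge0 => y _; rewrite lee_fin expR_ge0.
  - apply/(measurable_restrictT _ (mcube r)); apply: measurable_funTS.
    by apply/measurable_EFinP; exact: mexp.
  - apply/measurable_EFinP; apply: measurable_funM; first exact: mexp.
    exact: measurable_funX.
  move=> x _; rewrite patchE; case: ifPn => [|_].
    by rewrite inE/= lee_fin => xr; rewrite (cutoff_in r0 xr) expr1n mulr1.
  by rewrite lee_fin mulr_ge0 ?expR_ge0 ?sqr_ge0.
apply: (le_trans (cacc _ cphi (cutoff_bounded_support r0))).
rewrite -mulrA EFinM; apply: lee_wpmul2l; first by rewrite lee_fin.
pose f1 (x : V) : \bar R := (C1 * r `^ (- (2 * s)))%:E * (expR (m * u x))%:E.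
pose f2 (x : V) : \bar R := (C2 * r ^+ N)%:E * (expR (m * u x) * `|x| `^ (- p))%:E.
have c10 : (0 <= C1 * r `^ (- (2 * s)))%R by rewrite mulr_ge0 ?powR_ge0.
have c20 : (0 <= C2 * r ^+ N)%R by rewrite mulr_ge0 ?exprn_ge0 ?(ltW r0).
have mw : measurable_fun setT (fun x : V => (expR (m * u x))%:E) by apply/measurable_EFinP; exact: mexp.
have mw2 : measurable_fun setT (fun x : V => (expR (m * u x) * `|x| `^ (- p))%:E).
  apply/measurable_EFinP; apply: measurable_funM; first exact: mexp.
  exact: measurable_rV_norm_powR.
apply: (le_trans (@ge0_integral_cover_le _ _ _ mu
  (fun x => (expR (m * u x))%:E * energy_at s (cutoff r) x) f1 f2 _ _ (mcube (4 * r)%R) mD2 _ _ _ _ _ _ _)).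
- by apply: emeasurable_funM => //; exact: measurable_energy_at.
- exact: measurable_funeM.
- exact: measurable_funeM.
- by move=> x; rewrite mule_ge0 ?lee_fin// energy_at_ge0.
- by move=> x; rewrite mule_ge0 ?lee_fin.
- by move=> x; rewrite mule_ge0 ?lee_fin// mulr_ge0 ?powR_ge0.
- move=> x; rewrite !patchE; have [xr|xr] := leP `|x|%R (4 * r)%R.
    rewrite mem_set// memNset/=; last by apply/negP; rewrite -leNgt.
    rewrite adde0 /f1 [leRHS]muleC; apply: lee_wpmul2l; first by rewrite lee_fin.
    exact: near_bound.
  rewrite memNset/=; last by apply/negP; rewrite -ltNge.
  rewrite mem_set// add0e /f2 -EFinM mulrCA EFinM; apply: lee_wpmul2l; first by rewrite lee_fin.
  exact: far_bound.
rewrite ge0_integralZl//; last by apply: measurable_funTS.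
rewrite ge0_integralZl//; last by apply: measurable_funTS.
apply: (le_trans (leeD (lee_wpmul2l _ (gC _ r40)) (lee_wpmul2l _ (tail _ r40)))); rewrite ?lee_fin//.
rewrite !powRM ?(ltW r0)// le_eqVlt; apply/orP; left; apply/eqP.
have e1 : (r `^ (- (2 * s)) * r `^ M = r `^ (N%:R - 2 * s * (m + 1)))%R.
  by rewrite -powRD_gt0//; congr (_ `^ _)%R; rewrite /M; ring.
have e2 : (r ^+ N * r `^ (M - p) = r `^ (N%:R - 2 * s * (m + 1)))%R.
  by rewrite -powR_mulrn ?(ltW r0)// -powRD_gt0//; congr (_ `^ _)%R; rewrite /M; ring.
rewrite [RHS]mulrDl -{1}e1 -e2; ring.
Qed.

(** Interpolation is pointwise. Put [v = 2 s ln r + u x]: after factoring out [expR (m * u x)], the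
    two terms are the exponentials of [(m1 - m) * v] and [(m2 - m) * v], one of which is at least 1
    according to the sign of [v]. *)
Lemma exp_growth_interpolate (m1 m2 m : R) : (m1 <= m <= m2)%R ->
  exp_growth m1 -> exp_growth m2 -> exp_growth m.
Proof.
move=> /andP[m1m mm2] [C1 g1] [C2 g2]; exists (C1 + C2)%R => r r0.
have rq q : (0 < r `^ q)%R by exact: powR_gt0.
have mc := @measurable_rV_cube R N r.
have mw k : measurable_fun [set x : V | `|x| <= r]%R (fun x : V => (expR (k * u x))%:E).
  by apply: measurable_funTS; apply/measurable_EFinP; exact: mexp.
apply: (@le_trans _ _ (\int[mu]_(x in [set x : V | `|x| <= r]%R)
   ((r `^ (2 * s * (m1 - m)))%:E * (expR (m1 * u x))%:E + (r `^ (2 * s * (m2 - m)))%:E * (expR (m2 * u x))%:E))).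
  apply: ge0_le_integral => //.
  - by apply: emeasurable_funD; exact: measurable_funeM.
  move=> x _; rewrite -!EFinM -EFinD lee_fin.
  have E k : (r `^ (2 * s * (k - m)) * expR (k * u x) =
      expR (m * u x) * expR ((k - m) * (2 * s * ln r + u x)))%R.
    rewrite /powR gt_eqF// -!expRD; congr expR; ring.
  rewrite !E -mulrDr ler_peMr ?expR_ge0//.
  have [h|h] := leP 0%R (2 * s * ln r + u x)%R.
    by rewrite ler_wpDl ?expR_ge0// -[leLHS]expR0 ler_expR mulr_ge0// subr_ge0.
  by rewrite ler_wpDr ?expR_ge0// -[leLHS]expR0 ler_expR mulr_le0// ?subr_le0// ltW.
rewrite ge0_integralD//; last 4 first.
- by move=> x _; rewrite mule_ge0 ?lee_fin ?expR_ge0 ?(ltW (rq _)).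
- exact: measurable_funeM.
- by move=> x _; rewrite mule_ge0 ?lee_fin ?expR_ge0 ?(ltW (rq _)).
- exact: measurable_funeM.
rewrite !ge0_integralZl ?lee_fin ?(ltW (rq _))//.
rewrite [((C1 + C2) * _)%R]mulrDl EFinD; apply: leeD.
  apply: le_trans (lee_wpmul2l _ (g1 _ r0)) _; first by rewrite lee_fin ltW.
  rewrite -EFinM lee_fin mulrCA -powRD_gt0// le_eqVlt; apply/orP; left; apply/eqP.
  by congr (_ * _ `^ _)%R; ring.
apply: le_trans (lee_wpmul2l _ (g2 _ r0)) _; first by rewrite lee_fin ltW.
rewrite -EFinM lee_fin mulrCA -powRD_gt0// le_eqVlt; apply/orP; left; apply/eqP.
by congr (_ * _ `^ _)%R; ring.
Qed.

(** The step does not apply at 4 itself, so [m] is reached from [m - 1] in [[3, 4)], obtained by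
    interpolating between 3 and 4. *)
Lemma exp_growth_lt5 (m : R) : (4 <= m < 5)%R -> exp_growth m.
Proof.
move=> /andP[m4 m5].
have step k : (k < 4)%N -> exp_growth k%:R -> exp_growth k.+1%:R.
  by move=> k4 gk; rewrite -natr1; apply: exp_growthS => //; rewrite ler0n ltr_nat.
have g1 := step 0%N isT exp_growth0.
have g2 := step 1%N isT g1.
have g3 := step 2%N isT g2.
have g4 := step 3%N isT g3.
rewrite -(subrK 1%R m); apply: exp_growthS; first by apply/andP; split; lra.
by apply: (exp_growth_interpolate _ g3 g4); apply/andP; split; lra.
Qed.

(** The integral over the unit cube is a positive lower bound for all larger cubes, which rules out
    a negative exponent as [r] grows. *)
Lemma exp_growth_exponent (m : R) : (0 <= m)%R -> exp_growth m -> (2 * s * m <= N%:R)%R.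
Proof.
move=> m0 [C gC]; rewrite leNgt; apply/negP => Nm.
have w0 (x : V) : (0 <= expR (m * u x))%R by exact: expR_ge0.
have C0 := cube_growth_ge0 w0 gC.
have [B B0 hB] := continuous_cube_bounded 1%R cu.
pose l : R := (expR (- (m * B)) * 2 ^+ N)%R.
have l0 : (0 < l)%R by rewrite mulr_gt0 ?expR_gt0 ?exprn_gt0.
have low r : (1 <= r)%R -> (l <= C * r `^ (N%:R - 2 * s * m))%R.
  move=> r1; rewrite -lee_fin; apply: le_trans (gC r (lt_le_trans ltr01 r1)).
  apply: (@le_trans _ _ (\int[mu]_(x in [set x : V | `|x| <= 1]%R) (expR (- (m * B)))%:E)).
    rewrite integral_cst; last exact: measurable_rV_cube.
    by rewrite [X in _ <= _ * X]lebesgueN_cube// mulr1 /l EFinM.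
  apply: (@le_trans _ _ (\int[mu]_(x in [set x : V | `|x| <= 1]%R) (expR (m * u x))%:E)).
    apply: ge0_le_integral => //; first exact: measurable_rV_cube.
    - by apply: measurable_funTS; apply/measurable_EFinP; exact: mexp.
    move=> x /= x1; rewrite lee_fin ler_expR -mulrN ler_wpM2l// lerNl.
    by rewrite (le_trans _ (hB x x1))// ler_normr lexx orbT.
  apply: ge0_subset_integral => //; [exact: measurable_rV_cube|exact: measurable_rV_cube| |].
    by apply: measurable_funTS; apply/measurable_EFinP; exact: mexp.
  by move=> x /= x1; exact: le_trans r1.
set q := (N%:R - 2 * s * m)%R in low.
have q0 : (q < 0)%R by rewrite subr_lt0.
have Cp : (0 < C)%R.
  have := low 1%R (lexx _); rewrite powR1 mulr1; exact: lt_le_trans.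
(* Then [r] to the power [q] is at most [l / (2 * C)], so the upper bound drops to [l / 2]; the
   absolute value guarantees [1 <= r]. *)
pose r : R := expR ((`|ln (l / (2 * C))|) / (- q)).
have r1 : (1 <= r)%R.
  by rewrite /r -[leLHS]expR0 ler_expR divr_ge0// oppr_ge0 ltW.
have := low r r1; apply/negP; rewrite -ltNge.
rewrite /powR gt_eqF ?expR_gt0// /r expRK.
rewrite (_ : q * (_ / - q) = - `|ln (l / (2 * C))|)%R; last first.
  by field; rewrite lt_eqF.
have lC : (0 < l / (2 * C))%R by rewrite divr_gt0// mulr_gt0.
apply: (@le_lt_trans _ _ (C * (l / (2 * C))))%R.
  rewrite ler_wpM2l ?(ltW Cp)// -[leRHS](lnK lC) ler_expR lerNl.
  by rewrite ler_normr lexx orbT.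
rewrite (_ : C * (l / (2 * C)) = l / 2)%R; last by field; rewrite gt_eqF.
by lra.
Qed.

End growth.

Theorem theorem1p1 (R : realType) (N : nat) (s : R) :
  (1 <= N)%N -> 0 < s < 1 -> N%:R < 10 * s ->
  ~ exists u : 'rV[R]_N -> R, is_solution s u /\ is_stable s u.
Proof.
move=> _ s01 Ns [u [[[sigma ssigma hu] [_ _ uW] sol] stab]].
have s0 : 0 < s by case/andP: s01.
have cu : continuous u by case: hu => -[|k] [g [_ _ [cu _] _]].
have [b sb sd] := holder_space_second_diff s01 ssigma hu.
have N5 : N%:R / (2 * s) < 5 by rewrite ltr_pdivrMr ?mulr_gt0//; lra.
(* Both entries are below 5, the second because [N < 10 * s]. The midpoint of [q] and 5 is then an
   exponent [m] in [[4, 5)] with [N < 2 * s * m]. *)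
pose q := Num.max 4 (N%:R / (2 * s)).
have q5 : q < 5 by rewrite gt_max N5 andbT ltr_nat.
have q4 : 4 <= q by rewrite le_max lexx.
have m45 : 4 <= (q + 5) / 2 < 5 by apply/andP; split; lra.
have Nq : N%:R / (2 * s) <= q by rewrite le_max lexx orbT.
have m0 : 0 <= (q + 5) / 2 by lra.
have := exp_growth_exponent cu m0 (exp_growth_lt5 s01 cu uW sol stab sb sd m45).
apply/negP; rewrite -ltNge mulrC -ltr_pdivrMr ?mulr_gt0//; lra.
Qed.
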